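(* For every $p\ge2$, $\theta>0$, $A_0\ge a_0>0$ and $A_1,A_2,A_3,A_4>0$ there is a constant $C>0$, depending only on $\theta,p,a_0,A_0,A_1,\dots,A_4$, such that the following holds for any measures $\mathbb{P}_N=\mathbb{P}_N^{\theta,M_N}$ as in the context with these constants. Let $\phi_V^{\theta,\mathsf{M}+\theta}$ be the equilibrium measure and $\mu_N$ the empirical measure defined in the context. Then for all $\gamma>0$, all $N\ge2$, and all compactly supported Lipschitz functions $g:\mathbb{R}\to\mathbb{R}$, $$\mathbb{P}_N\left(\left|\int_{\mathbb{R}}g(x)\,\mu_N(dx)-\int_{\mathbb{R}}g(x)\,\phi_V^{\theta,\mathsf{M}+\theta}(x)\,dx\right|\ge\gamma\|g\|_{1/2}+\frac{\theta\|g\|_{\mathrm{Lip}}}{N^p}\right)\le\exp\left(-2\pi^2\gamma^2\theta N^2+C\left(N^2p_N+N^2q_N+N\log N\right)\right).$$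
   Context: Measures. For $\theta>0$, $N\in\mathbb{N}$, $M\in\mathbb{Z}_{\ge0}$ let $\mathbb{W}^{\theta,M}_N$ be the set of $(\ell_1,\dots,\ell_N)$ with $\ell_i=\lambda_i+(N-i)\theta$, where $M\ge\lambda_1\ge\cdots\ge\lambda_N\ge0$ are integers. Put $Q_\theta(x)=\frac{\Gamma(x+1)\Gamma(x+\theta)}{\Gamma(x)\Gamma(x+1-\theta)}$ and, for $\vec\ell\in\mathbb{W}^{\theta,M_N}_N$, $$\mathbb{P}_N^{\theta,M_N}(\vec\ell)=\frac1{Z_N}\prod_{1\le i<j\le N}Q_\theta(\ell_i-\ell_j)\prod_{i=1}^N\exp(-NV_N(\ell_i/N)),$$ with $Z_N$ the normalization constant. The empirical measure is $\mu_N=\mu_N(\vec\ell)=\frac1N\sum_{i=1}^N\delta(\ell_i/N)$. Assumptions. (1) $\theta>0$, $A_0\ge a_0>0$, $\mathsf{M}\in[a_0,A_0]$; $M_N\in\mathbb{Z}_{\ge0}$ and $0\le q_N\le1$ are sequences with $|N^{-1}M_N-\mathsf{M}|\le A_1q_N$. (2) $V_N$ is continuous on $I_N=[0,M_NN^{-1}+(N-1)N^{-1}\theta]$. $V$ is a continuous function on $I=[0,\mathsf{M}+\theta]$, extended to $[0,\infty)$ by $V(x)=V(\mathsf{M}+\theta)$ for $x\ge\mathsf{M}+\theta$. There is a sequence $p_N\ge0$ with $|V_N(s)-V(s)|\le A_2p_N$ for $s\in I_N$, and $|V(s)|\le A_3$ for $s\in I$. $V$ is differentiable on $(0,\mathsf{M}+\theta)$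 with $|V'(s)|\le A_4\left[1+|\log|s||+|\log|s-\mathsf{M}-\theta||\right]$ there. (Here the exponent $p$ and the sequence $p_N$ are unrelated.) Equilibrium measure. For $s\in[\theta,\infty)$ let $\mathcal{A}^\theta_s$ be the set of $\phi\in L^1([0,s])$ with $0\le\phi\le\theta^{-1}$ a.e. and $\int_0^s\phi=1$. $\phi_V^{\theta,s}$ is the (known to exist) unique minimizer over $\mathcal{A}^\theta_s$ of $$I_V^\theta(\phi)=-\theta\iint\log|x-y|\phi(x)\phi(y)\,dx\,dy+\int V(x)\phi(x)\,dx.$$ Norms. $\hat g(t)=\int_{\mathbb{R}}g(x)e^{-itx}dx$, $\|g\|_{1/2}=\left(\int_{\mathbb{R}}|t||\hat g(t)|^2dt\right)^{1/2}$, $\|g\|_{\mathrm{Lip}}=\sup_{x\ne y}\left|\frac{g(x)-g(y)}{x-y}\right|$.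
   Formalization: The function g is additionally assumed not to be identically zero: for g = 0 the event is {0 ≥ 0}, of probability 1, while the right-hand side tends to 0 as γ → ∞, so the claim as printed fails for that g. *)

(* Defs.v *)
From HB Require Import structures.
From mathcomp Require Import all_boot all_order all_algebra.
From mathcomp Require Import complex.
From mathcomp Require Import all_classical all_reals all_analysis.

Set Implicit Arguments.
Unset Strict Implicit.
Unset Printing Implicit Defensive.

Import Order.TTheory GRing.Theory Num.Theory.
Import numFieldNormedType.Exports.

Local Open Scope classical_set_scope.
Local Open Scope ring_scope.

(* Euler's integral; it converges for z > 0, and Q below is only evaluated at
   points x >= theta > 0, where the four arguments of Gamma are positive. *)
Definition Gamma (R : realType) (z : R) : R :=
  \int[@lebesgue_measure R]_(t in `]0, +oo[) (t `^ (z - 1) * expR (- t)).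

Definition Q (R : realType) (theta x : R) : R :=
  (Gamma (x + 1) * Gamma (x + theta)) / (Gamma x * Gamma (x + 1 - theta)).

(* For fixed theta, the map from lambda to ell is injective, so the state space
   is represented by the finite set of the lambda's.  Indices start at 0: entry
   i of the tuple is lambda_{i+1}. *)
Definition state (N M : nat) : {set N.-tuple 'I_M.+1} :=
  [set lam : N.-tuple 'I_M.+1 | sorted (fun a b : 'I_M.+1 => (b <= a)%N) lam].

Definition ell (R : realType) (theta : R) (N M : nat) (lam : N.-tuple 'I_M.+1)
    (i : nat) : R :=
  (nth ord0 lam i)%:R + (N - i.+1)%:R * theta.

Definition weight (R : realType) (theta : R) (N M : nat) (VN : R -> R)
    (lam : N.-tuple 'I_M.+1) : R :=
  (\prod_(0 <= i < N) \prod_(i.+1 <= j < N)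
      Q theta (ell theta lam i - ell theta lam j)) *
  \prod_(0 <= i < N) expR (- (N%:R * VN (ell theta lam i / N%:R))).

Definition partition_function (R : realType) (theta : R) (N M : nat)
    (VN : R -> R) : R :=
  \sum_(lam in state N M) weight theta VN lam.

Definition PN (R : realType) (theta : R) (N M : nat) (VN : R -> R)
    (E : pred (N.-tuple 'I_M.+1)) : R :=
  \sum_(lam in state N M | E lam)
    ((partition_function theta N M VN)^-1 * weight theta VN lam).

Definition empirical_measure (R : realType) (theta : R) (N M : nat)
    (lam : N.-tuple 'I_M.+1) : {measure set R -> \bar R} :=
  mscale (N%:R^-1)%:nng (msum (fun i => \d_(ell theta lam i / N%:R)) N).

Record assumption1 (R : realType) (a0 A0 A1 : R) (MM : R) (M_ : nat -> nat)
    (q_ : nat -> R) : Prop := Assumption1 {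
  a1_MM : a0 <= MM <= A0;
  a1_q : forall N, (0 < N)%N -> 0 <= q_ N <= 1;
  a1_M : forall N, (0 < N)%N -> `|N%:R^-1 * (M_ N)%:R - MM| <= A1 * q_ N }.

Definition IN (R : realType) (theta : R) (N M : nat) : set R :=
  `[0, M%:R / N%:R + (N.-1)%:R / N%:R * theta].

Record assumption2 (R : realType) (theta A2 A3 A4 : R) (MM : R)
    (M_ : nat -> nat) (V_ : nat -> R -> R) (V : R -> R) (p_ : nat -> R) :
    Prop := Assumption2 {
  a2_VN_cont : forall N, (0 < N)%N ->
    {within IN theta N (M_ N), continuous (V_ N)};
  a2_V_cont : {within `[0, MM + theta], continuous V};
  a2_V_ext : forall x : R, MM + theta <= x -> V x = V (MM + theta);
  a2_p : forall N, (0 < N)%N -> 0 <= p_ N;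
  a2_VN_V : forall N, (0 < N)%N ->
    forall s : R, IN theta N (M_ N) s -> `|V_ N s - V s| <= A2 * p_ N;
  a2_V_bound : forall s : R, 0 <= s <= MM + theta -> `|V s| <= A3;
  a2_V_derivable : forall s : R, 0 < s < MM + theta -> derivable V s 1;
  a2_V_derive : forall s : R, 0 < s < MM + theta ->
    `|derive1 V s| <= A4 * (1 + `|ln `|s| | + `|ln `|s - MM - theta| |) }.

(* Functions in L^1([0, s]) are represented by functions on R whose values
   outside [0, s] are irrelevant: all the integrals below are over [0, s]. *)
Definition admissible (R : realType) (theta s : R) (phi : R -> R) : Prop :=
  [/\ (@lebesgue_measure R).-integrable `[0, s] (EFin \o phi),
      {ae @lebesgue_measure R, forall x, 0 <= x <= s ->
         0 <= phi x <= theta^-1} &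
      \int[@lebesgue_measure R]_(x in `[0, s]) phi x = 1].

(* The integrands below are integrable for admissible phi and V continuous on
   [0, s]; on the diagonal z.1 = z.2, a null set, the convention ln 0 = 0
   applies. *)
Definition energy (R : realType) (theta s : R) (V phi : R -> R) : R :=
  - theta * (\int[(@lebesgue_measure R \x @lebesgue_measure R)%E]_(z in
      `[0, s] `*` `[0, s]) (ln `|z.1 - z.2| * phi z.1 * phi z.2)) +
  \int[@lebesgue_measure R]_(x in `[0, s]) (V x * phi x).

Definition equilibrium (R : realType) (theta s : R) (V phi : R -> R) : Prop :=
  admissible theta s phi /\
  forall psi, admissible theta s psi ->
    energy theta s V phi <= energy theta s V psi.

(* exp (i u), by Euler's formula. *)
Definition cexp_i (R : realType) (u : R) : R[i] := (cos u +i* sin u)%C.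

Definition cintegral (R : realType) (f : R -> R[i]) : R[i] :=
  ((\int[@lebesgue_measure R]_x complex.Re (f x)) +i*
   (\int[@lebesgue_measure R]_x complex.Im (f x)))%C.

Definition fourier (R : realType) (g : R -> R) (t : R) : R[i] :=
  cintegral (fun x => (g x)%:C%C * cexp_i (- (t * x))).

(* The integral is finite when g is Lipschitz with compact support, so the
   convention of real-valued integrals for divergent integrals is harmless. *)
Definition norm_half (R : realType) (g : R -> R) : R :=
  Num.sqrt (\int[@lebesgue_measure R]_t
    (`|t| * ComplexField.Normc.normc (fourier g t) ^+ 2)).

Definition norm_lip (R : realType) (g : R -> R) : R :=
  sup [set `|(g z.1 - g z.2) / (z.1 - z.2)|
      | z in [set z : R * R | z.1 != z.2]].

Definition compactly_supported (R : realType) (g : R -> R) : Prop :=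
  compact (closure [set x | g x != 0]).

(* Main.v *)
Require Import Defs.
From HB Require Import structures.
From mathcomp Require Import all_boot all_order all_algebra.
From mathcomp Require Import all_classical all_reals all_analysis.
From mathcomp Require Import measurable_realfun complex zify ring lra.

Set Implicit Arguments.
Unset Strict Implicit.
Unset Printing Implicit Defensive.

Import Order.TTheory GRing.Theory Num.Theory.
Import numFieldNormedType.Exports.

Local Open Scope classical_set_scope.
Local Open Scope ring_scope.


(** Why the inequality holds. Write x_i = ell_i / N. Since Q theta x is x ^ (2 theta) up to a
    factor exp (O (1 / x)), the logarithm of the weight of a configuration is, up to a
    constant that is the same for all configurations and up to O (N ln N + N^2 p_N),

      2 theta sum_(i < j) ln (x_i - x_j) - N sum_i V (x_i),

    which is close to - N^2 times the energy of the density that the configuration mimics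
    ([Q_bounds], [log_weight_coulomb]). Let phi be the minimizer of the energy. It remains to
    bound the normalization from below and the weights in the event from above; the number of
    states is exp (O (N ln N)), so the best weight in the event decides ([gibbs_tail]).

    Lower bound ([configuration_energy_ge]). Round the quantiles of phi down to the lattice.
    The ceiling 1 / theta on densities makes consecutive quantiles theta / N apart, so the
    rounded points form a state. Comparing the interaction of the quantile cells with the
    interaction of the points loses only O (N ln N), and the potential loses O (N) because it
    is dominated by a bounded monotone function. The interval available to the particles and
    the support of phi differ in length by O (q_N), which costs O (N^2 q_N)
    ([redistribute]).

    Upper bound ([configuration_energy_le]). Smear the points of a configuration into boxes
    of the tiny width theta / N ^ p, giving a density psi whose energy is that of the points
    up to O (N ln N), and put nu = psi - phi. Expanding the interaction of psi = phi + nu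
    produces the energy of phi, a linear term, and - theta logE nu nu. The linear term is
    nonnegative up to O (ln N / N + q_N) by the first-order optimality of phi
    ([variational_inequality]): the same points smeared at width theta / N respect the
    ceiling, and the potential of phi hardly distinguishes the two smearings because it is
    Lipschitz up to a logarithm ([logpot_modulus]). Thus the weight carries an additional
    factor exp (theta N^2 logE nu nu).

    Finally nu has total mass zero, and for such nu the quantity - logE nu nu is, up to the
    constant, the integral of |t|^-1 times the squared modulus of its Fourier transform.
    The Cauchy-Schwarz inequality on the frequency side bounds the square of the integral of
    g against nu by the squared half-norm of g times - logE nu nu / (2 pi^2)
    ([fourier_duality], [duality_energy_le]). In the event this integral is at least gamma
    times the half-norm, the term with the Lipschitz norm being the price of replacing the
    empirical measure by psi; hence logE nu nu <= - 2 pi^2 gamma^2.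

    The Fourier-analytic part is done with real cosine and sine transforms on the half-line
    and exponential cutoffs, for which all integrals converge absolutely: the kernel of
    (exp (-at) - exp (-bt)) / t is explicit ([frullani_kernel]) and tends to minus the
    logarithm up to a constant, which a density of mass zero does not see. *)
(** * Real-valued integrals on the line *)

Section RealIntegrals.
Context {R : realType}.
Implicit Types (f g h : R -> R) (a b c x r : R).
Notation mu := (@lebesgue_measure R).

(** Integrability on the whole line: together with indicator factors it replaces
    integrals over sets, so that linearity needs no domain bookkeeping. *)
Definition L1 f := mu.-integrable setT (EFin \o f).

Lemma L1_measurable f : L1 f -> measurable_fun setT f.
Proof. by move=> /measurable_int /measurable_EFinP. Qed.

Lemma le_L1 f g : measurable_fun setT f -> (forall x, `|f x| <= g x) ->
  L1 g -> L1 f.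
Proof.
move=> mf fg; apply: le_integrable => //; first exact/measurable_EFinP.
by move=> x _; rewrite /= lee_fin (le_trans (fg x))// ler_norm.
Qed.

Lemma eq_L1 f g : f =1 g -> L1 f -> L1 g.
Proof. by move=> /funext ->. Qed.

Lemma L1D f g : L1 f -> L1 g -> L1 (fun x => f x + g x).
Proof. by move=> /(integrableD measurableT) h /h; apply: eq_integrable. Qed.

Lemma L1B f g : L1 f -> L1 g -> L1 (fun x => f x - g x).
Proof. by move=> /(integrableB measurableT) h /h; apply: eq_integrable. Qed.

Lemma L1Z c f : L1 f -> L1 (fun x => c * f x).
Proof. by move=> /(integrableZl measurableT c); apply: eq_integrable. Qed.

Lemma L1N f : L1 f -> L1 (fun x => - f x).
Proof. by move=> /(L1Z (-1)); apply: eq_L1 => x; rewrite mulN1r. Qed.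

Lemma L1_norm f : L1 f -> L1 (fun x => `|f x|).
Proof. by move=> /integrable_norm. Qed.

Lemma L10 : L1 (fun _ => 0).
Proof. exact: integrable0. Qed.

Lemma L1_sum (I : Type) (s : seq I) (F : I -> R -> R) :
  (forall i, L1 (F i)) -> L1 (fun x => \sum_(i <- s) F i x).
Proof.
move=> iF; elim: s => [|i s ih].
  by apply: eq_L1 L10 => x; rewrite big_nil.
by apply: eq_L1 (L1D (iF i) ih) => x; rewrite big_cons.
Qed.

Lemma L1_ge0 f : measurable_fun setT f -> (forall x, 0 <= f x) ->
  (\int[mu]_x (f x)%:E < +oo)%E -> L1 f.
Proof.
move=> mf f0 fy; apply/integrableP; split; first exact/measurable_EFinP.
by apply: le_lt_trans fy; apply: ge0_le_integral => //=;
  [apply/measurable_EFinP; exact: measurableT_comp|exact/measurable_EFinP|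
   move=> x _; rewrite ger0_norm].
Qed.

Lemma L1M c h f : measurable_fun setT h -> (forall x, `|h x| <= c) ->
  L1 f -> L1 (fun x => h x * f x).
Proof.
move=> mh hc Lf; apply: le_L1 (L1Z c (L1_norm Lf)).
  by apply: measurable_funM => //; exact: L1_measurable.
by move=> x; rewrite normrM ler_wpM2r.
Qed.

Lemma L1_fin_num f : L1 f -> (\int[mu]_x (f x)%:E)%E \is a fin_num.
Proof. by move=> Lf; apply: integrable_fin_num. Qed.

Lemma intRE f : L1 f -> (\int[mu]_x f x)%:E = (\int[mu]_x (f x)%:E)%E.
Proof. by move=> /L1_fin_num /fineK. Qed.

Lemma intRD f g : L1 f -> L1 g ->
  \int[mu]_x (f x + g x) = \int[mu]_x f x + \int[mu]_x g x.
Proof. exact: RintegralD. Qed.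

Lemma intRB f g : L1 f -> L1 g ->
  \int[mu]_x (f x - g x) = \int[mu]_x f x - \int[mu]_x g x.
Proof. exact: RintegralB. Qed.

Lemma intRZ c f : L1 f -> \int[mu]_x (c * f x) = c * \int[mu]_x f x.
Proof. exact: RintegralZl. Qed.

Lemma intRN f : L1 f -> \int[mu]_x (- f x) = - \int[mu]_x f x.
Proof.
move=> Lf; rewrite -mulN1r -intRZ//.
by apply: eq_Rintegral => x _; rewrite mulN1r.
Qed.

Lemma intR0 : \int[mu]_x (0 : R) = 0.
Proof. by rewrite Rintegral_cst// mul0r. Qed.

Lemma eq_intR f g : f =1 g -> \int[mu]_x f x = \int[mu]_x g x.
Proof. by move=> fg; apply: eq_Rintegral. Qed.

Lemma intR_sum (I : Type) (s : seq I) (F : I -> R -> R) :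
  (forall i, L1 (F i)) ->
  \int[mu]_x (\sum_(i <- s) F i x) = \sum_(i <- s) \int[mu]_x F i x.
Proof.
move=> iF; elim: s => [|i s ih].
  by rewrite big_nil -[RHS]intR0; apply: eq_intR => x; rewrite big_nil.
rewrite big_cons -ih -intRD//; last exact: L1_sum.
by apply: eq_intR => x; rewrite big_cons.
Qed.

Lemma le_intR f g : L1 f -> L1 g -> (forall x, f x <= g x) ->
  \int[mu]_x f x <= \int[mu]_x g x.
Proof. by move=> Lf Lg fg; apply: le_Rintegral. Qed.

Lemma intR_ge0 f : (forall x, 0 <= f x) -> 0 <= \int[mu]_x f x.
Proof. by move=> f0; apply: Rintegral_ge0. Qed.

Lemma le_norm_intR f : L1 f -> `|\int[mu]_x f x| <= \int[mu]_x `|f x|.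
Proof. exact: le_normr_Rintegral. Qed.

Lemma le_norm_intR2 f g : L1 f -> L1 g -> (forall x, `|f x| <= g x) ->
  `|\int[mu]_x f x| <= \int[mu]_x g x.
Proof.
move=> Lf Lg fg; apply: le_trans (le_norm_intR Lf) _.
by apply: le_intR => //; exact: L1_norm.
Qed.

Lemma intR_indic (A : set R) f :
  \int[mu]_(x in A) f x = \int[mu]_x (\1_A x * f x).
Proof.
rewrite Rintegral_mkcond; apply: eq_intR => x.
by rewrite patchE indicE; case: ifP => _; rewrite ?mul1r ?mul0r.
Qed.

Lemma L1_indic (A : set R) f : measurable A ->
  L1 (fun x => \1_A x * f x) <-> mu.-integrable A (EFin \o f).
Proof.
move=> mA; rewrite /L1.
have -> : EFin \o (fun x => \1_A x * f x) = (EFin \o f) \_ A.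
  apply/funext => x /=; rewrite patchE indicE.
  by case: ifP => _; rewrite ?mul1r ?mul0r.
by apply: iff_sym; exact: integrable_mkcond.
Qed.

Lemma indic_itvE a b x : \1_(`[a, b]%classic) x = (a <= x <= b)%R%:R :> R.
Proof. by rewrite indicE mem_setE in_itv. Qed.

Lemma mu_itv_fin a b : (mu `[a, b] < +oo)%E.
Proof. by rewrite lebesgue_measure_itv/=; case: ifP => _; rewrite ?ltry// -EFinB ltry. Qed.

Lemma L1_itv_bounded a b c f : measurable_fun setT f -> (forall x, `|f x| <= c) ->
  L1 (fun x => \1_(`[a, b]%classic) x * f x).
Proof.
move=> mf fc; apply/L1_indic => //; apply: measurable_bounded_integrable => //.
- exact: mu_itv_fin.
- exact: measurable_funTS.
- by exists c; split => [|M cM x _]; [exact: num_real|apply: (le_trans (fc x)); exact: ltW].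
Qed.

Lemma L1_itv a b : L1 \1_(`[a, b]%classic).
Proof.
apply: (@eq_L1 (fun x => \1_(`[a, b]%classic) x * cst 1 x)); first by move=> x; rewrite mulr1.
by apply: (@L1_itv_bounded _ _ 1) => // x; rewrite normr1.
Qed.

Lemma intR_itv a b : a <= b -> \int[mu]_x \1_(`[a, b]%classic) x = b - a.
Proof.
move=> ab; transitivity (\int[mu]_(x in `[a, b]) (1 : R)).
  by rewrite [RHS]intR_indic; apply: eq_intR => x; rewrite mulr1.
rewrite Rintegral_cst// mul1r.
transitivity (fine (b - a)%:E) => //; congr fine.
apply: etrans (lebesgue_measure_itv _) _; rewrite /= lte_fin.
by case: ltP => //= ba; congr EFin; apply/eqP; rewrite eq_sym subr_eq0 eq_le ab ba.
Qed.

Lemma measurable_inv : measurable_fun [set: R] (fun x : R => x^-1).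
Proof.
have -> : (fun x : R => x^-1) = (fun x : R => x * (x ^+ 2) `^ (-1)).
  apply/funext => x; have [->|x0] := eqVneq x 0; first by rewrite mul0r invr0.
  by rewrite powR_inv1 ?sqr_ge0// expr2 invfM mulrA mulfV// mul1r.
apply: measurable_funM => //.
apply: (measurableT_comp (measurable_powR (-1))).
exact: measurable_funX.
Qed.

Lemma measurable_sqrt : measurable_fun [set: R] (@Num.sqrt R).
Proof. apply: continuous_measurable_fun; exact: sqrt_continuous. Qed.

(** The primitive of a nonnegative function bounds its integral on an open
    interval even when the function blows up at the endpoints: exhaust the
    interval by closed subintervals. *)
Lemma ge0_FTC_le (F f : R -> R) a b C : a < b ->
  (forall x, a < x < b -> 0 <= f x) ->
  (forall x, a < x < b -> {for x, continuous f}) ->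
  (forall x, a < x < b -> is_derive x 1 F (f x)) ->
  (forall u v, a < u -> u < v -> v < b -> F v - F u <= C) ->
  (\int[mu]_(x in `]a, b[) (f x)%:E <= C%:E)%E.
Proof.
move=> ab f0 cf dF FC.
pose e n : R := (b - a) / n.+3%:R.
have ba0 : 0 < b - a by rewrite subr_gt0.
have e0 n : 0 < e n by rewrite divr_gt0.
have e3 n : e n <= (b - a) / 3.
  by rewrite ler_pM2l// lef_pV2 ?posrE// ler_nat.
pose S n : set R := `[a + e n, b - e n]%classic.
have Sab n x : S n x -> a < x < b.
  rewrite /S/= in_itv/= => /andP[h1 h2]; have := e0 n; lra.
have eS n m : (n <= m)%N -> e m <= e n.
  by move=> nm; rewrite ler_pM2l// lef_pV2 ?posrE// ler_nat.
have mfo : measurable_fun `]a, b[ f.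
  apply: open_continuous_measurable_fun => //.
  by move=> x; rewrite inE/= in_itv/=; exact: cf.
have US : \bigcup_i S i = `]a, b[%classic.
  apply/seteqP; split=> x /=.
    by move=> [n _ /Sab]; rewrite in_itv.
  rewrite in_itv/= => /andP[ax xb].
  pose d := Num.min (x - a) (b - x).
  have d0 : 0 < d by rewrite lt_min !subr_gt0 ax.
  have [n nd] : exists n : nat, (b - a) / d < n%:R.
    by exists (Num.truncn ((b - a) / d)).+1; rewrite truncnS_gt.
  exists n => //; rewrite /S/= in_itv/=.
  have : e n <= d.
    rewrite /e ler_pdivrMr// mulrC -ler_pdivrMr//.
    by apply: le_trans (ltW nd) _; rewrite ler_nat; do 3 apply: leqW.
  rewrite /d le_min => /andP[]; lra.
have Smeas i : measurable_fun (S i) (EFin \o f).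
  apply/measurable_EFinP; apply: measurable_funS mfo => // x /Sab.
  by rewrite /= in_itv.
have nd : {homo S : n m / (n <= m)%N >-> (n <= m)%O}.
  move=> n m nm; apply/subsetPset => x; rewrite /S/= !in_itv/=.
  have := eS _ _ nm => h /andP[h1 h2]; apply/andP; split; lra.
have Spos : forall i x, S i x -> (0%R <= (EFin \o f) x)%E.
  by move=> i x /Sab ?; rewrite /= lee_fin f0.
have H : (\int[mu]_(x in S i) (f x)%:E @[i --> \oo] -->
          \int[mu]_(x in \bigcup_i S i) (f x)%:E)%E.
  by apply: ge0_nondecreasing_set_cvg_integral => //; move=> i; exact: measurable_itv.
rewrite US in H; rewrite -(cvg_lim _ H)//.
apply: lime_le; first by apply/cvg_ex; eexists; exact: H.
apply: nearW => n.
have abn : a + e n < b - e n by have := e3 n; have := e0 n; lra.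
rewrite /S /= (@continuous_FTC2 _ f F)//.
- rewrite -EFinB lee_fin; apply: FC => //; have := e0 n; lra.
- apply: continuous_in_subspaceT => x; rewrite inE => /Sab; exact: cf.
- split.
  + move=> x; rewrite in_itv/= => /andP[h1 h2].
    have /dF[] // : a < x < b by have := e0 n; lra.
  + apply: cvg_at_right_filter; apply: differentiable_continuous.
    apply/derivable1_diffP; have /dF[] // : a < a + e n < b by have := e0 n; lra.
  + apply: cvg_at_left_filter; apply: differentiable_continuous.
    apply/derivable1_diffP; have /dF[] // : a < b - e n < b by have := e0 n; lra.
- move=> x; rewrite in_itv/= => /andP[h1 h2].
  have /dF[_] : a < x < b by have := e0 n; lra.
  by rewrite derive1E.
Qed.

End RealIntegrals.

(** * Derivatives of explicit expressions *)

Section Derivatives.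
Context {R : realType}.
Implicit Types (f g : R -> R) (a b c x : R).

Lemma derC x c : is_derive x 1 (fun _ : R => c) 0.
Proof. exact: is_derive_cst. Qed.

Lemma derI x : is_derive x 1 (fun y : R => y) 1.
Proof. exact: is_derive_id. Qed.

Lemma derD f g x a b : is_derive x 1 f a -> is_derive x 1 g b ->
  is_derive x 1 (fun y => f y + g y) (a + b).
Proof. by move=> fa gb; exact: is_deriveD. Qed.

Lemma derN f x a : is_derive x 1 f a -> is_derive x 1 (fun y => - f y) (- a).
Proof. by move=> fa; exact: is_deriveN. Qed.

Lemma derB f g x a b : is_derive x 1 f a -> is_derive x 1 g b ->
  is_derive x 1 (fun y => f y - g y) (a - b).
Proof. by move=> fa gb; exact: is_deriveB. Qed.

Lemma derZ f x a c : is_derive x 1 f a -> is_derive x 1 (fun y => c * f y) (c * a).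
Proof. by move=> fa; exact: is_deriveZ. Qed.

Lemma derM f g x a b : is_derive x 1 f a -> is_derive x 1 g b ->
  is_derive x 1 (fun y => f y * g y) (f x * b + g x * a).
Proof. by move=> fa gb; exact: is_deriveM. Qed.

Lemma der_comp f g x a b : is_derive (g x) 1 f a -> is_derive x 1 g b ->
  is_derive x 1 (fun y => f (g y)) (a * b).
Proof. by move=> fa gb; exact: is_derive1_comp. Qed.

Lemma derV f x a : f x != 0 -> is_derive x 1 f a ->
  is_derive x 1 (fun y => (f y)^-1) (- (f x) ^- 2 * a).
Proof. by move=> fx fa; exact: is_deriveV. Qed.

Lemma der_continuous f x a : is_derive x 1 f a -> {for x, continuous f}.
Proof.
by move=> [fx _]; apply: differentiable_continuous; exact/derivable1_diffP.
Qed.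

End Derivatives.

(** * Integrals of inverse powers of the distance to a point *)

Section SingularKernels.
Context {R : realType}.
Implicit Types (f g h : R -> R) (a b c x y r u : R).
Notation mu := (@lebesgue_measure R).

(** The model singularity: its integrals are explicit and it dominates the logarithm. *)
Definition isqrt u : R := (Num.sqrt `|u|)^-1.

Lemma isqrt_ge0 u : 0 <= isqrt u.
Proof. by rewrite invr_ge0 sqrtr_ge0. Qed.

Lemma measurable_isqrt : measurable_fun setT isqrt.
Proof.
apply: (measurableT_comp measurable_inv).
exact: (measurableT_comp measurable_sqrt).
Qed.

Lemma measurable_dist x (k : R -> R) : measurable_fun setT k ->
  measurable_fun setT (fun y => k (x - y)).
Proof.
by move=> mk; apply: (measurableT_comp mk); exact: measurable_funB.
Qed.

(** An even kernel is integrated on both sides of its singularity by means of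
    a primitive on the half-line. *)
Lemma ge0_even_FTC_le (k G : R -> R) x a b C : 0 <= a -> a < b ->
  measurable_fun setT k ->
  (forall u, k (- u) = k u) ->
  (forall u, a < u < b -> 0 <= k u) ->
  (forall u, a < u < b -> {for u, continuous k}) ->
  (forall u, a < u < b -> is_derive u 1 G (k u)) ->
  (forall u v, a < u -> u < v -> v < b -> G v - G u <= C) ->
  L1 (fun y => ((a < `|x - y| < b)%R%:R : R) * k (x - y)) /\
  \int[mu]_y (((a < `|x - y| < b)%R%:R : R) * k (x - y)) <= 2 * C.
Proof.
move=> a0 ab mk ek k0 ck dG GC.
pose A := (`]x - b, x - a[ : set R)%classic.
pose B := (`]x + a, x + b[ : set R)%classic.
have Ax y : A y -> a < x - y < b by rewrite /A/= in_itv/= => /andP[? ?]; lra.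
have Bx y : B y -> a < y - x < b by rewrite /B/= in_itv/= => /andP[? ?]; lra.
have mkx : measurable_fun setT (fun y => k (x - y)) by exact: measurable_dist.
have eAB : (fun y => ((a < `|x - y| < b)%R%:R : R) * k (x - y)) =
           (fun y => k (x - y)) \_ (A `|` B).
  apply/funext => y; rewrite patchE.
  have -> : (y \in A `|` B) = (a < `|x - y| < b).
    apply/idP/idP.
      rewrite inE => -[/Ax|/Bx].
        by move=> h; rewrite ger0_norm//; lra.
      by move=> h; rewrite distrC ger0_norm//; lra.
    move=> h; rewrite inE; case: (leP y x) => yx.
      move: h; rewrite ger0_norm ?subr_ge0// => /andP[h1 h2].
      by left; rewrite /A/= in_itv/=; apply/andP; split; lra.
    move: h; rewrite distrC ger0_norm ?subr_ge0 ?ltW// => /andP[h1 h2].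
    by right; rewrite /B/= in_itv/=; apply/andP; split; lra.
  by case: ifP; rewrite ?mul1r ?mul0r.
have IA : (\int[mu]_(y in A) (k (x - y))%:E <= C%:E)%E.
  apply: (@ge0_FTC_le _ (fun y => - G (x - y))); first by lra.
  - by move=> y hy; apply: k0; lra.
  - move=> y hy; apply: (@continuous_comp _ _ _ (fun y => x - y) k).
      exact: (@der_continuous _ _ _ (0 - 1) (derB (derC _ _) (derI _))).
    by apply: ck; lra.
  - move=> y hy; apply: is_derive_eq.
      apply: derN; apply: (@der_comp _ _ (fun y => x - y)).
        by apply: dG; lra.
    by ring.
  - move=> u v ? ? ?; have := GC (x - v) (x - u).
    by move=> /(_ ltac:(lra) ltac:(lra) ltac:(lra)); lra.
have IB : (\int[mu]_(y in B) (k (x - y))%:E <= C%:E)%E.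
  have kE y : k (x - y) = k (y - x) by rewrite -opprB ek.
  apply: (@ge0_FTC_le _ (fun y => G (y - x))); first by lra.
  - by move=> y hy; rewrite kE; apply: k0; lra.
  - have -> : (fun y => k (x - y)) = (fun y => k (y - x)) by apply/funext.
    move=> y hy; apply: (@continuous_comp _ _ _ (fun y => y - x) k).
      exact: (@der_continuous _ _ _ (1 - 0) (derB (derI _) (derC _ _))).
    by apply: ck; lra.
  - move=> y hy; apply: is_derive_eq.
      apply: (@der_comp _ _ (fun y => y - x)).
        by apply: dG; lra.
    by rewrite kE; ring.
  - move=> u v ? ? ?; have := GC (u - x) (v - x).
    by move=> /(_ ltac:(lra) ltac:(lra) ltac:(lra)); lra.
have pos y : (A `|` B) y -> 0 <= k (x - y).
  move=> [/Ax h|/Bx h]; first exact: k0.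
  by rewrite -opprB ek; exact: k0.
have mAB : measurable (A `|` B) by apply: measurableU; exact: measurable_itv.
have I : (\int[mu]_(y in A `|` B) (k (x - y))%:E <= (2 * C)%:E)%E.
  rewrite ge0_integral_setU//.
  - by rewrite mulr_natl mulr2n EFinD leeD.
  - exact: measurable_itv.
  - exact: measurable_itv.
  - by apply/measurable_EFinP; exact: measurable_funTS.
  - apply/disj_setPS => y [/Ax ? /Bx ?]; lra.
have fE : EFin \o (fun y => ((a < `|x - y| < b)%R%:R : R) * k (x - y)) =
    (fun y => (k (x - y))%:E) \_ (A `|` B).
  by rewrite eAB; apply/funext => y /=; rewrite !patchE; case: ifP.
have iE : (\int[mu]_y (((a < `|x - y| < b)%R%:R : R) * k (x - y))%:E =
           \int[mu]_(y in A `|` B) (k (x - y))%:E)%E.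
  by rewrite [RHS]integral_mkcond -fE.
have L : L1 (fun y => ((a < `|x - y| < b)%R%:R : R) * k (x - y)).
  apply: L1_ge0; last by rewrite iE; exact: le_lt_trans I (ltry _).
    suff : measurable_fun setT ((fun y => k (x - y)) \_ (A `|` B)) by rewrite -eAB.
    apply/measurable_restrict => //.
    by rewrite setTI; exact: measurable_funTS.
  move=> y; have := congr1 (fun f => f y) eAB => /= ->.
  by rewrite patchE; case: ifP => //; rewrite inE; exact: pos.
by split => //; rewrite -lee_fin intRE// iE.
Qed.

Lemma isqrt_near x r : 0 < r ->
  L1 (fun y => ((`|x - y| < r)%R%:R : R) * isqrt (x - y)) /\
  \int[mu]_y (((`|x - y| < r)%R%:R : R) * isqrt (x - y)) <= 4 * Num.sqrt r.
Proof.
move=> r0.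
have [||u|u|u|u|u v|] := @ge0_even_FTC_le isqrt (fun u => 2 * Num.sqrt u) x 0 r
  (2 * Num.sqrt r) _ r0.
- by [].
- exact: measurable_isqrt.
- by rewrite /isqrt normrN.
- by move=> _; exact: isqrt_ge0.
- move=> /andP[u0 _].
  apply: (@continuous_comp _ _ _ (fun u => Num.sqrt `|u|) (fun u => u^-1)).
    apply: (@continuous_comp _ _ _ (fun u => `|u|)); first exact: norm_continuous.
    exact: sqrt_continuous.
  by apply: inv_continuous; rewrite sqrtr_eq0 -ltNge normr_gt0 gt_eqF.
- move=> /andP[u0 _]; apply: is_derive_eq; first exact: derZ (is_derive1_sqrt u0).
  by rewrite /isqrt gtr0_norm// invfM mulrA mulfV ?mul1r.
- move=> u0 uv vr; have := @sqrtr_ge0 R u.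
  by have : Num.sqrt v <= Num.sqrt r by [rewrite ler_sqrt ?ltW//]; lra.
have e : (fun y => ((0 < `|x - y| < r)%R%:R : R) * isqrt (x - y)) =
         (fun y => ((`|x - y| < r)%R%:R : R) * isqrt (x - y)).
  apply/funext => y; have [->|xy] := eqVneq (x - y) 0.
    by rewrite /isqrt normr0 sqrtr0 invr0 !mulr0.
  by rewrite normr_gt0 xy.
rewrite e => L I; split => //; apply: le_trans I _.
by rewrite mulrA -natrM.
Qed.

Lemma inv_annulus x d r : 0 < d -> d < r ->
  L1 (fun y => ((d < `|x - y| < r)%R%:R : R) * `|x - y|^-1) /\
  \int[mu]_y (((d < `|x - y| < r)%R%:R : R) * `|x - y|^-1) <= 2 * ln (r / d).
Proof.
move=> d0 dr.
apply: (@ge0_even_FTC_le (fun u => `|u|^-1) (@ln R)) => //.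
- exact: ltW.
- by apply: (measurableT_comp measurable_inv).
- by move=> u; rewrite normrN.
- by move=> u /andP[du _]; apply: (@continuous_comp _ _ _ (fun u => `|u|) (fun u => u^-1));
    [exact: norm_continuous|apply: inv_continuous; rewrite normr_eq0 gt_eqF// (lt_trans d0)].
- move=> u /andP[du _]; have u0 := lt_trans d0 du.
  by rewrite gtr0_norm//; exact: is_derive1_ln.
- move=> u v du uv vr; have u0 := lt_trans d0 du; have v0 := lt_trans u0 uv.
  have r0 := lt_trans v0 vr.
  rewrite -ln_div ?posrE// ler_ln ?posrE; [|exact: divr_gt0|exact: divr_gt0].
  by apply: ler_pM; rewrite ?invr_ge0 ?ltW// ltf_pV2 ?posrE.
Qed.

(** Single points are null: this removes the points where the convention for the
    logarithm of 0 breaks an inequality. *)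
Lemma eq_intR_off (a b : R) f g : measurable_fun setT f -> measurable_fun setT g ->
  (forall y, y != a -> y != b -> f y = g y) -> \int[mu]_y f y = \int[mu]_y g y.
Proof.
move=> mf mg fg; congr fine; apply: ae_eq_integral => //.
- exact/measurable_EFinP.
- exact/measurable_EFinP.
- exists ([set a] `|` [set b]); split.
  + by apply: measurableU; exact: measurable_set1.
  + apply: null_set_setU.
    - exact: measurable_set1.
    - exact: measurable_set1.
    - exact: lebesgue_measure_set1.
    - exact: lebesgue_measure_set1.
  + move=> y /= h; apply: contrapT => ny; apply: h => _.
    congr EFin; apply: fg; apply/eqP => ya; apply: ny; [left|right]; exact: ya.
Qed.

Lemma le_intR_off (a b : R) f g : L1 f -> L1 g ->
  (forall y, y != a -> y != b -> f y <= g y) -> \int[mu]_y f y <= \int[mu]_y g y.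
Proof.
move=> Lf Lg fg.
pose h y := (((y != a) && (y != b))%:R : R).
have mh : measurable_fun setT h.
  have -> : h = (fun y => \1_(~` ([set a] `|` [set b])) y).
    apply/funext => y; rewrite indicE /h; congr (_%:R); congr nat_of_bool.
    apply/idP/idP.
      by move=> /andP[/eqP ya /eqP yb]; rewrite inE => -[].
    by rewrite inE => ny; apply/andP; split; apply/eqP => e; apply: ny; [left|right].
  by apply: measurable_indic; apply: measurableC; apply: measurableU; exact: measurable_set1.
have h1 y : `|h y| <= 1 by rewrite /h; case: (_ && _); rewrite ?normr1 ?normr0.
have Lhf := L1M mh h1 Lf; have Lhg := L1M mh h1 Lg.
rewrite (@eq_intR_off a b f (fun y => h y * f y)); first last.
- by move=> y ya yb; rewrite /h ya yb mul1r.
- exact: L1_measurable.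
- exact: L1_measurable.
rewrite (@eq_intR_off a b g (fun y => h y * g y)); first last.
- by move=> y ya yb; rewrite /h ya yb mul1r.
- exact: L1_measurable.
- exact: L1_measurable.
apply: le_intR => // y; rewrite /h.
case: (eqVneq y a) => ya /=; first by rewrite !mul0r.
case: (eqVneq y b) => yb /=; first by rewrite !mul0r.
by rewrite !mul1r fg.
Qed.

End SingularKernels.

(** * Iterated integrals *)

Section Fubini.
Context {R : realType}.
Implicit Types (f g h : R -> R) (k : R * R -> R).
Notation mu := (@lebesgue_measure R).

Definition prodL1 k := (mu \x mu)%E.-integrable setT (EFin \o k).

(** Tonelli: an integrable bound on the integrals of the slices suffices. *)
Lemma prodL1_le k (F : R -> R) : measurable_fun setT k ->
  (forall x, L1 (fun y => k (x, y))) ->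
  (forall x, \int[mu]_y `|k (x, y)| <= F x) -> L1 F -> prodL1 k.
Proof.
move=> mk Lk kF LF; apply/integrable12ltyP; first exact/measurable_EFinP.
have -> : (\int[mu]_x \int[mu]_y `|(EFin \o k) (x, y)| =
          \int[mu]_x (\int[mu]_y `|k (x, y)|)%:E)%E.
  by apply: eq_integral => x _; rewrite intRE//; exact: L1_norm.
apply: le_lt_trans (integrable_lty measurableT LF).
apply: ge0_le_integral => //.
- by move=> x _; rewrite lee_fin intR_ge0.
- have -> : (fun x => (\int[mu]_y `|k (x, y)|)%:E) =
            (fun x => \int[mu]_y (`|k (x, y)|%:E))%E.
    by apply/funext => x; rewrite intRE//; exact: L1_norm.
  apply: (@measurable_fun_fubini_tonelli_F _ _ (measurableTypeR R) (measurableTypeR R) R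
    [the {sigma_finite_measure set (measurableTypeR R) -> \bar R} of mu]
    (fun z => `|k z|%:E)) => //.
  by apply/measurable_EFinP; exact: measurableT_comp.
- exact: (measurable_int mu).
- by move=> x _; rewrite lee_fin.
Qed.

Lemma Rfubini1 k : prodL1 k -> (forall x, L1 (fun y => k (x, y))) ->
  L1 (fun x => \int[mu]_y k (x, y)) /\
  \int[(mu \x mu)%E]_z k z = \int[mu]_x \int[mu]_y k (x, y).
Proof.
move=> ik Lk.
have e : EFin \o (fun x => \int[mu]_y k (x, y)) = (fun x => \int[mu]_y (k (x, y))%:E)%E.
  by apply/funext => x /=; rewrite intRE.
split; first by rewrite /L1 e; exact: (@integrable_fubini_F _ _ (measurableTypeR R) (measurableTypeR R) R _ _ (EFin \o k) ik).
rewrite /Rintegral; congr fine.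
have /= <- := integral12_prod_meas1 ik.
by apply: eq_integral => x _; have := congr1 (fun F => F x) e.
Qed.

Lemma Rfubini2 k : prodL1 k -> (forall y, L1 (fun x => k (x, y))) ->
  L1 (fun y => \int[mu]_x k (x, y)) /\
  \int[(mu \x mu)%E]_z k z = \int[mu]_y \int[mu]_x k (x, y).
Proof.
move=> ik Lk.
have e : EFin \o (fun y => \int[mu]_x k (x, y)) = (fun y => \int[mu]_x (k (x, y))%:E)%E.
  by apply/funext => y /=; rewrite intRE.
have mk : measurable_fun setT k by apply/measurable_EFinP; exact: (measurable_int _ ik).
have e' : EFin \o (fun y => \int[mu]_x `|k (x, y)|) =
          (fun y => \int[mu]_x (`|k (x, y)|)%:E)%E.
  by apply/funext => y /=; rewrite intRE//; exact: L1_norm.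
have Ln : L1 (fun y => \int[mu]_x `|k (x, y)|).
  apply: L1_ge0.
  - apply/measurable_EFinP; rewrite e'.
    apply: (@measurable_fun_fubini_tonelli_G _ _ (measurableTypeR R) (measurableTypeR R) R
      [the {sigma_finite_measure set (measurableTypeR R) -> \bar R} of mu]
      (fun z => `|k z|%:E)) => //.
    by apply/measurable_EFinP; exact: measurableT_comp.
  - by move=> y; exact: intR_ge0.
  - have mE : measurable_fun setT (EFin \o k) by exact: (measurable_int _ ik).
    have := (@integrable21ltyP _ _ (measurableTypeR R) (measurableTypeR R) R _ _ _ mE).1 ik.
    apply: le_lt_trans.
    rewrite le_eqVlt; apply/orP; left; apply/eqP; apply: eq_integral => y _.
    by have := congr1 (fun F => F y) e'.
split.
  apply: le_L1 Ln => [|y]; last exact: le_norm_intR.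
  by apply/measurable_EFinP; rewrite e; exact: (@measurable_fubini_G _ _ (measurableTypeR R) (measurableTypeR R) R _ _ (EFin \o k) ik).
rewrite /Rintegral; congr fine.
have /= <- := integral21_prod_meas1 ik.
by apply: eq_integral => x _; have := congr1 (fun F => F x) e.
Qed.

Lemma Rfubini k : prodL1 k -> (forall x, L1 (fun y => k (x, y))) ->
  (forall y, L1 (fun x => k (x, y))) ->
  \int[mu]_x \int[mu]_y k (x, y) = \int[mu]_y \int[mu]_x k (x, y).
Proof. by move=> ik /(Rfubini1 ik)[_ <-] /(Rfubini2 ik)[_ <-]. Qed.

Lemma measurable_slice1 (k : R * R -> R) x : measurable_fun setT k ->
  measurable_fun setT (fun y => k (x, y)).
Proof. by move=> mk; apply: (measurableT_comp mk); exact: measurable_pair1. Qed.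

Lemma measurable_slice2 (k : R * R -> R) y : measurable_fun setT k ->
  measurable_fun setT (fun x => k (x, y)).
Proof. by move=> mk; apply: (measurableT_comp mk); exact: measurable_pair2. Qed.

Lemma measurable_fst_comp f : measurable_fun setT f ->
  measurable_fun setT (fun z : R * R => f z.1).
Proof. by move=> mf; apply: (measurableT_comp mf); exact: measurable_fst. Qed.

Lemma measurable_snd_comp f : measurable_fun setT f ->
  measurable_fun setT (fun z : R * R => f z.2).
Proof. by move=> mf; apply: (measurableT_comp mf); exact: measurable_snd. Qed.

Lemma prodL1_bounded f h (q : R * R -> R) c : L1 f -> L1 h ->
  measurable_fun setT q -> (forall z, `|q z| <= c) ->
  prodL1 (fun z => f z.1 * (q z * h z.2)).
Proof.
move=> Lf Lh mq qc.
have mf := L1_measurable Lf; have mh := L1_measurable Lh.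
have Lq x : L1 (fun y => q (x, y) * h y).
  by apply: (@L1M _ c) => //; exact: measurable_slice1.
apply: (@prodL1_le _ (fun x => (c * \int[mu]_y `|h y|) * `|f x|)).
- apply: measurable_funM; first exact: measurable_fst_comp.
  by apply: measurable_funM => //; exact: measurable_snd_comp.
- by move=> x; exact: (L1Z (f x) (Lq x)).
- move=> x /=.
  have -> : \int[mu]_y `|f x * (q (x, y) * h y)| = `|f x| * \int[mu]_y `|q (x, y) * h y|.
    by rewrite -intRZ; [apply: eq_intR => y; rewrite normrM|exact: L1_norm].
  rewrite mulrC ler_wpM2r// -intRZ; last exact: L1_norm.
  apply: le_intR; [exact: L1_norm|by apply: L1Z; exact: L1_norm|].
  by move=> y; rewrite normrM ler_wpM2r.
- by apply: L1Z; exact: L1_norm.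
Qed.

Lemma Rfubini_bounded f h (q : R * R -> R) c : L1 f -> L1 h ->
  measurable_fun setT q -> (forall z, `|q z| <= c) ->
  \int[mu]_x (f x * \int[mu]_y (q (x, y) * h y)) =
  \int[mu]_y (h y * \int[mu]_x (q (x, y) * f x)).
Proof.
move=> Lf Lh mq qc.
have Lq x : L1 (fun y => q (x, y) * h y).
  by apply: (@L1M _ c) => //; exact: measurable_slice1.
have Lq' y : L1 (fun x => q (x, y) * f x).
  by apply: (@L1M _ c) => //; exact: (@measurable_slice2 q).
transitivity (\int[mu]_x \int[mu]_y (f x * (q (x, y) * h y))).
  by apply: eq_intR => x; rewrite intRZ.
rewrite (@Rfubini (fun z => f z.1 * (q z * h z.2))).
- apply: eq_intR => y; rewrite -intRZ//.
  by apply: eq_intR => x /=; ring.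
- exact: prodL1_bounded qc.
- by move=> x; exact: (L1Z (f x) (Lq x)).
- move=> y; apply: eq_L1 (L1Z (h y) (Lq' y)) => x /=; ring.
Qed.

Lemma L1_iterated f h (q : R * R -> R) c : L1 f -> L1 h ->
  measurable_fun setT q -> (forall z, `|q z| <= c) ->
  L1 (fun x => f x * \int[mu]_y (q (x, y) * h y)).
Proof.
move=> Lf Lh mq qc.
have Lq x : L1 (fun y => q (x, y) * h y).
  by apply: (@L1M _ c) => //; exact: measurable_slice1.
have [|L _] := Rfubini1 (prodL1_bounded Lf Lh mq qc).
  by move=> x; exact: (L1Z (f x) (Lq x)).
by apply: eq_L1 L => x /=; rewrite intRZ.
Qed.

End Fubini.

(** * Elementary inequalities for the logarithm *)

Section LogInequalities.
Context {R : realType}.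
Implicit Types (a b c x y r u v d : R).

Lemma ln_leB1 x : 0 < x -> ln x <= x - 1.
Proof. by move=> x0; rewrite -{1}(subrK 1 x) addrC le_ln1Dx//; lra. Qed.

Lemma ln_sqrt2 u : 0 < u -> ln u = 2 * ln (Num.sqrt u).
Proof.
by move=> u0; rewrite -{1}(sqr_sqrtr (ltW u0)) lnXn ?sqrtr_gt0// mulr_natl.
Qed.

(** A bound by an integrable singularity near 0 and by a linear function at infinity,
    which covers every use of the logarithm as a kernel on a bounded interval. *)
Lemma abs_ln_le u : `|ln `|u| | <= 2 * isqrt u + `|u|.
Proof.
have [->|u0] := eqVneq u 0.
  by rewrite !normr0 ln0// normr0 addr0 mulr_ge0// isqrt_ge0.
have a0 : 0 < `|u| by rewrite normr_gt0.
have s0 : 0 < Num.sqrt `|u| by rewrite sqrtr_gt0.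
have := isqrt_ge0 u.
rewrite ler_norml => i0; apply/andP; split; last first.
  by have := ln_leB1 a0; lra.
have : ln (isqrt u) <= isqrt u - 1 by apply: ln_leB1; rewrite invr_gt0.
rewrite /isqrt lnV ?posrE// (ln_sqrt2 a0); lra.
Qed.

Lemma ln1D_sqrt v : 0 <= v -> ln (1 + v) <= 2 * Num.sqrt v.
Proof.
move=> v0; have s0 := sqrtr_ge0 v.
apply: (@le_trans _ _ (ln ((1 + Num.sqrt v) ^+ 2))).
  rewrite ler_ln ?posrE; [|lra|by rewrite exprn_gt0//; lra].
  by rewrite sqrrD sqr_sqrtr// expr1n mul1r; lra.
rewrite lnXn; last lra.
have : ln (1 + Num.sqrt v) <= Num.sqrt v by apply: le_ln1Dx; lra.
by rewrite mulr2n; lra.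
Qed.

Lemma ln1D_isqrt d u : 0 <= d -> u != 0 -> ln (1 + d / `|u|) <= 2 * Num.sqrt d * isqrt u.
Proof.
move=> d0 u0; apply: le_trans (ln1D_sqrt _) _; first by rewrite divr_ge0.
by rewrite sqrtrM// sqrtrV// mulrA.
Qed.

Lemma ln_ratio_le a b d : 0 < a -> 0 < b -> b <= a + d -> ln b - ln a <= ln (1 + d / a).
Proof.
move=> a0 b0 bad; rewrite -ln_div ?posrE//.
have : b / a <= 1 + d / a by rewrite -{1}(divff (lt0r_neq0 a0)) -mulrDl ler_pM2r ?invr_gt0.
by move=> h; rewrite ler_ln ?posrE ?divr_gt0//; apply: lt_le_trans h; rewrite divr_gt0.
Qed.

Lemma ln_diff_le a b d : 0 < a -> 0 < b -> 0 <= d -> b <= a + d -> ln b <= ln a + d / a.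
Proof.
move=> a0 b0 d0 h; rewrite -lerBlDl; apply: le_trans (ln_ratio_le a0 b0 h) _.
by apply: le_ln1Dx; apply: lt_le_trans (divr_ge0 d0 (ltW a0)); lra.
Qed.

End LogInequalities.

(** * Bounded densities of compact support and their logarithmic potentials *)

Section LogPotential.
Context {R : realType}.
Implicit Types (f g h : R -> R) (a b c x y r u v d K B : R).
Notation mu := (@lebesgue_measure R).

(** The class of densities, test functions and their differences for which all the
    logarithmic integrals converge; the bounds are kept explicit because the constants of
    the final estimate must be uniform. *)
Definition bcs K B f := [/\ measurable_fun setT f, (forall x, `|f x| <= B) &
  (forall x, K < `|x| -> f x = 0)].

Lemma bcs_B0 K B f : bcs K B f -> 0 <= B.
Proof. by move=> [_ /(_ 0) h _]; apply: le_trans h. Qed.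

Lemma bcsW K K' B B' f : K <= K' -> B <= B' -> bcs K B f -> bcs K' B' f.
Proof.
move=> KK BB [mf fB fK]; split => // x; first exact: le_trans BB.
by move=> /(le_lt_trans KK) /fK.
Qed.

Lemma bcsD K B B' f g : bcs K B f -> bcs K B' g -> bcs K (B + B') (fun x => f x + g x).
Proof.
move=> [mf fB fK] [mg gB gK]; split=> [|x|x Kx]; first exact: measurable_funD.
  by apply: le_trans (ler_normD _ _) _; apply: lerD.
by rewrite fK// gK// addr0.
Qed.

Lemma bcsZ K B c f : bcs K B f -> bcs K (`|c| * B) (fun x => c * f x).
Proof.
move=> [mf fB fK]; split=> [|x|x Kx]; first exact: measurable_funM.
  by rewrite normrM ler_wpM2l.
by rewrite fK// mulr0.
Qed.

Lemma bcsB K B B' f g : bcs K B f -> bcs K B' g -> bcs K (B + B') (fun x => f x - g x).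
Proof.
move=> [mf fB fK] [mg gB gK]; split=> [|x|x Kx]; first exact: measurable_funB.
  by apply: le_trans (ler_normB _ _) _; apply: lerD.
by rewrite fK// gK// subr0.
Qed.

Lemma bcs_le K B f x : bcs K B f -> `|f x| <= B * \1_(`[- K, K]%classic) x.
Proof.
move=> [_ fB fK]; rewrite indic_itvE -ler_norml.
have [_|Kx] := leP `|x| K; first by rewrite mulr1.
by rewrite fK// normr0 mulr0.
Qed.

Lemma bcs_L1 K B f : bcs K B f -> L1 f.
Proof.
move=> bf; have [mf _ _] := bf; apply: (@le_L1 _ _ (fun x => B * \1_(`[- K, K]%classic) x)) => //.
  by move=> x; exact: bcs_le.
by apply: L1Z; exact: L1_itv.
Qed.

Lemma bcs_norm_int K B f : 0 <= K -> bcs K B f -> \int[mu]_x `|f x| <= B * (2 * K).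
Proof.
move=> K0 bf; have -> : 2 * K = K - - K by lra.
rewrite -intR_itv; last lra.
rewrite -intRZ; last exact: L1_itv.
apply: le_intR => [|| x]; last exact: bcs_le.
  by apply: L1_norm; exact: bcs_L1 bf.
by apply: L1Z; exact: L1_itv.
Qed.

Lemma measurable_ln_dist x : measurable_fun setT (fun y => ln `|x - y|).
Proof.
apply: (@measurable_dist _ x (fun u => ln `|u|)).
by apply: (measurableT_comp (@measurable_ln R)).
Qed.

(** Boundedness of the density leaves the singularity of the kernel integrable. *)
Lemma isqrt_kernel K B h x : 0 < K -> `|x| <= K -> bcs K B h ->
  L1 (fun y => isqrt (x - y) * `|h y|) /\
  \int[mu]_y (isqrt (x - y) * `|h y|) <= B * (4 * Num.sqrt (3 * K)).
Proof.
move=> K0 xK bh; have B0 := bcs_B0 bh; have [mh hB hK] := bh.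
have r0 : 0 < 3 * K by lra.
have [L I] := isqrt_near x r0.
have le y : isqrt (x - y) * `|h y| <= B * (((`|x - y| < 3 * K)%R%:R : R) * isqrt (x - y)).
  have i0 := isqrt_ge0 (x - y).
  have [_|xy] := ltP `|x - y| (3 * K); first by rewrite mul1r mulrC ler_wpM2r.
  rewrite hK ?normr0 ?mulr0 ?mul0r ?mulr0//.
  by have := ler_normB x y; lra.
have LL : L1 (fun y => isqrt (x - y) * `|h y|).
  apply: le_L1 (L1Z B L) => [|y]; last by rewrite ger0_norm// mulr_ge0 ?isqrt_ge0.
  apply: measurable_funM; last exact: measurableT_comp.
  by apply: measurable_dist; exact: measurable_isqrt.
split=> //; apply: (@le_trans _ _ (\int[mu]_y (B * (((`|x - y| < 3 * K)%R%:R : R) * isqrt (x - y))))).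
  by apply: le_intR => //; exact: L1Z.
by rewrite intRZ// ler_wpM2l.
Qed.

Definition potbound K : R := 8 * Num.sqrt (3 * K) + 4 * K ^+ 2.

Lemma potbound_ge0 K : 0 <= potbound K.
Proof.
rewrite /potbound; have h1 := sqrtr_ge0 (3 * K); have h2 := sqr_ge0 K; lra.
Qed.

Lemma log_kernel K B h x : 0 < K -> `|x| <= K -> bcs K B h ->
  L1 (fun y => ln `|x - y| * h y) /\
  \int[mu]_y `|ln `|x - y| * h y| <= B * potbound K.
Proof.
move=> K0 xK bh; have B0 := bcs_B0 bh; have [mh hB hK] := bh.
have [L I] := isqrt_kernel K0 xK bh.
have le y : `|ln `|x - y| * h y| <= 2 * (isqrt (x - y) * `|h y|) + (2 * K) * `|h y|.
  have [Ky|yK] := ltP K `|y|; first by rewrite hK// !(mulr0, normr0) addr0.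
  rewrite normrM mulrA -mulrDl ler_wpM2r//.
  apply: le_trans (abs_ln_le _) _; have := ler_normB x y; lra.
have Lh := L1_norm (bcs_L1 bh).
have LR := L1D (L1Z 2 L) (L1Z (2 * K) Lh).
have LL : L1 (fun y => ln `|x - y| * h y).
  apply: le_L1 LR => //; apply: measurable_funM => //; exact: measurable_ln_dist.
split=> //; apply: le_trans (le_intR (L1_norm LL) LR le) _.
rewrite intRD; [|exact: L1Z|exact: L1Z]; rewrite !intRZ//.
have := bcs_norm_int (ltW K0) bh; rewrite /potbound.
have : 0 < 2 * K by lra.
move=> K2 h2; have := ler_wpM2l (ltW K2) h2; rewrite expr2; nra.
Qed.

Lemma log_kernel_L1 K B h x : bcs K B h -> L1 (fun y => ln `|x - y| * h y).
Proof.
move=> bh; pose K' := `|K| + `|x| + 1.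
have xK : `|x| <= K' by rewrite /K'; have := normr_ge0 K; lra.
have K0 : 0 < K' by rewrite /K'; have := normr_ge0 K; have := normr_ge0 x; lra.
have KK : K <= K' by rewrite /K'; have := ler_norm K; have := normr_ge0 x; lra.
by have [] := log_kernel K0 xK (bcsW KK (lexx B) bh).
Qed.

Definition logpot h x := \int[mu]_y (ln `|x - y| * h y).

Lemma logpot_le K B h x : 0 < K -> `|x| <= K -> bcs K B h ->
  `|logpot h x| <= B * potbound K.
Proof.
by move=> K0 xK bh; have [L I] := log_kernel K0 xK bh; apply: le_trans (le_norm_intR L) I.
Qed.

(** The potential of a bounded density is Lipschitz up to a logarithm: where
    the distance to the singularity is at least d the kernel moves by at most
    its inverse times d, and the remaining short interval is integrated exactly. *)
Lemma logpot_modulus K B h x x' d : 0 < K -> `|x| <= K -> `|x'| <= K -> bcs K B h ->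
  0 < d -> d <= K -> `|x - x'| <= d ->
  `|logpot h x' - logpot h x| <= B * (24 * d + 4 * d * ln (3 * K / d)).
Proof.
move=> K0 xK x'K bh d0 dK xx; have B0 := bcs_B0 bh; have [mh hB hK] := bh.
have d20 : 0 < 2 * d by lra.
have d3K : d < 3 * K by lra.
(* Near the singularity ln (1 + d/u) <= 2 sqrt (d/u); elsewhere it is at most d/u. *)
pose D z y := 2 * Num.sqrt d * (((`|z - y| < 2 * d)%R%:R : R) * isqrt (z - y)) +
              d * (((d < `|z - y| < 3 * K)%R%:R : R) * `|z - y|^-1).
have D1 z y : `|z| <= K -> `|y| <= K -> z != y -> ln (1 + d / `|z - y|) <= D z y.
  move=> zK yK zy; have u0 : 0 < `|z - y| by rewrite normr_gt0 subr_eq0.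
  have s0 := sqrtr_ge0 d; have i0 := isqrt_ge0 (z - y).
  have v0 : 0 <= `|z - y|^-1 by rewrite invr_ge0 ltW.
  rewrite /D; have [h1|h1] := ltP `|z - y| (2 * d).
    have := ln1D_isqrt (ltW d0) (_ : z - y != 0); rewrite subr_eq0 => /(_ zy).
    rewrite mul1r => /le_trans; apply; rewrite lerDl.
    by apply: mulr_ge0; [exact: ltW|apply: mulr_ge0].
  have -> : d < `|z - y| < 3 * K.
    by apply/andP; split; [lra|have := ler_normB z y; lra].
  rewrite mul0r mulr0 add0r mul1r; apply: le_ln1Dx.
  have : 0 <= d / `|z - y| by apply: mulr_ge0; first exact: ltW.
  lra.
have LD z : L1 (D z).
  have [La _] := isqrt_near z d20; have [Lb _] := inv_annulus z d0 d3K.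
  by apply: L1D; exact: L1Z.
have ID z : \int[mu]_y D z y <= 12 * d + 2 * d * ln (3 * K / d).
  have [La Ia] := isqrt_near z d20; have [Lb Ib] := inv_annulus z d0 d3K.
  rewrite intRD; [|exact: L1Z|exact: L1Z]; rewrite !intRZ//; apply: lerD.
    have s0 := sqrtr_ge0 d.
    apply: (@le_trans _ _ (2 * Num.sqrt d * (4 * Num.sqrt (2 * d)))).
      by apply: ler_wpM2l => //; exact: mulr_ge0.
    have t2 : Num.sqrt 2 <= 3 / 2 :> R.
      have : Num.sqrt 2 <= Num.sqrt ((3 / 2) ^+ 2) :> R by rewrite ler_wsqrtr//; lra.
      by rewrite sqrtr_sqr ger0_norm//; lra.
    have -> : 2 * Num.sqrt d * (4 * Num.sqrt (2 * d)) = 8 * Num.sqrt 2 * Num.sqrt d ^+ 2.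
      by rewrite sqrtrM//; ring.
    by rewrite (sqr_sqrtr (ltW d0)); apply: ler_wpM2r; [exact: ltW|lra].
  have -> : 2 * d * ln (3 * K / d) = d * (2 * ln (3 * K / d)) by ring.
  by apply: ler_wpM2l => //; exact: ltW.
have Dge0 z y : 0 <= D z y.
  have s0 := sqrtr_ge0 d; have i0 := isqrt_ge0 (z - y).
  apply: addr_ge0; apply: mulr_ge0; [exact: mulr_ge0|exact: mulr_ge0|exact: ltW|].
  by apply: mulr_ge0; rewrite ?invr_ge0.
have Lx := log_kernel_L1 x bh; have Lx' := log_kernel_L1 x' bh.
rewrite /logpot -intRB//.
have L := L1B Lx' Lx.
apply: le_trans (le_norm_intR L) _.
apply: (@le_trans _ _ (\int[mu]_y (B * (D x y + D x' y)))).
  apply: (@le_intR_off _ x x'); [exact: L1_norm|by apply: L1Z; exact: L1D|].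
  move=> y yx yx'; rewrite -mulrBl normrM mulrC.
  have [Ky|yK] := ltP K `|y|.
    by rewrite hK// normr0 mul0r mulr_ge0// addr_ge0.
  apply: ler_pM => //.
  have u0 : 0 < `|x - y| by rewrite normr_gt0 subr_eq0 eq_sym.
  have u0' : 0 < `|x' - y| by rewrite normr_gt0 subr_eq0 eq_sym.
  have xy : x != y by rewrite eq_sym.
  have x'y : x' != y by rewrite eq_sym.
  have := D1 _ _ xK yK xy; have := D1 _ _ x'K yK x'y.
  have t1 : `|x - y| <= `|x' - y| + d.
    have -> : x - y = (x' - y) + (x - x') by ring.
    by have := ler_normD (x' - y) (x - x'); lra.
  have t2 : `|x' - y| <= `|x - y| + d.
    have -> : x' - y = (x - y) - (x - x') by ring.
    by have := ler_normB (x - y) (x - x'); lra.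
  have := ln_ratio_le u0 u0' t2; have := ln_ratio_le u0' u0 t1.
  have := Dge0 x y; have := Dge0 x' y.
  by rewrite ler_norml => ? ? ? ? ? ?; apply/andP; split; lra.
rewrite intRZ; last exact: L1D.
rewrite intRD//; apply: ler_wpM2l => //.
have := ID x; have := ID x'; lra.
Qed.

End LogPotential.

(** * The logarithmic energy as a bilinear form *)

Section LogEnergy.
Context {R : realType}.
Implicit Types (f g h : R -> R) (a b c x y r u v d K B : R).
Notation mu := (@lebesgue_measure R).

Definition logE f h : R :=
  \int[(mu \x mu)%E]_z (ln `|z.1 - z.2| * f z.1 * h z.2).

Lemma measurable_ln_diff : measurable_fun setT (fun z : R * R => ln `|z.1 - z.2|).
Proof.
apply: (measurableT_comp (@measurable_ln R)).
apply: (@measurableT_comp _ _ _ _ _ _ (fun x : R => `|x|)) => //.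
apply: measurable_funB; first exact: (@measurable_fst_comp _ id).
exact: (@measurable_snd_comp _ id).
Qed.

Lemma logE_prodL1 K B B' f h : 0 < K -> bcs K B f -> bcs K B' h ->
  prodL1 (fun z => ln `|z.1 - z.2| * f z.1 * h z.2).
Proof.
move=> K0 bf bh; have [mf fB fK] := bf; have [mh _ _] := bh.
have Lx x : L1 (fun y => ln `|x - y| * f x * h y).
  by apply: eq_L1 (L1Z (f x) (log_kernel_L1 x bh)) => y; ring.
apply: (@prodL1_le _ _ (fun x => B' * potbound K * `|f x|)) => //.
- apply: measurable_funM; last exact: measurable_snd_comp.
  by apply: measurable_funM; [exact: measurable_ln_diff|exact: measurable_fst_comp].
- move=> x /=; have [Kx|xK] := ltP K `|x|.
    rewrite fK// normr0 mulr0; apply: (@le_trans _ _ (\int[mu]_y (0 : R))); last by rewrite intR0.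
    apply: le_intR; [|exact: L10|].
      by apply: eq_L1 L10 => y; rewrite mulr0 mul0r normr0.
    by move=> y; rewrite mulr0 mul0r normr0.
  have [L I] := log_kernel K0 xK bh.
  apply: (@le_trans _ _ (\int[mu]_y (`|f x| * `|ln `|x - y| * h y|))).
    rewrite le_eqVlt; apply/orP; left; apply/eqP; apply: eq_intR => y.
    by rewrite !normrM; ring.
  by rewrite intRZ; [rewrite mulrC ler_wpM2r|exact: L1_norm].
- by apply: L1Z; apply: L1_norm; exact: bcs_L1 bf.
Qed.

(** Fubini: the interaction is the integral of one density against the potential of the
    other, which transfers the bounds on potentials to the energy. *)
Lemma logE1 K B B' f h : 0 < K -> bcs K B f -> bcs K B' h ->
  L1 (fun x => f x * logpot h x) /\ logE f h = \int[mu]_x (f x * logpot h x).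
Proof.
move=> K0 bf bh.
have e x : \int[mu]_y (ln `|x - y| * f x * h y) = f x * logpot h x.
  rewrite -intRZ; last exact: log_kernel_L1 bh.
  by apply: eq_intR => y; ring.
rewrite /logE; have [|L ->] := Rfubini1 (logE_prodL1 K0 bf bh).
  move=> x; apply: eq_L1 (L1Z (f x) (log_kernel_L1 x bh)) => y /=; ring.
by split; [apply: eq_L1 L|apply: eq_intR] => x; rewrite -e.
Qed.

Lemma logE2 K B B' f h : 0 < K -> bcs K B f -> bcs K B' h ->
  logE f h = \int[mu]_y (h y * logpot f y).
Proof.
move=> K0 bf bh.
have e y : \int[mu]_x (ln `|x - y| * f x * h y) = h y * logpot f y.
  rewrite -intRZ; last exact: log_kernel_L1 bf.
  by apply: eq_intR => x; rewrite distrC; ring.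
rewrite /logE; have [|_ ->] := Rfubini2 (logE_prodL1 K0 bf bh).
  move=> y; apply: eq_L1 (L1Z (h y) (log_kernel_L1 y bf)) => x /=; rewrite distrC; ring.
by apply: eq_intR => y; rewrite -e.
Qed.

Lemma logE_sym K B B' f h : 0 < K -> bcs K B f -> bcs K B' h -> logE f h = logE h f.
Proof. by move=> K0 bf bh; rewrite (logE2 K0 bf bh) (logE1 K0 bh bf).2. Qed.

Lemma logEDl K B B' C f g h : 0 < K -> bcs K B f -> bcs K B' g -> bcs K C h ->
  logE (fun x => f x + g x) h = logE f h + logE g h.
Proof.
move=> K0 bf bg bh.
have [_ ->] := logE1 K0 (bcsD bf bg) bh.
have [L1 ->] := logE1 K0 bf bh; have [L2 ->] := logE1 K0 bg bh.
by rewrite -intRD//; apply: eq_intR => x; rewrite mulrDl.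
Qed.

Lemma logEZl K B C c f h : 0 < K -> bcs K B f -> bcs K C h ->
  logE (fun x => c * f x) h = c * logE f h.
Proof.
move=> K0 bf bh.
have [_ ->] := logE1 K0 (bcsZ c bf) bh; have [L ->] := logE1 K0 bf bh.
by rewrite -intRZ//; apply: eq_intR => x; rewrite mulrA.
Qed.

Lemma logEBl K B B' C f g h : 0 < K -> bcs K B f -> bcs K B' g -> bcs K C h ->
  logE (fun x => f x - g x) h = logE f h - logE g h.
Proof.
move=> K0 bf bg bh.
have [_ ->] := logE1 K0 (bcsB bf bg) bh.
have [L1 ->] := logE1 K0 bf bh; have [L2 ->] := logE1 K0 bg bh.
by rewrite -intRB//; apply: eq_intR => x; rewrite mulrBl.
Qed.

Lemma logEBr K B B' C f g h : 0 < K -> bcs K B f -> bcs K B' g -> bcs K C h ->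
  logE h (fun x => f x - g x) = logE h f - logE h g.
Proof.
move=> K0 bf bg bh; rewrite (logE_sym K0 bh (bcsB bf bg)) (logEBl K0 bf bg bh).
by rewrite (logE_sym K0 bf bh) (logE_sym K0 bg bh).
Qed.

Lemma logEDr K B B' C f g h : 0 < K -> bcs K B f -> bcs K B' g -> bcs K C h ->
  logE h (fun x => f x + g x) = logE h f + logE h g.
Proof.
move=> K0 bf bg bh; rewrite (logE_sym K0 bh (bcsD bf bg)) (logEDl K0 bf bg bh).
by rewrite (logE_sym K0 bf bh) (logE_sym K0 bg bh).
Qed.

Lemma logEZr K B C c f h : 0 < K -> bcs K B f -> bcs K C h ->
  logE h (fun x => c * f x) = c * logE h f.
Proof.
move=> K0 bf bh; rewrite (logE_sym K0 bh (bcsZ c bf)) (logEZl c K0 bf bh).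
by rewrite (logE_sym K0 bf bh).
Qed.

Lemma bcs0 K : bcs K 0 (fun _ : R => 0).
Proof. by split => // x; rewrite normr0. Qed.

Lemma bcs_sum K B (I : Type) (s : seq I) (F : I -> R -> R) : (forall i, bcs K B (F i)) ->
  bcs K ((size s)%:R * B) (fun x => \sum_(i <- s) F i x).
Proof.
move=> bF; elim: s => [|i s ih].
  have -> : (fun x => \sum_(i <- [::]) F i x) = (fun _ => 0).
    by apply/funext => x; rewrite big_nil.
  by rewrite mul0r; exact: bcs0.
have -> : (fun x => \sum_(j <- i :: s) F j x) = (fun x => F i x + \sum_(j <- s) F j x).
  by apply/funext => x; rewrite big_cons.
have := bcsD (bF i) ih; congr bcs.
by rewrite /= -[in RHS]natr1 mulrDl mul1r addrC.
Qed.

Lemma logE0l h : logE (fun _ => 0) h = 0.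
Proof.
rewrite /logE /Rintegral (_ : (fun z : R * R => _) = cst 0%E) ?integral_cst//= ?mul0e//.
by apply/funext => z; rewrite mulr0 mul0r.
Qed.

Lemma logE_suml K B C (I : Type) (s : seq I) (F : I -> R -> R) h : 0 < K ->
  (forall i, bcs K B (F i)) -> bcs K C h ->
  logE (fun x => \sum_(i <- s) F i x) h = \sum_(i <- s) logE (F i) h.
Proof.
move=> K0 bF bh; elim: s => [|i s ih].
  rewrite big_nil -[RHS](logE0l h); congr logE.
  by apply/funext => x; rewrite big_nil.
rewrite big_cons -ih -(logEDl K0 (bF i) (bcs_sum s bF) bh); congr logE.
by apply/funext => x; rewrite big_cons.
Qed.

Lemma logE_sumr K B C (I : Type) (s : seq I) (F : I -> R -> R) h : 0 < K ->
  (forall i, bcs K B (F i)) -> bcs K C h ->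
  logE h (fun x => \sum_(i <- s) F i x) = \sum_(i <- s) logE h (F i).
Proof.
move=> K0 bF bh; rewrite (logE_sym K0 bh (bcs_sum s bF)) (logE_suml s K0 bF bh).
by apply: eq_bigr => i _; rewrite (logE_sym K0 (bF i) bh).
Qed.

Lemma logE_norm K B B' f h : 0 < K -> bcs K B f -> bcs K B' h ->
  `|logE f h| <= (\int[mu]_x `|f x|) * (B' * potbound K).
Proof.
move=> K0 bf bh; have [L ->] := logE1 K0 bf bh.
have [_ _ fK] := bf; have Lf := L1_norm (bcs_L1 bf).
rewrite mulrC -intRZ//; apply: (le_norm_intR2 L (L1Z _ Lf)) => x.
have [Kx|xK] := ltP K `|x|; first by rewrite fK// mul0r normr0 mulr0.
by rewrite normrM mulrC ler_wpM2r//; exact: logpot_le bh.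
Qed.

(** A one-sided bound on the kernel over the product of the supports is a bound on the
    energy; the diagonal may be left out because single points are null. *)
Lemma logE_le K B B' f h c : 0 < K -> bcs K B f -> bcs K B' h ->
  (forall x, 0 <= f x) -> (forall x, 0 <= h x) ->
  (forall x y, f x != 0 -> h y != 0 -> x != y -> ln `|x - y| <= c) ->
  logE f h <= c * (\int[mu]_x f x) * (\int[mu]_x h x).
Proof.
move=> K0 bf bh f0 h0 lnc; have [L ->] := logE1 K0 bf bh.
rewrite -mulrA mulrCA -mulrC -intRZ; last exact: bcs_L1 bf.
apply: (le_intR L); first by apply: L1Z; exact: bcs_L1 bf.
move=> x; have [->|fx] := eqVneq (f x) 0; first by rewrite mul0r mulr0.
rewrite mulrC ler_wpM2r// /logpot -intRZ; last exact: bcs_L1 bh.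
apply: (@le_intR_off _ x x); [exact: log_kernel_L1 bh|by apply: L1Z; exact: bcs_L1 bh|].
move=> y yx _; have [->|hy] := eqVneq (h y) 0; first by rewrite !mulr0.
by rewrite ler_wpM2r// lnc// eq_sym.
Qed.

Lemma logE_ge K B B' f h c : 0 < K -> bcs K B f -> bcs K B' h ->
  (forall x, 0 <= f x) -> (forall x, 0 <= h x) ->
  (forall x y, f x != 0 -> h y != 0 -> x != y -> c <= ln `|x - y|) ->
  c * (\int[mu]_x f x) * (\int[mu]_x h x) <= logE f h.
Proof.
move=> K0 bf bh f0 h0 lnc; have [L ->] := logE1 K0 bf bh.
rewrite -mulrA mulrCA -mulrC -intRZ; last exact: bcs_L1 bf.
apply: (le_intR _ L); first by apply: L1Z; exact: bcs_L1 bf.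
move=> x; have [->|fx] := eqVneq (f x) 0; first by rewrite mul0r mulr0.
rewrite [leRHS]mulrC ler_wpM2r// /logpot -intRZ; last exact: bcs_L1 bh.
apply: (@le_intR_off _ x x); [by apply: L1Z; exact: bcs_L1 bh|exact: log_kernel_L1 bh|].
move=> y yx _; have [->|hy] := eqVneq (h y) 0; first by rewrite !mulr0.
by rewrite ler_wpM2r// lnc// eq_sym.
Qed.

(** The singularity of the logarithm costs only a constant in the energy of a
    density concentrated at scale d. *)
Lemma logE_self_ge K B f d : 0 < K -> bcs K B f -> (forall x, 0 <= f x) -> 0 < d ->
  (forall x y, f x != 0 -> f y != 0 -> `|x - y| < d) ->
  (ln d * (\int[mu]_x f x) - 8 * B * d) * (\int[mu]_x f x) <= logE f f.
Proof.
move=> K0 bf f0 d0 fd; have [mf fB fK] := bf; have [L ->] := logE1 K0 bf bf.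
have B0 := bcs_B0 bf; have Lf := bcs_L1 bf.
rewrite -intRZ//; apply: (le_intR _ L); first exact: L1Z.
move=> x; have [->|fx] := eqVneq (f x) 0; first by rewrite mul0r mulr0.
rewrite [leRHS]mulrC ler_wpM2r//.
have [Li Ii] := isqrt_near x d0.
pose G y := ln d * f y - 2 * Num.sqrt d * B * (((`|x - y| < d)%R%:R : R) * isqrt (x - y)).
have LG : L1 G by apply: L1B; exact: L1Z.
apply: (@le_trans _ _ (\int[mu]_y G y)).
  rewrite intRB; [|exact: L1Z|exact: L1Z]; rewrite !intRZ// lerD2l lerN2.
  have s0 := sqrtr_ge0 d.
  apply: (@le_trans _ _ (2 * Num.sqrt d * B * (4 * Num.sqrt d))).
    by apply: ler_wpM2l => //; rewrite mulr_ge0// mulr_ge0.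
  have -> : 2 * Num.sqrt d * B * (4 * Num.sqrt d) = 8 * B * Num.sqrt d ^+ 2 by ring.
  by rewrite sqr_sqrtr// ltW.
apply: (@le_intR_off _ x x) => //; first exact: log_kernel_L1 bf.
move=> y yx _; rewrite /G; have i0 := isqrt_ge0 (x - y); have s0 := sqrtr_ge0 d.
have [->|fy] := eqVneq (f y) 0.
  rewrite !mulr0 sub0r oppr_le0; apply: mulr_ge0; last exact: mulr_ge0.
  by rewrite mulr_ge0// mulr_ge0.
rewrite (fd x y)// mul1r.
have xy : x - y != 0 by rewrite subr_eq0 eq_sym.
have u0 : 0 < `|x - y| by rewrite normr_gt0.
have e1 : ln d - 2 * Num.sqrt d * isqrt (x - y) <= ln `|x - y|.
  have := ln1D_isqrt (ltW d0) xy.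
  have := @ln_ratio_le _ `|x - y| d d u0 d0 ltac:(lra); lra.
have e2 : f y <= B by have := fB y; rewrite ger0_norm.
have t0 : 0 <= 2 * Num.sqrt d * isqrt (x - y) by rewrite mulr_ge0// mulr_ge0.
have := ler_wpM2r (f0 y) e1; have := ler_wpM2l t0 e2; lra.
Qed.

End LogEnergy.

(** * Explicit integrals on intervals and on the half-line *)

Section ExplicitIntegrals.
Context {R : realType}.
Implicit Types (f g h F G : R -> R) (a b c x y r t u v d C e : R).
Notation mu := (@lebesgue_measure R).

Lemma intR_FTC F f a b : a < b -> (forall x, a <= x <= b -> is_derive x 1 F (f x)) ->
  (forall x, a <= x <= b -> {for x, continuous f}) ->
  L1 (fun x => \1_(`[a, b]%classic) x * f x) /\
  \int[mu]_x (\1_(`[a, b]%classic) x * f x) = F b - F a.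
Proof.
move=> ab dF cf.
have cfab : {within `[a, b], continuous f}.
  by apply: continuous_in_subspaceT => x; rewrite inE/= in_itv/=; exact: cf.
split.
  apply/L1_indic; first exact: measurable_itv.
  by apply: continuous_compact_integrable => //; exact: segment_compact.
have da : is_derive a 1 F (f a) by apply: dF; rewrite lexx ltW.
have db : is_derive b 1 F (f b) by apply: dF; rewrite lexx ltW.
have dab x : x \in `]a, b[ -> is_derive x 1 F (f x).
  by rewrite in_itv/= => /andP[ax xb]; apply: dF; rewrite !ltW.
rewrite -intR_indic /Rintegral (@continuous_FTC2 _ f F)//.
- split=> [x /dab[]||] //.
  + by apply: cvg_at_right_filter; exact: (der_continuous da).
  + by apply: cvg_at_left_filter; exact: (der_continuous db).
- by move=> x /dab[_]; rewrite derive1E.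
Qed.

Definition halfline t : R := (0 <= t)%R%:R.

Lemma halfline_indic t : halfline t = \1_(`[0, +oo[%classic) t.
Proof. by rewrite /halfline indicE mem_setE in_itv/= andbT. Qed.

Lemma measurable_halfline : measurable_fun setT halfline.
Proof.
have -> : halfline = \1_(`[0, +oo[%classic) by apply/funext => t; exact: halfline_indic.
exact: measurable_indic.
Qed.

(** The exponential rate makes the boundary term at infinity vanish, so the integral on
    the half-line is read off one primitive. *)
Lemma ge0_halfline_FTC F f l C c : 0 < c ->
  (forall t, 0 <= t -> 0 <= f t) -> continuous f ->
  (forall t, is_derive t 1 F (f t)) ->
  (forall t, 0 <= t -> `|F t - l| <= C * expR (- (c * t))) ->
  L1 (fun t => halfline t * f t) /\ \int[mu]_t (halfline t * f t) = l - F 0.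
Proof.
move=> c0 f0 cf dF Fl.
have mf : measurable_fun setT f by exact: continuous_measurable_fun.
have lim : F t @[t --> +oo%R] --> l.
  apply/cvgrPdist_le => /= e e0.
  have C0 : 0 <= C.
    have := Fl 0 (lexx _); rewrite mulr0 oppr0 expR0 mulr1; exact: le_trans.
  near=> t.
  have t0 : 0 <= t by near: t; apply: nbhs_pinfty_ge; exact: num_real.
  rewrite distrC; apply: le_trans (Fl t t0) _.
  have ct : C / e <= c * t.
    by rewrite [c * t]mulrC -ler_pdivrMr//; near: t; apply: nbhs_pinfty_ge; exact: num_real.
  have h : c * t <= expR (c * t) by have := expR_ge1Dx (c * t); lra.
  rewrite expRN ler_pdivrMr ?expR_gt0// mulrC -ler_pdivrMr//.
  exact: le_trans ct h.
have E : (\int[mu]_(t in `[0%R, +oo[) (f t)%:E = l%:E - (F 0)%:E)%E.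
  apply: ge0_continuous_FTC2y.
  - exact: f0.
  - exact: continuous_subspaceT.
  - exact: lim.
  - by move=> x _; case: (dF x).
  - by apply: cvg_at_right_filter; exact: (der_continuous (dF 0)).
  - by move=> x _; rewrite derive1E; case: (dF x).
have mH := measurable_halfline.
have E' : (\int[mu]_t (halfline t * f t)%:E = \int[mu]_(t in `[0%R, +oo[) (f t)%:E)%E.
  rewrite [RHS]integral_mkcond; apply: eq_integral => t _.
  by rewrite patchE halfline_indic indicE; case: ifP; rewrite ?mul1r ?mul0r.
have L : L1 (fun t => halfline t * f t).
  apply: L1_ge0.
  - exact: measurable_funM.
  - move=> t; rewrite /halfline; have [/f0|_] := leP 0 t; rewrite ?mul1r// ?mul0r//.
  - by rewrite E' E -EFinB ltry.
split => //; rewrite -[LHS]/(fine (\int[mu]_t (halfline t * f t)%:E)%E).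
by rewrite E' E.
Unshelve. all: by end_near. Qed.

Lemma continuous_cosM a : continuous (fun t : R => cos (t * a)).
Proof.
move=> t; apply: (@continuous_comp _ _ _ (fun t => t * a) cos); last exact: continuous_cos.
by apply: continuousM; [exact: cvg_id|exact: cvg_cst].
Qed.

Lemma continuous_expNM c : continuous (fun t : R => expR (- (c * t))).
Proof.
move=> t; apply: (@continuous_comp _ _ _ (fun t => - (c * t)) expR); last exact: continuous_expR.
by apply: continuousN; apply: continuousM; [exact: cvg_cst|exact: cvg_id].
Qed.

Lemma der_expNM c t : is_derive t 1 (fun t => expR (- (c * t))) (- c * expR (- (c * t))).
Proof.
have := @der_comp _ (@expR R) (fun t => - (c * t)) t _ _ (is_derive_expR _) (derN (derZ c (derI t))).
by move=> h; apply: is_derive_eq h _; ring.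
Qed.

Lemma der_cosM a t : is_derive t 1 (fun t => cos (t * a)) (- a * sin (t * a)).
Proof.
have := @der_comp _ (@cos R) (fun t => t * a) t _ _ (is_derive_cos _) (derM (derI t) (derC t a)).
by move=> h; apply: is_derive_eq h _; ring.
Qed.

Lemma der_sinM a t : is_derive t 1 (fun t => sin (t * a)) (a * cos (t * a)).
Proof.
have := @der_comp _ (@sin R) (fun t => t * a) t _ _ (is_derive_sin _) (derM (derI t) (derC t a)).
by move=> h; apply: is_derive_eq h _; ring.
Qed.

Definition hexp c t := halfline t * expR (- (c * t)).

Lemma hexp_ge0 c t : 0 <= hexp c t.
Proof. by rewrite mulr_ge0// expR_ge0. Qed.

(** Adding the exponential to its product with the cosine makes the integrand
    nonnegative; the cosine transform is then a difference of two values of one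
    primitive. *)
Lemma hexp_cos1 c a : 0 < c ->
  L1 (fun t => halfline t * (expR (- (c * t)) * (1 + cos (t * a)))) /\
  \int[mu]_t (halfline t * (expR (- (c * t)) * (1 + cos (t * a)))) =
    c^-1 + c / (c ^+ 2 + a ^+ 2).
Proof.
move=> c0; pose D := c ^+ 2 + a ^+ 2.
have D0 : 0 < D by rewrite /D ltr_wpDr ?sqr_ge0// exprn_gt0.
pose F t := expR (- (c * t)) * (D^-1 * (a * sin (t * a) - c * cos (t * a)) - c^-1).
have cE : continuous (fun t : R => expR (- (c * t))) by exact: continuous_expNM.
have cC : continuous (fun t : R => cos (t * a)) by exact: continuous_cosM.
have [t t0|t|t|t t0|L ->] := @ge0_halfline_FTC F
  (fun t => expR (- (c * t)) * (1 + cos (t * a))) 0 (D^-1 * (`|a| + c) + c^-1) c c0.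
- by rewrite mulr_ge0 ?expR_ge0//; have := cos_geN1 (t * a); lra.
- apply: cvgM; first exact: cE.
  by apply: cvgD; [exact: cvg_cst|exact: cC].
- apply: (is_derive_eq (derM (der_expNM c t) (derB (derZ _ (derB (derZ _ (der_sinM a t)) (derZ _ (der_cosM a t)))) (derC t _)))).
  by rewrite /D; field; rewrite !gt_eqF.
- rewrite subr0 /F normrM ger0_norm ?expR_ge0// mulrC ler_wpM2r ?expR_ge0//.
  apply: le_trans (ler_normB _ _) _; rewrite [`|c^-1|]ger0_norm ?invr_ge0 ?(ltW c0)// lerD2r.
  rewrite normrM [`|D^-1|]ger0_norm ?invr_ge0 ?(ltW D0)//.
  apply: ler_wpM2l; first by rewrite invr_ge0 ltW.
  apply: le_trans (ler_normB _ _) _; rewrite !normrM [`|c|]gtr0_norm//; apply: lerD.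
    by rewrite ler_piMr// sin_max.
  by rewrite ler_piMr ?cos_max// ltW.
- by split=> //; rewrite /F mulr0 oppr0 expR0 mul0r sin0 cos0 /D; field; rewrite !gt_eqF.
Qed.

Lemma hexp_L1 c : 0 < c -> L1 (hexp c).
Proof.
move=> c0; have [L _] := hexp_cos1 0 c0.
apply: eq_L1 (L1Z 2^-1 L) => t; rewrite mulr0 cos0 /hexp; by field.
Qed.

Lemma hexp_int c : 0 < c -> \int[mu]_t hexp c t = c^-1.
Proof.
move=> c0; have [L I] := hexp_cos1 0 c0.
transitivity (2^-1 * (c^-1 + c / (c ^+ 2 + 0 ^+ 2))).
  by rewrite -I -intRZ//; apply: eq_intR => t; rewrite mulr0 cos0 /hexp; field.
by field; rewrite gt_eqF.
Qed.

Lemma L1_cos F a : L1 F -> L1 (fun t => F t * cos (t * a)).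
Proof.
move=> LF; have h x : `|cos (x * a)| <= 1 by exact: cos_max.
have := L1M _ h LF; rewrite (_ : (fun x => cos (x * a) * F x) = (fun t => F t * cos (t * a))).
  by apply; apply: continuous_measurable_fun; exact: continuous_cosM.
by apply/funext => t; rewrite mulrC.
Qed.

Lemma hexp_cos c a : 0 < c ->
  \int[mu]_t (hexp c t * cos (t * a)) = c / (c ^+ 2 + a ^+ 2).
Proof.
move=> c0; have [L I] := hexp_cos1 a c0; have Lc := hexp_L1 c0.
have -> : c / (c ^+ 2 + a ^+ 2) = (c^-1 + c / (c ^+ 2 + a ^+ 2)) - c^-1 by ring.
rewrite -I -(hexp_int c0) -intRB//; apply: eq_intR => t; rewrite /hexp; ring.
Qed.

Definition htexp c t := halfline t * (t * expR (- (c * t))).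

Lemma htexp_cos1 c a : 0 < c ->
  L1 (fun t => halfline t * (t * expR (- (c * t)) * (1 + cos (t * a)))) /\
  \int[mu]_t (halfline t * (t * expR (- (c * t)) * (1 + cos (t * a)))) =
    c ^- 2 + (c ^+ 2 - a ^+ 2) / (c ^+ 2 + a ^+ 2) ^+ 2.
Proof.
move=> c0; pose D := c ^+ 2 + a ^+ 2.
have D0 : 0 < D by rewrite /D ltr_wpDr ?sqr_ge0// exprn_gt0.
pose G t := (D^-1 * (a * sin (t * a) - c * cos (t * a)) - c^-1).
pose H t := (D ^- 2 * (2 * a * c * sin (t * a) - (c ^+ 2 - a ^+ 2) * cos (t * a)) - c ^- 2).
pose F t := expR (- (c * t)) * (t * G t + H t).
have cE : continuous (fun t : R => expR (- (c * t))) by exact: continuous_expNM.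
have cC : continuous (fun t : R => cos (t * a)) by exact: continuous_cosM.
pose CG := D^-1 * (`|a| + c) + c^-1.
pose CH := D ^- 2 * (`|2 * a * c| + `|c ^+ 2 - a ^+ 2|) + c ^- 2.
have GC t : `|G t| <= CG.
  apply: le_trans (ler_normB _ _) _; rewrite [`|c^-1|]ger0_norm ?invr_ge0 ?(ltW c0)// lerD2r.
  rewrite normrM [`|D^-1|]ger0_norm ?invr_ge0 ?(ltW D0)//.
  apply: ler_wpM2l; first by rewrite invr_ge0 ltW.
  apply: le_trans (ler_normB _ _) _; rewrite !normrM [`|c|]gtr0_norm//; apply: lerD.
    by rewrite ler_piMr// sin_max.
  by rewrite ler_piMr ?cos_max// ltW.
have HC t : `|H t| <= CH.
  have D20 : 0 <= D ^- 2 by rewrite invr_ge0 exprn_ge0// ltW.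
  have c20 : 0 <= c ^- 2 by rewrite invr_ge0 exprn_ge0// ltW.
  apply: le_trans (ler_normB _ _) _; rewrite [`|c ^- 2|]ger0_norm// lerD2r.
  rewrite normrM [`|D ^- 2|]ger0_norm//; apply: ler_wpM2l => //.
  apply: le_trans (ler_normB _ _) _; rewrite [`|_ * sin _|]normrM [`|_ * cos _|]normrM.
  by apply: lerD; rewrite ler_piMr// ?sin_max ?cos_max.
have [|t t0|t|t|t t0|L ->] := @ge0_halfline_FTC F
  (fun t => t * expR (- (c * t)) * (1 + cos (t * a))) 0 (2 / c * CG + CH) (c / 2).
- by rewrite divr_gt0.
- rewrite mulr_ge0 ?mulr_ge0 ?expR_ge0//; have := cos_geN1 (t * a); lra.
- apply: cvgM; last by apply: cvgD; [exact: cvg_cst|exact: cC].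
  by apply: cvgM; [exact: cvg_id|exact: cE].
- apply: (is_derive_eq (derM (der_expNM c t)
    (derD (derM (derI t) (derB (derZ _ (derB (derZ _ (der_sinM a t)) (derZ _ (der_cosM a t)))) (derC t _)))
      (derB (derZ _ (derB (derZ _ (der_sinM a t)) (derZ _ (der_cosM a t)))) (derC t _))))).
  by rewrite /G /H /D; field; rewrite !gt_eqF.
- rewrite subr0 /F normrM ger0_norm ?expR_ge0//.
  set E := expR (- (c / 2 * t)).
  have -> : expR (- (c * t)) = E * E by rewrite -expRD; congr expR; field.
  have -> : E * E * `|t * G t + H t| = E * `|t * G t + H t| * E by ring.
  have E0 : 0 <= E by exact: expR_ge0.
  have E1 : E <= 1 by rewrite expR_le1 oppr_le0; nra.
  apply: ler_wpM2r => //.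
  have tE : t * E <= 2 / c.
    have h : c / 2 * t <= expR (c / 2 * t) by have := expR_ge1Dx (c / 2 * t); lra.
    rewrite /E expRN ler_pdivrMr ?expR_gt0// mulrC -ler_pdivrMr; last by rewrite divr_gt0.
    by rewrite invf_div mulrC.
  apply: (@le_trans _ _ (t * E * `|G t| + E * `|H t|)).
    have -> : t * E * `|G t| + E * `|H t| = E * (t * `|G t| + `|H t|) by ring.
    by apply: ler_wpM2l => //; apply: le_trans (ler_normD _ _) _; rewrite normrM (ger0_norm t0).
  have := GC t; have := HC t; have := normr_ge0 (G t); have := normr_ge0 (H t).
  have tE0 : 0 <= t * E by rewrite mulr_ge0.
  move=> ? ? ? ?; apply: lerD.
    by apply: ler_pM.
  by apply: le_trans (_ : 1 * `|H t| <= _); [exact: ler_wpM2r|rewrite mul1r].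
- by split=> //; rewrite /F /G /H mulr0 oppr0 expR0 !mul0r sin0 cos0 /D; field; rewrite !gt_eqF.
Qed.

Lemma htexp_L1 c : 0 < c -> L1 (htexp c).
Proof.
move=> c0; have [L _] := htexp_cos1 0 c0.
apply: eq_L1 (L1Z 2^-1 L) => t; rewrite mulr0 cos0 /htexp; by field.
Qed.

Lemma htexp_cos c a : 0 < c ->
  \int[mu]_t (htexp c t * cos (t * a)) = (c ^+ 2 - a ^+ 2) / (c ^+ 2 + a ^+ 2) ^+ 2.
Proof.
move=> c0; have [L I] := htexp_cos1 a c0; have Lc := htexp_L1 c0.
have I0 : \int[mu]_t htexp c t = c ^- 2.
  have [L0 I0] := htexp_cos1 0 c0.
  transitivity (2^-1 * (c ^- 2 + (c ^+ 2 - 0 ^+ 2) / (c ^+ 2 + 0 ^+ 2) ^+ 2)).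
    by rewrite -I0 -intRZ//; apply: eq_intR => t; rewrite mulr0 cos0 /htexp; field.
  by field; rewrite gt_eqF.
have -> : (c ^+ 2 - a ^+ 2) / (c ^+ 2 + a ^+ 2) ^+ 2 =
  (c ^- 2 + (c ^+ 2 - a ^+ 2) / (c ^+ 2 + a ^+ 2) ^+ 2) - c ^- 2 by ring.
rewrite -I -I0 -intRB//; apply: eq_intR => t; rewrite /htexp; ring.
Qed.

End ExplicitIntegrals.

(** * Cosine transforms and the dual norm of the logarithmic energy *)

Section CosineTransforms.
Context {R : realType}.
Implicit Types (f g h F nu : R -> R) (a b c x y r t u v d C e K B L : R).
Notation mu := (@lebesgue_measure R).

(** The real and imaginary parts of the Fourier transform up to sign; working with them
    keeps all integrals real. *)
Definition cosT f t := \int[mu]_x (cos (t * x) * f x).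
Definition sinT f t := \int[mu]_x (sin (t * x) * f x).

Lemma measurable_cos : measurable_fun setT (@cos R).
Proof. by apply: continuous_measurable_fun; exact: continuous_cos. Qed.

Lemma measurable_sin : measurable_fun setT (@sin R).
Proof. by apply: continuous_measurable_fun; exact: continuous_sin. Qed.

Lemma measurable_mul2 : measurable_fun setT (fun z : R * R => z.1 * z.2).
Proof.
by apply: measurable_funM; [exact: (@measurable_fst_comp _ id)|exact: (@measurable_snd_comp _ id)].
Qed.

Let qc (z : R * R) := cos (z.1 * z.2).
Let qs (z : R * R) := sin (z.1 * z.2).

Let mqc : measurable_fun setT qc.
Proof. apply: (measurableT_comp measurable_cos); exact: measurable_mul2. Qed.

Let mqs : measurable_fun setT qs.
Proof. apply: (measurableT_comp measurable_sin); exact: measurable_mul2. Qed.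

Let qc1 z : `|qc z| <= 1. Proof. exact: cos_max. Qed.
Let qs1 z : `|qs z| <= 1. Proof. exact: sin_max. Qed.

Lemma L1_cosT F f : L1 F -> L1 f -> L1 (fun t => F t * cosT f t).
Proof. by move=> LF Lf; exact: (L1_iterated LF Lf mqc qc1). Qed.

Lemma L1_sinT F f : L1 F -> L1 f -> L1 (fun t => F t * sinT f t).
Proof. by move=> LF Lf; exact: (L1_iterated LF Lf mqs qs1). Qed.

Lemma L1_cosM f t : L1 f -> L1 (fun x => cos (t * x) * f x).
Proof.
by move=> Lf; apply: (@L1M _ 1) => //; [exact: (measurable_slice1 t mqc)|move=> x; exact: cos_max].
Qed.

Lemma L1_sinM f t : L1 f -> L1 (fun x => sin (t * x) * f x).
Proof.
by move=> Lf; apply: (@L1M _ 1) => //; [exact: (measurable_slice1 t mqs)|move=> x; exact: sin_max].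
Qed.

Definition cosine_kernel F a := \int[mu]_t (F t * cos (t * a)).

(** The phase cos (t (x - y)) splits into products of functions of x and of y, which
    produces the two transforms of f after exchanging the integrals. *)
Lemma cosine_kernelE F f y : L1 F -> L1 f ->
  L1 (fun x => f x * cosine_kernel F (x - y)) /\
  \int[mu]_x (f x * cosine_kernel F (x - y)) =
  \int[mu]_t (cos (y * t) * (F t * cosT f t)) + \int[mu]_t (sin (y * t) * (F t * sinT f t)).
Proof.
move=> LF Lf.
pose q (z : R * R) := cos (z.2 * (z.1 - y)).
have mq : measurable_fun setT q.
  apply: (measurableT_comp measurable_cos); apply: measurable_funM.
    exact: (@measurable_snd_comp _ id).
  by apply: measurable_funB => //; exact: (@measurable_fst_comp _ id).
have q1 z : `|q z| <= 1 by exact: cos_max.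
have e x : f x * cosine_kernel F (x - y) = f x * \int[mu]_t (q (x, t) * F t).
  by congr (_ * _); apply: eq_intR => t; rewrite mulrC.
split; first by apply: eq_L1 (L1_iterated Lf LF mq q1) => x; rewrite e.
rewrite (eq_intR e) (Rfubini_bounded Lf LF mq q1).
rewrite -intRD; [|exact: L1_cosM (L1_cosT LF Lf)|exact: L1_sinM (L1_sinT LF Lf)].
apply: eq_intR => t.
suff -> : \int[mu]_x (q (x, t) * f x) = cos (y * t) * cosT f t + sin (y * t) * sinT f t.
  by ring.
rewrite -intRZ; last exact: L1_cosM.
rewrite -intRZ; last exact: L1_sinM.
rewrite -intRD; [|by apply: L1Z; exact: L1_cosM|by apply: L1Z; exact: L1_sinM].
apply: eq_intR => x; rewrite /q /= mulrBr cosB [t * y]mulrC; ring.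
Qed.

(** A multiplier on the frequency side is a convolution with its cosine transform on the
    space side: substitute [cosine_kernelE] and exchange the integrals. *)
Lemma parseval F f h : L1 F -> L1 f -> L1 h ->
  [/\ L1 (fun t => F t * (cosT f t * cosT h t + sinT f t * sinT h t)),
      L1 (fun y => h y * \int[mu]_x (f x * cosine_kernel F (x - y))) &
  \int[mu]_t (F t * (cosT f t * cosT h t + sinT f t * sinT h t)) =
  \int[mu]_y (h y * \int[mu]_x (f x * cosine_kernel F (x - y)))].
Proof.
move=> LF Lf Lh.
have Lc := L1_cosT LF Lf; have Ls := L1_sinT LF Lf.
have Lcc := L1_cosT Lc Lh; have Lss := L1_sinT Ls Lh.
have eT t : F t * (cosT f t * cosT h t + sinT f t * sinT h t) =
  F t * cosT f t * cosT h t + F t * sinT f t * sinT h t by ring.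
have L0 := L1D Lcc Lss.
have eY y : h y * \int[mu]_x (f x * cosine_kernel F (x - y)) =
  h y * (\int[mu]_t (qc (y, t) * (F t * cosT f t))) +
  h y * (\int[mu]_t (qs (y, t) * (F t * sinT f t))).
  by rewrite (cosine_kernelE _ LF Lf).2 mulrDr.
have LY1 := L1_iterated Lh Lc mqc qc1; have LY2 := L1_iterated Lh Ls mqs qs1.
split.
- by apply: eq_L1 L0 => t; rewrite eT.
- by apply: eq_L1 (L1D LY1 LY2) => y; rewrite eY.
have e1 : \int[mu]_t (F t * cosT f t * cosT h t) =
    \int[mu]_y (h y * (\int[mu]_t (qc (y, t) * (F t * cosT f t)))).
  rewrite (Rfubini_bounded Lh Lc mqc qc1).
  by apply: eq_intR => t; congr (_ * _); apply: eq_intR => x; rewrite /qc/= [t * x]mulrC.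
have e2 : \int[mu]_t (F t * sinT f t * sinT h t) =
    \int[mu]_y (h y * (\int[mu]_t (qs (y, t) * (F t * sinT f t)))).
  rewrite (Rfubini_bounded Lh Ls mqs qs1).
  by apply: eq_intR => t; congr (_ * _); apply: eq_intR => x; rewrite /qs/= [t * x]mulrC.
apply: etrans (eq_intR eT) _; apply: etrans (esym (eq_intR eY)).
by apply: etrans (intRD Lcc Lss) _; rewrite e1 e2; apply: esym; exact: (intRD LY1 LY2).
Qed.

Lemma hexp_kernel c a : 0 < c -> cosine_kernel (hexp c) a = c / (c ^+ 2 + a ^+ 2).
Proof. exact: hexp_cos. Qed.

(** The function (exp(-at) - exp(-bt)) / t on the half-line, written as an
    integral of exponentials so that its cosine transform is obtained by
    exchanging integrals. *)
Definition frullani a b t := hexp a t *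
  \int[mu]_u (halfline t * halfline (u - a) * expR (- (t * (u - a))) * \1_(`[a, b]%classic) u).

Let qe a (z : R * R) := halfline z.1 * halfline (z.2 - a) * expR (- (z.1 * (z.2 - a))).

Let mqe a : measurable_fun setT (qe a).
Proof.
have m2 : measurable_fun setT (fun z : R * R => z.2 - a).
  by apply: measurable_funB => //; exact: (@measurable_snd_comp _ id).
apply: measurable_funM.
  apply: measurable_funM; first exact: (@measurable_fst_comp _ halfline measurable_halfline).
  exact: (measurableT_comp measurable_halfline m2).
have m3 : measurable_fun setT (fun z : R * R => z.1 * (z.2 - a)).
  by apply: measurable_funM => //; exact: (@measurable_fst_comp _ id).
apply: (measurableT_comp (continuous_measurable_fun (@continuous_expR R))).
exact: measurable_funN m3.
Qed.

Let qe1 a z : `|qe a z| <= 1.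
Proof.
rewrite /qe /halfline; have [z1|_] := leP 0 z.1; last by rewrite !mul0r normr0.
have [z2|_] := leP 0 (z.2 - a); last by rewrite mulr0 mul0r normr0.
rewrite !mul1r ger0_norm ?expR_ge0// expR_le1 oppr_le0; exact: mulr_ge0.
Qed.

Lemma frullani_L1 a b : 0 < a -> L1 (frullani a b).
Proof. by move=> a0; exact: (L1_iterated (hexp_L1 a0) (L1_itv a b) (mqe a) (qe1 a)). Qed.

Lemma frullaniE a b t : 0 < a -> a < b -> 0 < t ->
  frullani a b t = (expR (- (a * t)) - expR (- (b * t))) / t.
Proof.
move=> a0 ab t0.
have dF u : is_derive u 1 (fun u => - t^-1 * expR (- (t * u))) (expR (- (t * u))).
  apply: (is_derive_eq (derZ (- t^-1) (der_expNM t u))).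
  by field; rewrite gt_eqF.
have cf : continuous (fun u : R => expR (- (t * u))) by exact: continuous_expNM.
have [L I] := intR_FTC ab (fun u _ => dF u) (fun u _ => cf u).
transitivity (\int[mu]_u (\1_(`[a, b]%classic) u * expR (- (t * u)))).
  rewrite /frullani -intRZ.
    apply: eq_intR => u; rewrite indic_itvE /hexp /halfline (ltW t0) subr_ge0.
    have [au|] := leP a u; last by rewrite !(mulr0, mul0r).
    rewrite !mul1r mulrA -expRD mulrC; congr (_ * expR _); ring.
  by apply: (@L1M _ 1); [exact: (measurable_slice1 t (mqe a))|move=> u; exact: (qe1 a (t, u))|exact: L1_itv].
by rewrite I [t * b]mulrC [t * a]mulrC; field; rewrite gt_eqF.
Qed.

Lemma frullani_ge0 a b t : 0 <= frullani a b t.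
Proof.
apply: mulr_ge0; first exact: hexp_ge0.
apply: intR_ge0 => u; rewrite mulr_ge0 ?mulr_ge0 ?expR_ge0//.
Qed.

(** Integrating the Poisson kernels u / (u^2 + v^2) over u between a and b. *)
Lemma frullani_kernel a b v : 0 < a -> a < b ->
  cosine_kernel (frullani a b) v = 2^-1 * ln ((b ^+ 2 + v ^+ 2) / (a ^+ 2 + v ^+ 2)).
Proof.
move=> a0 ab; have b0 := lt_trans a0 ab.
have La := hexp_L1 a0.
have e t : frullani a b t * cos (t * v) =
    (hexp a t * cos (t * v)) * \int[mu]_u (qe a (t, u) * \1_(`[a, b]%classic) u).
  by rewrite /frullani; ring.
rewrite /cosine_kernel (eq_intR e) (Rfubini_bounded (L1_cos v La) (L1_itv a b) (mqe a) (qe1 a)).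
have e' u : \1_(`[a, b]%classic) u * \int[mu]_t (qe a (t, u) * (hexp a t * cos (t * v))) =
    \1_(`[a, b]%classic) u * (u / (u ^+ 2 + v ^+ 2)).
  rewrite indic_itvE; have [au|_] := leP a u; last by rewrite !mul0r.
  have u0 : 0 < u by exact: lt_le_trans au.
  have [ub|_] := leP u b; last by rewrite !mul0r.
  rewrite !mul1r -hexp_kernel//; apply: eq_intR => t.
  rewrite /qe /hexp /halfline /= subr_ge0 au.
  have [t0|_] := leP 0 t; last by rewrite !mul0r.
  by rewrite !mul1r mulrA -expRD; congr (expR _ * _); ring.
rewrite (eq_intR e').
have pos u : a <= u <= b -> 0 < u ^+ 2 + v ^+ 2.
  by move=> /andP[au _]; rewrite ltr_wpDr ?sqr_ge0// exprn_gt0// (lt_le_trans a0).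
have dq u : is_derive u 1 (fun u => u ^+ 2 + v ^+ 2) (u * 1 + u * 1 + 0).
  exact: derD (derM (derI u) (derI u)) (derC u _).
have [u /pos u0|u /pos u0|] := @intR_FTC _ (fun u => 2^-1 * ln (u ^+ 2 + v ^+ 2))
  (fun u => u / (u ^+ 2 + v ^+ 2)) _ _ ab.
- have dl := @der_comp _ (@ln R) (fun u => u ^+ 2 + v ^+ 2) u _ _ (is_derive1_ln u0) (dq u).
  apply: (is_derive_eq (derZ 2^-1 dl)).
  by field; rewrite gt_eqF.
- apply: (@continuousM _ _ (fun u => u)); first exact: cvg_id.
  apply: (@continuous_comp _ _ _ (fun u => u ^+ 2 + v ^+ 2) (fun u => u^-1)).
    exact: der_continuous (dq u).
  by apply: inv_continuous; rewrite gt_eqF.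
move=> _ ->; rewrite ln_div ?posrE; first ring.
  by apply: pos; rewrite lexx ltW.
by apply: pos; rewrite lexx ltW.
Qed.

End CosineTransforms.

Section Duality.
Context {R : realType}.
Implicit Types (f g h F nu : R -> R) (a b c x y r t u v d C e K B L : R).
Notation mu := (@lebesgue_measure R).

(** Up to a constant that a density of total mass zero does not see, the
    kernel of the Frullani function approximates minus the logarithm. *)
Lemma frullani_kernel_approx e a : 0 < e -> e < 1 -> a != 0 ->
  `|cosine_kernel (frullani (2 * e) (2 * e^-1)) a - ln (2 * e^-1) + ln `|a| |
  <= a ^+ 2 * e ^+ 2 + 2 * Num.sqrt (2 * e) * isqrt a.
Proof.
move=> e0 e1 a0; have v0 : 0 < e^-1 by rewrite invr_gt0.
have ev : e < e^-1 by rewrite (lt_trans e1)// invf_gt1.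
have u0 : 0 < `|a| by rewrite normr_gt0.
have a20 : 0 < a ^+ 2 by rewrite exprn_even_gt0.
have e20 : 0 < e ^+ 2 by rewrite exprn_gt0.
set b := 2 * e^-1; have b0 : 0 < b by rewrite mulr_gt0.
have b2 : 0 < b ^+ 2 by rewrite exprn_gt0.
have d2 : 0 < (2 * e) ^+ 2 by rewrite exprn_gt0// mulr_gt0.
rewrite frullani_kernel; [|by rewrite mulr_gt0|by rewrite /b ltr_pM2l].
have E1 : b ^+ 2 + a ^+ 2 = b ^+ 2 * (1 + (a / b) ^+ 2).
  by rewrite /b; field; rewrite gt_eqF.
have E2 : (2 * e) ^+ 2 + a ^+ 2 = `|a| ^+ 2 * (1 + (2 * e / `|a|) ^+ 2).
  by rewrite -[a ^+ 2]real_normK ?num_real//; field; rewrite gt_eqF.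
set X := (a / b) ^+ 2; set Y := (2 * e / `|a|) ^+ 2.
have X0 : 0 <= X by exact: sqr_ge0.
have Y0 : 0 <= Y by exact: sqr_ge0.
have X1 : 0 < 1 + X by lra.
have Y1 : 0 < 1 + Y by lra.
have -> : 2^-1 * ln ((b ^+ 2 + a ^+ 2) / ((2 * e) ^+ 2 + a ^+ 2)) - ln b + ln `|a| =
    2^-1 * ln (1 + X) - 2^-1 * ln (1 + Y).
  have l1 : ln (b ^+ 2 * (1 + X)) = 2 * ln b + ln (1 + X).
    by rewrite lnM ?posrE// lnXn// mulr2n; ring.
  have a2n : 0 < `|a| ^+ 2 by rewrite exprn_gt0.
  have l2 : ln (`|a| ^+ 2 * (1 + Y)) = 2 * ln `|a| + ln (1 + Y).
    by rewrite lnM ?posrE// lnXn// mulr2n; ring.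
  rewrite E1 E2 ln_div ?posrE; [|exact: mulr_gt0|exact: mulr_gt0].
  by rewrite l1 l2; field.
have lX : ln (1 + X) <= X by apply: le_ln1Dx; lra.
have lX0 : 0 <= ln (1 + X) by apply: ln_ge0; lra.
have lY0 : 0 <= ln (1 + Y) by apply: ln_ge0; lra.
have lY : 2^-1 * ln (1 + Y) <= 2 * Num.sqrt (2 * e) * isqrt a.
  apply: le_trans (ln1D_isqrt (_ : 0 <= 2 * e) a0); last by rewrite mulr_ge0// ltW.
  have w0 : 0 <= 2 * e / `|a| by rewrite divr_ge0// mulr_ge0// ltW.
  have w1 : 0 < (1 + 2 * e / `|a|) ^+ 2 by rewrite exprn_gt0//; lra.
  have : ln (1 + Y) <= ln ((1 + 2 * e / `|a|) ^+ 2).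
    by rewrite ler_ln ?posrE// /Y; nra.
  rewrite lnXn; last lra.
  by rewrite mulr2n; lra.
have XE : X = a ^+ 2 * e ^+ 2 / 4 by rewrite /X /b; field; rewrite gt_eqF.
have := mulr_ge0 (ltW a20) (ltW e20).
by rewrite ler_norml => ?; apply/andP; split; lra.
Qed.

(** On a density of total mass zero the constant term of the kernel integrates to zero,
    so minus the logarithmic energy is a weighted square norm of the Fourier transform,
    up to an error that vanishes with e. *)
Lemma mass_zero_energy K B nu e : 0 < K -> bcs K B nu -> \int[mu]_x nu x = 0 ->
  0 < e -> e < 1 ->
  `|\int[mu]_t (frullani (2 * e) (2 * e^-1) t * (cosT nu t ^+ 2 + sinT nu t ^+ 2))
    + logE nu nu| <=
  (\int[mu]_x `|nu x|) * (4 * K ^+ 2 * e ^+ 2 * (B * (2 * K)) +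
     2 * Num.sqrt (2 * e) * (B * (4 * Num.sqrt (3 * K)))).
Proof.
move=> K0 bnu nu0 e0 e1; have v0 : 0 < e^-1 by rewrite invr_gt0.
have [mnu nuB nuK] := bnu; have Lnu := bcs_L1 bnu; have B0 := bcs_B0 bnu.
set b := ln (2 * e^-1); set F := frullani _ _.
have LF : L1 F by apply: frullani_L1; rewrite mulr_gt0.
have [L0 LY IY] := parseval LF Lnu Lnu.
have [LE IE] := logE1 K0 bnu bnu.
have -> : \int[mu]_t (F t * (cosT nu t ^+ 2 + sinT nu t ^+ 2)) =
    \int[mu]_y (nu y * \int[mu]_x (nu x * cosine_kernel F (x - y))) by rewrite -IY.
rewrite IE -intRD//.
have inner y : \int[mu]_x (nu x * cosine_kernel F (x - y)) + logpot nu y =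
    \int[mu]_x (nu x * (cosine_kernel F (x - y) - b + ln `|x - y|)).
  have [LK _] := cosine_kernelE y LF Lnu.
  have Lp := log_kernel_L1 y bnu.
  have -> : \int[mu]_x (nu x * cosine_kernel F (x - y)) =
      \int[mu]_x (nu x * cosine_kernel F (x - y) - b * nu x).
    by rewrite (intRB LK (L1Z b Lnu)) (intRZ b Lnu) nu0 mulr0 subr0.
  rewrite /logpot -intRD//; last by apply: L1B => //; exact: L1Z.
  by apply: eq_intR => x; rewrite distrC; ring.
set c := (4 * K ^+ 2 * e ^+ 2 * (B * (2 * K)) + _).
have LL : L1 (fun y => nu y * \int[mu]_x (nu x * cosine_kernel F (x - y)) + nu y * logpot nu y).
  exact: L1D.
rewrite mulrC -intRZ; last exact: L1_norm.
apply: (le_norm_intR2 LL); first by apply: L1Z; exact: L1_norm.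
move=> y; rewrite -mulrDr inner normrM [c * _]mulrC.
have [Ky|yK] := ltP K `|y|; first by rewrite nuK// normr0 !mul0r.
apply: ler_wpM2l => //.
have [Li Ii] := isqrt_kernel K0 yK bnu.
pose D x := (4 * K ^+ 2 * e ^+ 2) * `|nu x| + 2 * Num.sqrt (2 * e) * (isqrt (y - x) * `|nu x|).
have LD : L1 D by apply: L1D; apply: L1Z => //; exact: L1_norm.
have Lin : L1 (fun x => nu x * (cosine_kernel F (x - y) - b + ln `|x - y|)).
  have [LK _] := cosine_kernelE y LF Lnu.
  have := L1D (L1B LK (L1Z b Lnu)) (log_kernel_L1 y bnu).
  by apply: eq_L1 => x; rewrite distrC; ring.
apply: le_trans (le_norm_intR Lin) _.
apply: (@le_trans _ _ (\int[mu]_x D x)); last first.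
  rewrite intRD; [|by apply: L1Z; exact: L1_norm|exact: L1Z].
  rewrite !intRZ//; last exact: L1_norm.
  have c1 : 0 <= 4 * K ^+ 2 * e ^+ 2 by apply: mulr_ge0; [apply: mulr_ge0|]; rewrite ?sqr_ge0.
  have c2 : 0 <= 2 * Num.sqrt (2 * e) by rewrite mulr_ge0// sqrtr_ge0.
  apply: lerD; first exact: (ler_wpM2l c1 (bcs_norm_int (ltW K0) bnu)).
  exact: (ler_wpM2l c2 Ii).
apply: (@le_intR_off _ y y); [exact: L1_norm|exact: LD|].
move=> x xy _; have [Kx|xK] := ltP K `|x|; first by rewrite /D nuK// !(mul0r, normr0, mulr0) addr0.
have xy0 : x - y != 0 by rewrite subr_eq0.
rewrite normrM /D [2 * _ * (_ * _)]mulrA -mulrDl mulrC; apply: ler_wpM2r => //.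
apply: le_trans (frullani_kernel_approx e0 e1 xy0) _.
have -> : isqrt (x - y) = isqrt (y - x) by rewrite /isqrt distrC.
rewrite lerD2r; apply: ler_wpM2r; first exact: sqr_ge0.
have h : `|x - y| <= 2 * K by have := ler_normB x y; move: xK yK; clear; lra.
rewrite -[(x - y) ^+ 2]real_normK ?num_real//.
by have := normr_ge0 (x - y); move: h; clear; nra.
Qed.

(** The multiplier exp(-e|t|) smooths a Lipschitz function by the Poisson
    kernel, an approximate identity. *)
Lemma poisson_approx K B L g e y : 0 < K -> bcs K B g -> 0 <= L ->
  (forall x x', `|g x - g x'| <= L * `|x - x'|) -> 0 < e -> `|y| <= K ->
  `|\int[mu]_x (g x * cosine_kernel (hexp e) (x - y)) - pi * g y| <=
  L * Num.sqrt e * (4 * Num.sqrt (4 * K)) + B * `|pi - 2 * atan (3 * K / e)|.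
Proof.
move=> K0 bg L0 gL e0 yK; have [mg gB gK] := bg; have Lg := bcs_L1 bg.
pose P x := e / (e ^+ 2 + (x - y) ^+ 2).
have D0 x : 0 < e ^+ 2 + (x - y) ^+ 2 by rewrite ltr_wpDr ?sqr_ge0// exprn_gt0.
have P0 x : 0 <= P x by rewrite divr_ge0 ?ltW.
have LgP : L1 (fun x => g x * P x).
  have [L' _] := cosine_kernelE y (hexp_L1 e0) Lg.
  by apply: eq_L1 L' => x; rewrite hexp_kernel.
have -> : \int[mu]_x (g x * cosine_kernel (hexp e) (x - y)) = \int[mu]_x (g x * P x).
  by apply: eq_intR => x; rewrite hexp_kernel.
pose W := \1_(`[y - 3 * K, y + 3 * K]%classic) : R -> R.
have WE x : W x = (`|x - y| <= 3 * K)%R%:R.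
  rewrite /W indic_itvE ler_norml; congr (_%:R); congr nat_of_bool.
  by apply/idP/idP => /andP[h1 h2]; apply/andP; split; lra.
have dP x : is_derive x 1 (fun x => atan ((x - y) / e)) (P x).
  have := @der_comp _ (@atan R) (fun x => (x - y) / e) x _ _ (is_derive1_atan _)
    (derM (derB (derI x) (derC x y)) (derC x e^-1)).
  move=> h; apply: (is_derive_eq h); rewrite /P; field.
  by rewrite !gt_eqF//= ltr_wpDr ?sqr_ge0// exprn_gt0.
have cP x : {for x, continuous P}.
  apply: (@continuousM _ _ (fun _ => e)); first exact: cvg_cst.
  apply: (@continuous_comp _ _ _ (fun x => e ^+ 2 + (x - y) ^+ 2) (fun u => u^-1)).
    exact: der_continuous (derD (derC x (e ^+ 2)) (derM (derB (derI x) (derC x y)) (derB (derI x) (derC x y)))).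
  by apply: inv_continuous; rewrite gt_eqF.
have yy : y - 3 * K < y + 3 * K by lra.
have [LW IW] := intR_FTC yy (fun x _ => dP x) (fun x _ => cP x).
have {}IW : \int[mu]_x (W x * P x) = 2 * atan (3 * K / e).
  rewrite IW.
  have -> : (y - 3 * K - y) / e = - (3 * K / e) by ring.
  have -> : (y + 3 * K - y) / e = 3 * K / e by ring.
  by rewrite atanN; ring.
have gW x : W x * (g x * P x) = g x * P x.
  rewrite WE; have [_|h] := leP `|x - y| (3 * K); first by rewrite mul1r.
  by rewrite gK ?mul0r ?mulr0//; have := ler_normB x y; lra.
have split x : g x * P x - g y * (W x * P x) = W x * ((g x - g y) * P x).
  by rewrite -[in LHS]gW; ring.
have LD : L1 (fun x => W x * ((g x - g y) * P x)).
  by apply: eq_L1 (L1B LgP (L1Z (g y) LW)) => x; rewrite -split.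
have ID : \int[mu]_x (g x * P x) = \int[mu]_x (W x * ((g x - g y) * P x)) + g y * (2 * atan (3 * K / e)).
  rewrite -IW -(intRZ _ LW) -(intRD LD (L1Z _ LW)).
  by apply: eq_intR => x; rewrite -split; ring.
have -> : \int[mu]_x (g x * P x) - pi * g y = \int[mu]_x (W x * ((g x - g y) * P x)) -
    g y * (pi - 2 * atan (3 * K / e)) by rewrite ID; ring.
apply: le_trans (ler_normB _ _) _; apply: lerD; last by rewrite normrM ler_wpM2r.
have K40 : 0 < 4 * K by lra.
have [Li Ii] := isqrt_near y K40.
apply: (@le_trans _ _ (L * Num.sqrt e * \int[mu]_x (((`|y - x| < 4 * K)%R%:R : R) * isqrt (y - x)))).
  rewrite -intRZ//; apply: (le_norm_intR2 LD); first exact: L1Z.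
  move=> x; rewrite WE distrC; have [h|_] := leP `|y - x| (3 * K); last first.
    by rewrite mul0r normr0 !mulr_ge0 ?sqrtr_ge0 ?isqrt_ge0.
  have -> : `|y - x| < 4 * K by lra.
  rewrite !mul1r normrM (ger0_norm (P0 x)).
  apply: (@le_trans _ _ (L * `|x - y| * P x)); first by rewrite ler_wpM2r.
  rewrite -!mulrA ler_wpM2l// /P /isqrt distrC.
  have [->|a0] := eqVneq (`|y - x|) 0.
    by rewrite mul0r mulr_ge0 ?sqrtr_ge0// invr_ge0 sqrtr_ge0.
  have u0 : 0 < `|y - x| by rewrite lt_def a0 normr_ge0.
  have q0 : 0 < Num.sqrt `|y - x| by rewrite sqrtr_gt0.
  have p0 : 0 < Num.sqrt e by rewrite sqrtr_gt0.
  rewrite mulrA ler_pdivrMr// mulrAC ler_pdivlMr//.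
  have -> : (x - y) ^+ 2 = `|y - x| ^+ 2 by rewrite real_normK ?num_real//; ring.
  have eE : e = Num.sqrt e ^+ 2 by rewrite sqr_sqrtr// ltW.
  have uE : `|y - x| = Num.sqrt `|y - x| ^+ 2 by rewrite sqr_sqrtr.
  set p := Num.sqrt e in p0 eE *; set q := Num.sqrt `|y - x| in q0 uE *.
  rewrite uE eE.
  have -> : q ^+ 2 * p ^+ 2 * q = p * (p * q ^+ 3) by ring.
  rewrite ler_pM2l// -!exprM.
  have p4 : 0 <= p ^+ 4 by rewrite exprn_ge0// ltW.
  have q4 : 0 <= q ^+ 4 by rewrite exprn_ge0// ltW.
  have q3 : 0 <= q ^+ 3 by rewrite exprn_ge0// ltW.
  have [pq|qp] := leP p q.
    by have := ler_wpM2r q3 pq; rewrite -exprS; lra.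
  have : q ^+ 3 <= p ^+ 3 by rewrite lerXn2r ?nnegrE ?ltW.
  by move=> h3; have := ler_wpM2l (ltW p0) h3; rewrite -exprS; lra.
by apply: ler_wpM2l => //; rewrite mulr_ge0 ?sqrtr_ge0.
Qed.

(** The three terms are the orders of the errors of the Fourier regularization. *)
Lemma small_scale (a1 a2 a3 r eta : R) : 0 <= a1 -> 0 <= a2 -> 0 <= a3 -> 0 < r -> 0 < eta ->
  exists e : R, [/\ 0 < e, e < 1 &
    a1 * e + a2 * Num.sqrt e + a3 * `|pi - 2 * atan (r / e)| <= eta].
Proof.
move=> a10 a20 a30 r0 eta0.
pose s := eta / (2 * (a1 + a2 + 1)); pose d := eta / (4 * (a3 + 1)).
have s0 : 0 < s by rewrite divr_gt0// mulr_gt0//; lra.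
have d0 : 0 < d by rewrite divr_gt0// mulr_gt0//; lra.
have [A [A0 Aat]] : exists A : R, 0 < A /\ forall v, A < v -> `|pi / 2 - atan v| <= d.
  have /cvgrPdist_le /(_ d d0) [M [_ MA]] := @cvgy_atan R.
  exists (Num.max M 1); split; first by rewrite lt_max ltr01 orbT.
  by move=> v; rewrite gt_max => /andP[Mv _]; exact: MA.
pose e := Num.min (2^-1) (Num.min (s ^+ 2) (r / (2 * A))).
have e0 : 0 < e by rewrite !lt_min invr_gt0 ltr0n exprn_gt0// divr_gt0// mulr_gt0.
have e2 : e <= 2^-1 by rewrite ge_min lexx.
have es : e <= s ^+ 2 by rewrite !ge_min lexx !orbT.
have er : e <= r / (2 * A) by rewrite !ge_min lexx !orbT.
exists e; split => //; first lra.
have se : Num.sqrt e <= s.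
  by rewrite -(ger0_norm (ltW s0)) -sqrtr_sqr ler_sqrt// exprn_ge0// ltW.
have sq0 : 0 < Num.sqrt e by rewrite sqrtr_gt0.
have ee : e <= Num.sqrt e.
  rewrite -{1}(sqr_sqrtr (ltW e0)) expr2 ger_pMr//.
  have : Num.sqrt e <= Num.sqrt 1 by rewrite ler_sqrt//; lra.
  by rewrite sqrtr1.
have at_ : `|pi - 2 * atan (r / e)| <= 2 * d.
  have -> : pi - 2 * atan (r / e) = 2 * (pi / 2 - atan (r / e)) by field.
  rewrite normrM ger0_norm// ler_pM2l//; apply: Aat.
  rewrite ltr_pdivlMr//; move: er; rewrite ler_pdivlMr ?mulr_gt0//.
  have : 0 < A * e by rewrite mulr_gt0.
  lra.
have sE : 2 * (a1 + a2 + 1) * s = eta by rewrite /s; field; rewrite gt_eqF//; lra.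
have dE : 4 * (a3 + 1) * d = eta by rewrite /d; field; rewrite gt_eqF//; lra.
have h1 : a1 * e <= a1 * s by apply: ler_wpM2l => //; lra.
have h2 : a2 * Num.sqrt e <= a2 * s by apply: ler_wpM2l.
have h3 : a3 * `|pi - 2 * atan (r / e)| <= a3 * (2 * d) by apply: ler_wpM2l.
lra.
Qed.

(** Up to constants, the half-norm and the square root of minus the logarithmic energy are
    dual norms: both are weighted square norms of Fourier transforms, with weights t and
    1 / t. With the regularized weight M = exp (-et) - exp (-t/e) one has M^2 / t <= F for
    the Frullani function F, so the inequality of arithmetic and geometric means applies
    frequency by frequency, and e tends to zero. *)
Lemma fourier_duality K B B' L g nu c : 0 < K -> bcs K B g -> 0 <= L ->
  (forall x x', `|g x - g x'| <= L * `|x - x'|) ->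
  bcs K B' nu -> \int[mu]_x nu x = 0 ->
  L1 (fun t => halfline t * t * (cosT g t ^+ 2 + sinT g t ^+ 2)) -> 0 < c ->
  2 * pi * \int[mu]_x (g x * nu x) <=
  c * \int[mu]_t (halfline t * t * (cosT g t ^+ 2 + sinT g t ^+ 2)) - logE nu nu / c.
Proof.
move=> K0 bg L0 gL bnu nu0 LA c0.
set A := (X in _ <= c * X - _).
have [mg gB gK] := bg; have Lg := bcs_L1 bg; have B0 := bcs_B0 bg.
have [mnu nuB nuK] := bnu; have Lnu := bcs_L1 bnu; have B'0 := bcs_B0 bnu.
set n1 := \int[mu]_x `|nu x|; have n10 : 0 <= n1 by exact: intR_ge0.
apply/ler_addgt0Pl => eta eta0.
pose a1 := 2 * n1 * (B * (2 * K)) + c^-1 * (n1 * (4 * K ^+ 2 * (B' * (2 * K)))).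
pose a2 := 2 * n1 * (L * (4 * Num.sqrt (4 * K))) +
  c^-1 * (n1 * (2 * Num.sqrt 2 * (B' * (4 * Num.sqrt (3 * K))))).
pose a3 := 2 * n1 * B.
have s4 := sqrtr_ge0 (4 * K); have s3 := sqrtr_ge0 (3 * K); have s2 := @sqrtr_ge0 R 2.
have ci0 : 0 < c^-1 by rewrite invr_gt0.
have K20 := sqr_ge0 K.
have p1 : 0 <= B * (2 * K) by rewrite mulr_ge0//; lra.
have p2 : 0 <= B' * (2 * K) by rewrite mulr_ge0//; lra.
have p3 : 0 <= L * (4 * Num.sqrt (4 * K)) by rewrite mulr_ge0//; lra.
have p4 : 0 <= B' * (4 * Num.sqrt (3 * K)) by rewrite mulr_ge0//; lra.
have p5 : 0 <= n1 * (4 * K ^+ 2 * (B' * (2 * K))) by rewrite mulr_ge0// mulr_ge0//; lra.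
have p6 : 0 <= n1 * (2 * Num.sqrt 2 * (B' * (4 * Num.sqrt (3 * K)))).
  by rewrite mulr_ge0// mulr_ge0//; lra.
have a10 : 0 <= a1 by rewrite addr_ge0// mulr_ge0//; [lra|exact: ltW].
have a20 : 0 <= a2 by rewrite addr_ge0// mulr_ge0//; [lra|exact: ltW].
have a30 : 0 <= a3 by rewrite mulr_ge0//; lra.
have [//|e [e0 e1 small]] := @small_scale a1 a2 a3 (3 * K) eta a10 a20 a30 _ eta0; first lra.
have U0 : 0 < e^-1 by rewrite invr_gt0.
(* Subtracting the second exponential makes M^2 / t integrable at 0, and its cosine
   kernel is O(e). *)
pose M t := hexp e t - hexp e^-1 t.
have LM : L1 M by apply: L1B; exact: hexp_L1.
have MK a : cosine_kernel M a = cosine_kernel (hexp e) a - cosine_kernel (hexp e^-1) a.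
  rewrite /cosine_kernel -intRB; [|exact/L1_cos/hexp_L1|exact/L1_cos/hexp_L1].
  by apply: eq_intR => t; rewrite mulrBl.
have [LX LY IX] := parseval LM Lg Lnu.
set F := frullani (2 * e) (2 * e^-1).
have LF : L1 F by apply: frullani_L1; rewrite mulr_gt0.
have [LFX _ _] := parseval LF Lnu Lnu.
have LFX' : L1 (fun t => F t * (cosT nu t ^+ 2 + sinT nu t ^+ 2)) by exact: eq_L1 LFX.
have gm := mass_zero_energy K0 bnu nu0 e0 e1.
set J := \int[mu]_t (F t * (cosT nu t ^+ 2 + sinT nu t ^+ 2)) in gm.
have up : 2 * \int[mu]_t (M t * (cosT g t * cosT nu t + sinT g t * sinT nu t)) <= c * A + c^-1 * J.
  rewrite /A /J -intRZ// -intRZ// -intRZ// -intRD; [|exact: L1Z|exact: L1Z].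
  apply: le_intR; [exact: L1Z|by apply: L1D; exact: L1Z|].
  move=> t; rewrite /M /hexp /halfline.
  have cc := sqr_ge0 (cosT g t); have ss := sqr_ge0 (sinT g t).
  have cn := sqr_ge0 (cosT nu t); have sn := sqr_ge0 (sinT nu t).
  have F0 := frullani_ge0 (2 * e) (2 * e^-1) t.
  have R0 : 0 <= c^-1 * (F t * (cosT nu t ^+ 2 + sinT nu t ^+ 2)).
    by apply: mulr_ge0; [exact: ltW|apply: mulr_ge0 => //; exact: addr_ge0].
  have [t0|t0] := ltP 0 t; last first.
    have -> : (0 <= t)%R%:R * expR (- (e * t)) - (0 <= t)%R%:R * expR (- (e^-1 * t)) = 0 :> R.
      have [t1|_] := leP 0 t; last by rewrite !mul0r subrr.
      by have -> : t = 0 by [apply/eqP; rewrite eq_le t0]; rewrite !mulr0 subrr.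
    rewrite !mul0r mulr0.
    have -> : (0 <= t)%R%:R * t = 0 :> R.
      have [t1|_] := leP 0 t; last by rewrite mul0r.
      by apply/eqP; rewrite mul1r eq_le t0.
    by rewrite mul0r mulr0 add0r.
  rewrite (ltW t0) !mul1r /F frullaniE//; first last.
  - by rewrite ltr_pM2l// (lt_trans e1)// invf_gt1.
  - by rewrite mulr_gt0.
  set E1 := expR (- (e * t)); set E2 := expR (- (e^-1 * t)).
  have -> : expR (- (2 * e * t)) = E1 ^+ 2.
    by rewrite -expRM_natl; congr expR; ring.
  have -> : expR (- (2 * e^-1 * t)) = E2 ^+ 2.
    by rewrite -expRM_natl; congr expR; ring.
  have E20 : 0 <= E2 by exact: expR_ge0.
  have E12 : E2 <= E1.
    rewrite ler_expR lerN2; apply: ler_wpM2r; first exact: ltW.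
    by apply: ltW; rewrite (lt_trans e1)// invf_gt1.
  have m2 : (E1 - E2) ^+ 2 / t <= (E1 ^+ 2 - E2 ^+ 2) / t.
    by rewrite ler_pM2r ?invr_gt0//; nra.
  have amgm u v : 2 * ((E1 - E2) * (u * v)) <=
      c * (t * u ^+ 2) + c^-1 * ((E1 - E2) ^+ 2 / t * v ^+ 2).
    rewrite -subr_ge0.
    have -> : c * (t * u ^+ 2) + c^-1 * ((E1 - E2) ^+ 2 / t * v ^+ 2) - 2 * ((E1 - E2) * (u * v)) =
       (c * t)^-1 * (c * t * u - (E1 - E2) * v) ^+ 2.
      by field; rewrite !gt_eqF.
    by rewrite mulr_ge0 ?sqr_ge0// invr_ge0 mulr_ge0// ltW.
  have h1 := amgm (cosT g t) (cosT nu t); have h2 := amgm (sinT g t) (sinT nu t).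
  have h3 : c^-1 * ((E1 - E2) ^+ 2 / t * (cosT nu t ^+ 2 + sinT nu t ^+ 2)) <=
            c^-1 * ((E1 ^+ 2 - E2 ^+ 2) / t * (cosT nu t ^+ 2 + sinT nu t ^+ 2)).
    by apply: ler_wpM2l; [exact: ltW|apply: ler_wpM2r => //; exact: addr_ge0].
  lra.
have lowE : `|\int[mu]_y (nu y * \int[mu]_x (g x * cosine_kernel M (x - y))) -
             \int[mu]_y (pi * (g y * nu y))| <=
   n1 * (L * Num.sqrt e * (4 * Num.sqrt (4 * K)) + B * `|pi - 2 * atan (3 * K / e)| + e * (B * (2 * K))).
  have Lgn : L1 (fun y => g y * nu y) by exact: L1M mg gB Lnu.
  rewrite -intRB//; last exact: L1Z.
  set cst := (X in _ <= n1 * X).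
  rewrite mulrC /n1 -intRZ; last exact: L1_norm.
  apply: le_norm_intR2; [by apply: L1B => //; exact: L1Z|by apply: L1Z; exact: L1_norm|].
  move=> y; have [Ky|yK] := ltP K `|y|.
    by rewrite nuK// normr0 mul0r !mulr0 subrr normr0.
  have -> : nu y * \int[mu]_x (g x * cosine_kernel M (x - y)) - pi * (g y * nu y) =
     (\int[mu]_x (g x * cosine_kernel M (x - y)) - pi * g y) * nu y by ring.
  rewrite normrM; apply: ler_wpM2r => //.
  have [L1' _] := cosine_kernelE y (hexp_L1 e0) Lg.
  have [L2' _] := cosine_kernelE y (hexp_L1 U0) Lg.
  have -> : \int[mu]_x (g x * cosine_kernel M (x - y)) =
    \int[mu]_x (g x * cosine_kernel (hexp e) (x - y)) -
    \int[mu]_x (g x * cosine_kernel (hexp e^-1) (x - y)).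
    by rewrite -(intRB L1' L2'); apply: eq_intR => x; rewrite MK mulrBr.
  rewrite addrAC; apply: le_trans (ler_normB _ _) _; apply: lerD; first exact: poisson_approx bg L0 gL e0 yK.
  apply: (@le_trans _ _ (\int[mu]_x (e * `|g x|))).
    apply: (le_norm_intR2 L2'); first by apply: L1Z; exact: L1_norm.
    move=> x; rewrite normrM mulrC; apply: ler_wpM2r => //.
    rewrite hexp_kernel// ger0_norm; last by rewrite divr_ge0 ?ltW// ltr_wpDr ?sqr_ge0// exprn_gt0.
    rewrite ler_pdivrMr; last by rewrite ltr_wpDr ?sqr_ge0// exprn_gt0.
    have -> : e * ((e^-1) ^+ 2 + (x - y) ^+ 2) = e^-1 + e * (x - y) ^+ 2.
      by field; rewrite gt_eqF.
    by rewrite lerDl mulr_ge0 ?sqr_ge0 ?ltW.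
  rewrite intRZ; last exact: L1_norm.
  by apply: ler_wpM2l; [exact: ltW|exact: bcs_norm_int (ltW K0) bg].
have Lgn : L1 (fun y => g y * nu y) by exact: L1M mg gB Lnu.
rewrite -IX intRZ// in lowE.
set X := \int[mu]_t (M t * _) in up lowE.
have s2e : Num.sqrt (2 * e) = Num.sqrt 2 * Num.sqrt e by rewrite sqrtrM.
rewrite -/n1 s2e in gm.
have ee : e ^+ 2 <= e by rewrite expr2 ger_pMr// ltW.
have gm2 : c^-1 * J <= - logE nu nu / c + c^-1 * (n1 * (4 * K ^+ 2 * (B' * (2 * K)))) * e +
   c^-1 * (n1 * (2 * Num.sqrt 2 * (B' * (4 * Num.sqrt (3 * K))))) * Num.sqrt e.
  have h : J <= - logE nu nu + n1 * (4 * K ^+ 2 * (B' * (2 * K))) * e +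
     n1 * (2 * Num.sqrt 2 * (B' * (4 * Num.sqrt (3 * K)))) * Num.sqrt e.
    have := ler_wpM2l p5 ee.
    move: gm; rewrite ler_norml => /andP[_]; lra.
  have := ler_wpM2l (ltW ci0) h; lra.
move: lowE small; rewrite ler_norml => /andP[lo _]; rewrite /a1 /a2 /a3; lra.
Qed.

End Duality.

(** * The half-norm of a Lipschitz function *)

Section HalfNorm.
Context {R : realType}.
Implicit Types (f g h F nu : R -> R) (a b c x y r t u v d C e K B L : R).
Notation mu := (@lebesgue_measure R).

(** The cosine transform of t exp (-et), a regularization of -1 / a^2. *)
Definition hkernel e a : R := (e ^+ 2 - a ^+ 2) / (e ^+ 2 + a ^+ 2) ^+ 2.

Lemma sqrD_gt0 e a : 0 < e -> 0 < e ^+ 2 + a ^+ 2.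
Proof. by move=> e0; rewrite ltr_wpDr ?sqr_ge0// exprn_gt0. Qed.

Lemma hkernel_norm e a : 0 < e -> `|hkernel e a| <= (e ^+ 2 + a ^+ 2)^-1.
Proof.
move=> e0; have D := sqrD_gt0 a e0; have e2 := sqr_ge0 e; have a2 := sqr_ge0 a.
rewrite /hkernel normrM [`|_ ^-1|]ger0_norm ?invr_ge0 ?exprn_ge0 ?(ltW D)//.
rewrite ler_pdivrMr ?exprn_gt0// expr2 mulrA mulVf ?gt_eqF// mul1r.
by rewrite ler_norml; apply/andP; split; lra.
Qed.

Lemma hkernel_le e a : 0 < e -> `|hkernel e a| <= e ^- 2.
Proof.
move=> e0; apply: le_trans (hkernel_norm a e0) _.
by rewrite lef_pV2 ?posrE ?sqrD_gt0 ?exprn_gt0// lerDl sqr_ge0.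
Qed.

Lemma hkernel_sqr e a : 0 < e -> a ^+ 2 * `|hkernel e a| <= 1.
Proof.
move=> e0; have D := sqrD_gt0 a e0; have e2 := sqr_ge0 e.
apply: le_trans (ler_wpM2l (sqr_ge0 a) (hkernel_norm a e0)) _.
by rewrite ler_pdivrMr// mul1r lerDr.
Qed.

Lemma der_hkernel e y x : 0 < e ->
  is_derive x 1 (fun x => (x - y) / (e ^+ 2 + (x - y) ^+ 2)) (hkernel e (x - y)).
Proof.
move=> e0; have D := sqrD_gt0 (x - y) e0.
have d1 : is_derive x 1 (fun x => x - y) (1 - 0) by exact: derB (derI x) (derC x y).
have d2 := derD (derC x (e ^+ 2)) (derM d1 d1).
have d3 := @derV _ (fun x => e ^+ 2 + (x - y) * (x - y)) x _ (lt0r_neq0 D) d2.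
by apply: (is_derive_eq (derM d1 d3)); rewrite /hkernel; field; rewrite gt_eqF.
Qed.

Lemma continuous_hkernel e y x : 0 < e -> {for x, continuous (fun x => hkernel e (x - y))}.
Proof.
move=> e0; have D := sqrD_gt0 (x - y) e0.
have d1 : is_derive x 1 (fun x => x - y) (1 - 0) by exact: derB (derI x) (derC x y).
have d2 := derD (derC x (e ^+ 2)) (derM d1 d1).
have d4 := derM d2 d2.
have d3 := @derV _ (fun x => (e ^+ 2 + (x - y) * (x - y)) * (e ^+ 2 + (x - y) * (x - y))) x _
  (mulf_neq0 (lt0r_neq0 D) (lt0r_neq0 D)) d4.
exact: der_continuous (derM (derB (derC x (e ^+ 2)) (derM d1 d1)) d3).
Qed.

Lemma measurable_hkernel e : 0 < e -> measurable_fun setT (fun z : R * R => hkernel e (z.1 - z.2)).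
Proof.
move=> e0.
have m : measurable_fun setT (fun x => hkernel e x).
  apply: continuous_measurable_fun => x.
  by have := @continuous_hkernel e 0 x e0; rewrite (_ : (fun x => _) = hkernel e)//;
     apply/funext => u; rewrite subr0.
apply: (measurableT_comp m); apply: measurable_funB.
  exact: (@measurable_fst_comp _ id).
exact: (@measurable_snd_comp _ id).
Qed.

(** The kernel has integral zero on the line, so its integral over a window around the
    support is bounded independently of the regularization. *)
Lemma hkernel_window K e y : 0 < K -> 0 < e -> `|y| <= K ->
  \int[mu]_x (\1_(`[- (2 * K), 2 * K]%classic) x * hkernel e (x - y)) <= 2 / K.
Proof.
move=> K0 e0 yK; have [y1 y2] := ler_normlP _ _ yK.
have KK : - (2 * K) < 2 * K by lra.
have [_ ->] := intR_FTC KK (fun x _ => der_hkernel y x e0) (fun x _ => @continuous_hkernel e y x e0).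
have lem u : K <= u -> u / (e ^+ 2 + u ^+ 2) <= K^-1.
  move=> Ku; have u0 : 0 < u by exact: lt_le_trans Ku.
  rewrite ler_pdivrMr ?sqrD_gt0// mulrC ler_pdivlMr//.
  by have := sqr_ge0 e; move: K0 u0 Ku; clear; nra.
have h1 := lem (2 * K - y) ltac:(lra); have h2 := lem (2 * K + y) ltac:(lra).
have -> : - (2 * K) - y = - (2 * K + y) by ring.
by rewrite sqrrN mulNr; move: h1 h2; clear; lra.
Qed.

(** Since 2 g(x) g(y) = g(x)^2 + g(y)^2 - (g(x) - g(y))^2, the regularized energy
    of g is a window integral of the kernel plus a Gagliardo energy, in which the
    Lipschitz bound cancels the singularity -1 / a^2. *)
Lemma regularized_half_norm_le K B L g e : 0 < K -> bcs K B g -> 0 <= L ->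
  (forall x x', `|g x - g x'| <= L * `|x - x'|) -> 0 < e ->
  \int[mu]_t (htexp e t * (cosT g t ^+ 2 + sinT g t ^+ 2)) <=
  4 * B ^+ 2 + 8 * K ^+ 2 * L ^+ 2.
Proof.
move=> K0 bg L0 gL e0; have [mg gB gK] := bg; have Lg := bcs_L1 bg; have B0 := bcs_B0 bg.
have [_ LT IT] := parseval (htexp_L1 e0) Lg Lg.
pose q (z : R * R) := hkernel e (z.1 - z.2).
have mq : measurable_fun setT q by exact: measurable_hkernel.
have qb z : `|q z| <= e ^- 2 by exact: hkernel_le.
have kE a : cosine_kernel (htexp e) a = hkernel e a by exact: htexp_cos.
have qsym x y : q (x, y) = q (y, x) by rewrite /q /hkernel /=; congr (_ / _ ^+ 2); ring.
(* Without the window the square of g x - g y would not be integrable. *)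
pose S := \1_(`[- (2 * K), 2 * K]%classic) : R -> R.
have SE x : S x = (`|x| <= 2 * K)%R%:R by rewrite /S indic_itvE ler_norml.
have LS : L1 S by exact: L1_itv.
have gS x : S x * g x = g x.
  rewrite SE; have [_|h] := leP `|x| (2 * K); first by rewrite mul1r.
  by rewrite gK ?mulr0//; move: K0 h; clear; lra.
have Sg x : S x = 1 \/ (S x = 0 /\ g x = 0).
  rewrite SE; have [_|h] := leP `|x| (2 * K); [by left|right; split=> //].
  by rewrite gK//; move: K0 h; clear; lra.
pose g2 x := g x ^+ 2.
have bg2 : bcs K (B * B) g2.
  split=> [|x|x Kx]; first exact: measurable_funX.
    by rewrite /g2 normrX expr2 ler_pM.
  by rewrite /g2 gK// expr0n.
have Lg2 := bcs_L1 bg2.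
have gS2 x : S x * g2 x = g2 x by rewrite /g2 expr2 mulrA gS.
have Lq f y : L1 f -> L1 (fun x => q (y, x) * f x).
  by move=> Lf; apply: (@L1M _ (e ^- 2)) => //; exact: (measurable_slice1 y mq).
pose I f y := \int[mu]_x (q (y, x) * f x).
have LI f h : L1 f -> L1 h -> L1 (fun y => h y * I f y) by move=> Lf Lh; exact: L1_iterated Lh Lf mq qb.
have swap f h : L1 f -> L1 h -> \int[mu]_y (h y * I f y) = \int[mu]_x (f x * I h x).
  move=> Lf Lh; rewrite (Rfubini_bounded Lh Lf mq qb); apply: eq_intR => x.
  by congr (_ * _); apply: eq_intR => y; rewrite qsym.
pose D y := \int[mu]_x (q (y, x) * (S x * (g x - g y) ^+ 2)).
have DE y : D y = I g2 y - 2 * (g y * I g y) + g2 y * I S y.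
  rewrite /D /I -!intRZ; [|exact: Lq|exact/L1Z/Lq|exact: Lq].
  rewrite -intRB; [|exact: Lq|exact/L1Z/L1Z/Lq].
  rewrite -intRD; [|by apply: L1B; [exact: Lq|exact/L1Z/L1Z/Lq]|exact/L1Z/Lq].
  by apply: eq_intR => x; rewrite /g2; case: (Sg x) => [->|[-> ->]]; ring.
have T2 : 2 * \int[mu]_y (g y * I g y) = 2 * \int[mu]_y (g2 y * I S y) - \int[mu]_y (S y * D y).
  have LSD : L1 (fun y => S y * D y).
    have := L1D (L1B (LI _ _ Lg2 LS) (L1Z 2 (LI _ _ Lg Lg))) (LI _ _ LS Lg2).
    by apply: eq_L1 => y; rewrite DE /g2; case: (Sg y) => [->|[-> ->]]; ring.
  have <- : \int[mu]_y (S y * D y) + 2 * \int[mu]_y (g y * I g y) = 2 * \int[mu]_y (g2 y * I S y).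
    rewrite -intRZ; last exact: LI.
    rewrite -intRD//; last exact/L1Z/LI.
    rewrite mulrDl !mul1r -{1}(swap _ _ Lg2 LS) -intRD; [|exact: LI|exact: LI].
    by apply: eq_intR => y; rewrite DE /g2; case: (Sg y) => [->|[-> ->]]; ring.
  ring.
have -> : \int[mu]_t (htexp e t * (cosT g t ^+ 2 + sinT g t ^+ 2)) = \int[mu]_y (g y * I g y).
  rewrite -[LHS]/(\int[mu]_t (htexp e t * (cosT g t * cosT g t + sinT g t * sinT g t))) IT.
  by apply: eq_intR => y; congr (_ * _); apply: eq_intR => x; rewrite kE -/(q (x, y)) qsym mulrC.
have IS y : `|y| <= K -> I S y <= 2 / K.
  move=> yK; have -> : I S y = \int[mu]_x (S x * hkernel e (x - y)).
    by apply: eq_intR => x; rewrite qsym mulrC.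
  exact: hkernel_window.
have b1 : \int[mu]_y (g2 y * I S y) <= 2 / K * (B * B * (2 * K)).
  apply: (@le_trans _ _ (\int[mu]_y (2 / K * `|g2 y|))).
    apply: le_intR; [exact: LI|by apply: L1Z; exact: L1_norm|].
    move=> y; have [Ky|yK] := ltP K `|y|; first by have [_ _ ->] := bg2; rewrite // normr0 mul0r mulr0.
    by rewrite ger0_norm ?sqr_ge0// mulrC ler_wpM2r ?sqr_ge0// IS.
  rewrite intRZ; last exact: L1_norm.
  by apply: ler_wpM2l; [rewrite divr_ge0// ltW|exact: bcs_norm_int (ltW K0) bg2].
have intS : \int[mu]_x S x = 4 * K.
  by rewrite /S intR_itv; [ring|move: K0; clear; lra].
have b2 : - (\int[mu]_y (S y * D y)) <= L ^+ 2 * (4 * K) * (4 * K).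
  have LSD : L1 (fun y => S y * D y).
    have := L1D (L1B (LI _ _ Lg2 LS) (L1Z 2 (LI _ _ Lg Lg))) (LI _ _ LS Lg2).
    by apply: eq_L1 => y; rewrite DE /g2; case: (Sg y) => [->|[-> ->]]; ring.
  suff : `|\int[mu]_y (S y * D y)| <= L ^+ 2 * (4 * K) * (4 * K).
    by rewrite ler_norml => /andP[h _]; rewrite lerNl.
  rewrite -{2}intS -intRZ//; apply: (le_norm_intR2 LSD); first exact: L1Z.
  move=> y; rewrite normrM mulrC.
  have S0 x : 0 <= S x by rewrite SE.
  rewrite [`|S y|]ger0_norm//; apply: ler_wpM2r => //.
  rewrite -intS -intRZ//; apply: le_norm_intR2; [|exact: L1Z|].
    have := L1D (L1B (Lq _ y Lg2) (L1Z (2 * g y) (Lq _ y Lg))) (L1Z (g2 y) (Lq _ y LS)).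
    by apply: eq_L1 => x; rewrite /g2; case: (Sg x) => [->|[-> ->]]; ring.
  move=> x; rewrite normrM [`|S x * _|]normrM [`|S x|]ger0_norm// mulrCA mulrC.
  apply: ler_wpM2r => //.
  have h1 : `|(g x - g y) ^+ 2| <= L ^+ 2 * (y - x) ^+ 2.
    rewrite normrX -exprMn -[leRHS]real_normK ?num_real// normrM (ger0_norm L0) distrC.
    by rewrite lerXn2r ?nnegrE// ?mulr_ge0// gL.
  have h2 := hkernel_sqr (y - x) e0.
  have h3 := ler_wpM2l (normr_ge0 (q (y, x))) h1.
  have h4 := ler_wpM2l (sqr_ge0 L) h2.
  move: h3 h4; rewrite /q /= mulr1; clear; lra.
have KV : 2 / K * (B * B * (2 * K)) = 4 * B ^+ 2 by field; rewrite gt_eqF.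
rewrite KV in b1; move: T2 b1 b2.
move: (\int[mu]_y (g y * I g y)) (\int[mu]_y (g2 y * I S y)) (\int[mu]_y (S y * D y)).
by move=> p1 p2 p3; clear; lra.
Qed.

End HalfNorm.

Section HalfNorm2.
Context {R : realType}.
Implicit Types (f g h F nu : R -> R) (a b c x y r t u v d C e K B L : R).
Notation mu := (@lebesgue_measure R).

(** The frequency integral over the positive half-line only; evenness gives the other half. *)
Definition half_energy g := \int[mu]_t (halfline t * t * (cosT g t ^+ 2 + sinT g t ^+ 2)).

Lemma lip_of_der (f f' : R -> R) a b : (forall x, is_derive x 1 f (f' x)) ->
  (forall x, `|f' x| <= 1) -> `|f a - f b| <= `|a - b|.
Proof.
move=> df f1; wlog ab : a b / a <= b.
  by move=> W; have [/W//|/ltW/W] := leP a b; rewrite distrC [X in _ <= X]distrC.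
have cf : {within `[a, b], continuous f}.
  by apply: continuous_subspaceT => x; exact: der_continuous (df x).
have [c _ e] := MVT_segment ab (fun x _ => df x) cf.
by rewrite distrC e normrM [`|a - b|]distrC ler_piMl.
Qed.

Lemma cos_lip a b : `|cos a - cos b| <= `|a - b|.
Proof.
have h x : `|- sin x| <= 1 :> R by rewrite normrN; exact: sin_max.
exact: (@lip_of_der _ _ a b (fun x => is_derive_cos x) h).
Qed.

Lemma sin_lip a b : `|sin a - sin b| <= `|a - b|.
Proof. exact: (@lip_of_der _ _ a b (fun x => is_derive_sin x) (@cos_max R)). Qed.

Lemma continuous_lip (f : R -> R) C : (forall a b, `|f a - f b| <= C * `|a - b|) -> continuous f.
Proof.
move=> fC x; apply/cvgrPdist_le => /= e e0.
have C1 : 0 < `|C| + 1 by have := normr_ge0 C; lra.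
have d0 : 0 < e / (`|C| + 1) by rewrite divr_gt0.
near=> y; apply: le_trans (fC x y) _.
have : `|x - y| <= e / (`|C| + 1) by near: y; exact: cvgr_dist_le.
rewrite ler_pdivlMr// => h; have := normr_ge0 (x - y) => h0.
have := ler_wpM2r h0 (ler_norm C); lra.
Unshelve. all: by end_near. Qed.

Lemma transform_continuous (w : R -> R) K B g : 0 < K -> bcs K B g ->
  continuous w -> (forall x, `|w x| <= 1) -> (forall a b, `|w a - w b| <= `|a - b|) ->
  continuous (fun t => \int[mu]_x (w (t * x) * g x)).
Proof.
move=> K0 bg cw w1 wl; have [mg gB gK] := bg; have Lg := bcs_L1 bg.
have Lw t : L1 (fun x => w (t * x) * g x).
  apply: (@L1M _ 1) => //; apply: continuous_measurable_fun => x.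
  apply: (@continuous_comp _ _ _ (fun x => t * x) w); last exact: cw.
  by apply: (@continuousM _ _ (fun _ => t)); [exact: cvg_cst|exact: cvg_id].
apply: (@continuous_lip _ (K * \int[mu]_x `|g x|)) => a b.
rewrite -intRB// mulrAC -intRZ; last exact: L1_norm.
apply: le_norm_intR2; [exact: L1B|by apply: L1Z; exact: L1_norm|].
move=> x; rewrite -mulrBl normrM.
have [Kx|xK] := ltP K `|x|; first by rewrite gK// normr0 !mulr0.
apply: ler_wpM2r => //; apply: le_trans (wl _ _) _.
by rewrite -mulrBl normrM mulrC ler_wpM2r.
Qed.

Lemma continuous_cosT K B g : 0 < K -> bcs K B g -> continuous (cosT g).
Proof.
move=> K0 bg; apply: (transform_continuous K0 bg); [exact: continuous_cos|exact: cos_max|exact: cos_lip].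
Qed.

Lemma continuous_sinT K B g : 0 < K -> bcs K B g -> continuous (sinT g).
Proof.
move=> K0 bg; apply: (transform_continuous K0 bg); [exact: continuous_sin|exact: sin_max|exact: sin_lip].
Qed.

Lemma cosTN g t : cosT g (- t) = cosT g t.
Proof. by apply: eq_intR => x; rewrite mulNr cosN. Qed.

Lemma sinTN g t : L1 g -> sinT g (- t) = - sinT g t.
Proof.
move=> Lg; rewrite /sinT -intRN; last exact: L1_sinM.
by apply: eq_intR => x; rewrite mulNr sinN mulNr.
Qed.

(** Fatou along the regularizations, whose energies are bounded uniformly. *)
Lemma half_energy_L1 K B L g : 0 < K -> bcs K B g -> 0 <= L ->
  (forall x x', `|g x - g x'| <= L * `|x - x'|) ->
  L1 (fun t => halfline t * t * (cosT g t ^+ 2 + sinT g t ^+ 2)).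
Proof.
move=> K0 bg L0 gL.
pose G t := cosT g t ^+ 2 + sinT g t ^+ 2.
have G0 t : 0 <= G t by rewrite addr_ge0// sqr_ge0.
have mG : measurable_fun setT G.
  apply: measurable_funD; apply: measurable_funX; apply: continuous_measurable_fun.
    exact: continuous_cosT bg.
  exact: continuous_sinT bg.
have mH := @measurable_halfline R.
have H0 t : 0 <= halfline t * t by rewrite /halfline; have [?|_] := leP 0 t; rewrite ?mul1r ?mul0r.
have e0 n : 0 < n.+1%:R^-1 :> R by rewrite invr_gt0.
apply: L1_ge0 => [|t|].
- by apply: measurable_funM => //; exact: measurable_funM.
- by apply: mulr_ge0; [exact: H0|exact: G0].
pose f n t : \bar R := (htexp n.+1%:R^-1 t * G t)%:E.
have mf n : measurable_fun setT (f n).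
  apply/measurable_EFinP; apply: measurable_funM => //.
  exact: L1_measurable (htexp_L1 (e0 n)).
have f0 n t : setT t -> (0 <= f n t)%E.
  by move=> _; rewrite lee_fin mulr_ge0// /htexp mulrA mulr_ge0// expR_ge0.
have ndf t : setT t -> nondecreasing_seq (f ^~ t).
  move=> _ n m nm; rewrite lee_fin; apply: ler_wpM2r => //; rewrite /htexp /halfline.
  have [t0|t0] := leP 0 t; last by rewrite !mul0r.
  rewrite !mul1r; apply: ler_wpM2l => //; rewrite ler_expR lerN2; apply: ler_wpM2r => //.
  by rewrite lef_pV2 ?posrE// ler_nat.
have flim t : limn (f ^~ t) = (halfline t * t * G t)%:E.
  apply/cvg_lim => //; apply: cvg_EFin; first exact: nearW.
  have h1 : n.+1%:R^-1 * t @[n --> \oo] --> 0 * t.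
    by apply: cvgM; [exact: cvg_harmonic|exact: cvg_cst].
  have h2 : expR (- (n.+1%:R^-1 * t)) @[n --> \oo] --> expR (- (0 * t)).
    by apply: continuous_cvg; [exact: continuous_expR|exact: cvgN].
  have h3 : htexp n.+1%:R^-1 t * G t @[n --> \oo] --> halfline t * (t * expR (- (0 * t))) * G t.
    apply: cvgM; last exact: cvg_cst.
    by apply: cvgM; [exact: cvg_cst|apply: cvgM; [exact: cvg_cst|exact: h2]].
  by move: h3; rewrite mul0r oppr0 expR0 mulr1.
have MC : (\int[mu]_t (halfline t * t * G t)%:E = limn (fun n => \int[mu]_t f n t))%E.
  apply: etrans (monotone_convergence (@lebesgue_measure R) measurableT mf f0 ndf).
  by apply: eq_integral => t _; rewrite flim.
rewrite MC; apply: (@le_lt_trans _ _ (4 * B ^+ 2 + 8 * K ^+ 2 * L ^+ 2)%:E); last exact: ltry.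
apply: lime_le.
  apply: ereal_nondecreasing_is_cvgn => n m nm; apply: ge0_le_integral => //.
  - by move=> t Dt; exact: f0.
  - exact: mf.
  - exact: mf.
  - by move=> t Dt; exact: ndf.
apply: nearW => n.
have Lf : L1 (fun t => htexp n.+1%:R^-1 t * G t).
  have Lg := bcs_L1 bg; have [LP _ _] := parseval (htexp_L1 (e0 n)) Lg Lg.
  exact: eq_L1 LP.
by rewrite /f -intRE// lee_fin; exact: (regularized_half_norm_le K0 bg L0 gL).
Qed.

Lemma norm_half_sqr K B L g : 0 < K -> bcs K B g -> 0 <= L ->
  (forall x x', `|g x - g x'| <= L * `|x - x'|) ->
  norm_half g ^+ 2 = 2 * half_energy g.
Proof.
move=> K0 bg L0 gL; have Lg := bcs_L1 bg.
have LA := half_energy_L1 K0 bg L0 gL.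
pose f t := `|t| * (cosT g t ^+ 2 + sinT g t ^+ 2).
have f0 t : 0 <= f t by rewrite mulr_ge0// addr_ge0// sqr_ge0.
have fE t : `|t| * ComplexField.Normc.normc (fourier g t) ^+ 2 = f t.
  rewrite /f /fourier /cintegral /= sqr_sqrtr; last by rewrite addr_ge0// sqr_ge0.
  have -> : \int[mu]_x (g x * cos (- (t * x)) - 0 * sin (- (t * x))) = cosT g t.
    by apply: eq_intR => x; rewrite cosN mul0r subr0 mulrC.
  have -> : \int[mu]_x (g x * sin (- (t * x)) + 0 * cos (- (t * x))) = - sinT g t.
    rewrite -intRN; last exact: L1_sinM.
    by apply: eq_intR => x; rewrite sinN mul0r addr0 mulrN mulrC.
  by rewrite sqrrN.
have cf : continuous f.
  move=> t; apply: cvgM; first exact: norm_continuous.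
  have cC : cosT g x @[x --> t] --> cosT g t by exact: (continuous_cosT K0 bg).
  have cS : sinT g x @[x --> t] --> sinT g t by exact: (continuous_sinT K0 bg).
  exact: cvgD (cvgM cC cC) (cvgM cS cS).
have ef : f =1 f \o -%R.
  by move=> t; rewrite /f /= normrN cosTN sinTN// sqrrN.
rewrite /norm_half sqr_sqrtr; last by apply: intR_ge0 => t; rewrite fE.
rewrite (eq_intR fE) /Rintegral ge0_symfun_integralT//.
have -> : (\int[mu]_(x in [set x | (0 <= x)%R]) (f x)%:E)%E = (half_energy g)%:E.
  rewrite /half_energy intRE// -set_itvcy integral_mkcond; apply: eq_integral => t _.
  rewrite patchE mem_setE in_itv/= andbT /halfline /f; have [t0|t0] := leP 0 t.
    by rewrite mul1r ger0_norm.
  by rewrite !mul0r.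
by [].
Qed.

(** If the half-norm vanished, duality would give a zero integral against every density of
    mass zero; compare a bump near a point where g is nonzero with a bump outside the
    support. *)
Lemma norm_half_gt0 K B L g : 0 < K -> bcs K B g -> 0 <= L ->
  (forall x x', `|g x - g x'| <= L * `|x - x'|) -> (exists x, g x != 0) ->
  0 < norm_half g.
Proof.
move=> K0 bg L0 gL [x0 gx0]; have [mg gB gK] := bg; have Lg := bcs_L1 bg.
have n0 : 0 <= norm_half g by exact: sqrtr_ge0.
rewrite lt_def n0 andbT; apply/negP => /eqP gn0.
have A0 : half_energy g = 0.
  by have := norm_half_sqr K0 bg L0 gL; rewrite gn0 expr0n /=; lra.
have a0 : 0 < `|g x0| by rewrite normr_gt0.
pose r := `|g x0| / (2 * (L + 1)).
have r0 : 0 < r by rewrite divr_gt0// mulr_gt0//; lra.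
have Lr : L * r <= `|g x0| / 2.
  rewrite /r; have -> : L * (`|g x0| / (2 * (L + 1))) = (`|g x0| / 2) * (L / (L + 1)).
    by field; rewrite gt_eqF//; lra.
  rewrite ler_piMr ?divr_ge0//.
  by rewrite ler_pdivrMr; lra.
have x0K : `|x0| <= K by rewrite leNgt; apply/negP => /gK /eqP; exact/negP.
pose s := Num.sg (g x0).
(* The second bump lies off the support of g and only balances the mass. *)
pose nu x := s * (\1_(`[x0, x0 + r]%classic) x - \1_(`[K + 1, K + 1 + r]%classic) x).
pose K' := K + 1 + r.
have bi a b : `|a| <= K' -> `|b| <= K' -> bcs K' 1 \1_(`[a, b]%classic).
  move=> aK bK; split=> [|x|x Kx]; first exact: measurable_indic.
    by rewrite indic_itvE; case: (_ && _); rewrite ?normr1 ?normr0.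
  rewrite indic_itvE; have [/andP[ax xb]|//] := boolP (a <= x <= b).
  move: aK bK Kx; rewrite !ler_norml ltr_normr => /andP[h1 h2] /andP[h3 h4] /orP[]; lra.
have [x01 x02] := ler_normlP _ _ x0K.
have bnu : bcs K' (`|s| * (1 + 1)) nu.
  apply: bcsZ; apply: bcsB; apply: bi; rewrite ler_norml /K'; apply/andP; split; lra.
have i1 : \int[mu]_x \1_(`[x0, x0 + r]%classic) x = r by rewrite intR_itv; lra.
have i2 : \int[mu]_x \1_(`[K + 1, K + 1 + r]%classic) x = r by rewrite intR_itv; lra.
have nu0 : \int[mu]_x nu x = 0.
  rewrite intRZ; last by apply: L1B; exact: L1_itv.
  by rewrite intRB ?i1 ?i2 ?subrr ?mulr0//; exact: L1_itv.
pose X := \int[mu]_x (g x * nu x).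
have X0 : 0 < X.
  apply: (@lt_le_trans _ _ (`|g x0| / 2 * r)); first by rewrite mulr_gt0// divr_gt0.
  rewrite -[X in _ * X]i1 -intRZ; last exact: L1_itv.
  apply: le_intR; [by apply: L1Z; exact: L1_itv|exact: L1M mg gB (bcs_L1 bnu)|].
  move=> x; rewrite /nu.
  have -> : g x * (s * (\1_(`[x0, x0 + r]%classic) x - \1_(`[K + 1, K + 1 + r]%classic) x)) =
    (s * g x) * \1_(`[x0, x0 + r]%classic) x.
    rewrite [\1_(`[K + 1, _]%classic) x]indic_itvE.
    have [/andP[h1 h2]|_] := boolP (K + 1 <= x <= K + 1 + r); last by rewrite subr0; ring.
    by rewrite gK; [ring|rewrite ger0_norm; lra].
  rewrite indic_itvE; have [/andP[h1 h2]|_] := boolP (x0 <= x <= x0 + r); last by rewrite !mulr0.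
  rewrite !mulr1.
  have sg0 : s * g x0 = `|g x0| by rewrite -normrEsg.
  have d : `|g x - g x0| <= `|g x0| / 2.
    apply: le_trans (gL _ _) _; apply: le_trans Lr; apply: ler_wpM2l => //.
    by rewrite ger0_norm; lra.
  have s1 : `|s| <= 1 by rewrite /s normr_sg; case: (_ != _).
  have : `|s * (g x - g x0)| <= `|g x0| / 2.
    by rewrite normrM; apply: le_trans d; rewrite ler_piMl.
  rewrite mulrBr sg0 ler_norml => /andP[h _]; move: h; clear; lra.
pose E := logE nu nu.
have K'0 : 0 < K' by rewrite /K'; lra.
have bg' : bcs K' B g by apply: bcsW bg => //; rewrite /K'; lra.
pose c := (`|E| + 1) / X.
have c0 : 0 < c by rewrite divr_gt0// ltr_wpDl.
have := fourier_duality K'0 bg' L0 gL bnu nu0 (half_energy_L1 K0 bg L0 gL) c0.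
rewrite -/(half_energy g) A0 mulr0 sub0r -/E -/X.
have E1 : - (E / c) < X.
  rewrite -mulNr ltr_pdivrMr// /c mulrC divfK ?gt_eqF//.
  by have := ler_norm (- E); rewrite normrN; lra.
have := @pi_ge2 R => pi2; have : 2 * pi * X >= X.
  by rewrite ler_pMl//; lra.
move: E1; clear; lra.
Qed.

End HalfNorm2.

(** * Growth of the Gamma function and of the interaction *)

Section GammaFunction.
Context {R : realType}.
Implicit Types (a b c x y z r t theta : R).
Notation mu := (@lebesgue_measure R).

Definition gamma_density z t : R := \1_(`]0, +oo[%classic) t * (t `^ (z - 1) * expR (- t)).

Lemma GammaE z : Gamma z = \int[mu]_t gamma_density z t.
Proof. exact: intR_indic. Qed.

Lemma gamma_densityE z t : 0 < t -> gamma_density z t = t `^ (z - 1) * expR (- t).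
Proof. by move=> t0; rewrite /gamma_density indicE mem_setE in_itv/= t0 mul1r. Qed.

Lemma gamma_density0 z t : t <= 0 -> gamma_density z t = 0.
Proof.
by move=> t0; rewrite /gamma_density indicE mem_setE in_itv/= ltNge t0 mul0r.
Qed.

Lemma gamma_density_ge0 z t : 0 <= gamma_density z t.
Proof.
have [t0|t0] := ltP 0 t; last by rewrite gamma_density0.
by rewrite gamma_densityE// mulr_ge0 ?powR_ge0 ?expR_ge0.
Qed.

Lemma measurable_gamma_density z : measurable_fun setT (gamma_density z).
Proof.
apply: measurable_funM; first exact: measurable_indic.
apply: measurable_funM; first exact: measurable_powR.
apply: (measurableT_comp (continuous_measurable_fun (@continuous_expR R))).
exact: oppr_measurable.
Qed.

Lemma powR_le_expR z : exists2 C : R, 0 < C & forall t, 1 <= t -> t `^ (z - 1) <= C * expR (t / 2).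
Proof.
pose n := Num.truncn `|z - 1|.
have zn : z - 1 <= n.+1%:R by rewrite (le_trans (ler_norm _))// ltW// truncnS_gt.
exists (2 ^+ n.+1 * n.+1`!%:R); first by rewrite mulr_gt0 ?exprn_gt0// ltr0n fact_gt0.
move=> t t1; have t0 : 0 <= t by lra.
apply: (@le_trans _ _ (t `^ n.+1%:R)); first by rewrite ler_powR.
rewrite powR_mulrn//.
have h := @expR_ge1Dxn R (t / 2) n ltac:(lra).
have f0 : 0 < n.+1`!%:R :> R by rewrite ltr0n fact_gt0.
have : (t / 2) ^+ n.+1 <= n.+1`!%:R * expR (t / 2).
  by rewrite -ler_pdivrMl// mulrC; move: h; clear; lra.
rewrite exprMn exprVn ler_pdivrMr ?exprn_gt0// => /le_trans; apply.
by rewrite mulrC mulrA.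
Qed.

Lemma powR_der z t : 0 < t -> z != 0 -> is_derive t 1 (fun t => z^-1 * t `^ z) (t `^ (z - 1)).
Proof.
move=> t0 z0; have := derZ z^-1 (is_derive1_powR z t0).
by move=> h; apply: (is_derive_eq h); rewrite mulrA mulVf// mul1r.
Qed.

Lemma gamma_density_L1 z : 0 < z -> L1 (gamma_density z).
Proof.
move=> z0; have [C C0 hC] := powR_le_expR z.
have half0 : 0 < 2^-1 :> R by rewrite invr_gt0.
pose p t : R := \1_(`]0, 1[%classic) t * t `^ (z - 1).
have Lp : L1 p.
  apply/(@L1_indic _ _ (fun t => t `^ (z - 1))); first exact: measurable_itv.
  apply/integrableP; split.
    by apply/measurable_EFinP; apply: measurable_funTS; exact: measurable_powR.
  have -> : (\int[mu]_(t in `]0%R, 1%R[) `|(EFin \o (fun t => (t `^ (z - 1))%R)) t| =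
             \int[mu]_(t in `]0%R, 1%R[) ((t `^ (z - 1))%R)%:E)%E.
    by apply: eq_integral => t _; rewrite /= (@ger0_norm _ (t `^ (z - 1)))// powR_ge0.
  apply: (@le_lt_trans _ _ (z^-1)%:E); last exact: ltry.
  apply: (@ge0_FTC_le _ (fun t => z^-1 * t `^ z)) => //.
  - by move=> t _; exact: powR_ge0.
  - by move=> t /andP[t0 _]; exact: (der_continuous (is_derive1_powR (z - 1) t0)).
  - by move=> t /andP[t0 _]; apply: powR_der => //; rewrite gt_eqF.
  - move=> u v u0 uv v1; rewrite -mulrBr; apply: ler_piMr; first by rewrite invr_ge0 ltW.
    have : v `^ z <= 1 `^ z by rewrite ge0_ler_powR ?nnegrE ?ltW// (lt_trans u0).
    by rewrite powR1; have := powR_ge0 u z; clear; lra.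
apply: le_L1 (L1D Lp (L1Z C (hexp_L1 half0))) => [|t]; first exact: measurable_gamma_density.
rewrite ger0_norm ?gamma_density_ge0//.
have h0 := @hexp_ge0 R 2^-1 t.
have Ch : 0 <= C * hexp 2^-1 t by rewrite mulr_ge0// ltW.
have [t0|t0] := ltP 0 t; last first.
  by rewrite gamma_density0// addr_ge0// mulr_ge0 ?powR_ge0.
rewrite gamma_densityE//.
have e1 : expR (- t) <= 1 by rewrite expR_le1; lra.
have p0 := powR_ge0 t (z - 1).
rewrite /p indicE mem_setE in_itv/= t0/=; have [t1|t1] := ltP t 1.
  by rewrite mul1r; apply: ler_wpDr => //; rewrite ler_piMr.
rewrite mul0r add0r /hexp /halfline (ltW t0) mul1r.
have -> : - t = t / 2 * -1 + - (2^-1 * t) by field.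
have -> : expR (t / 2 * -1 + - (2^-1 * t)) = expR (- (2^-1 * t)) * expR (- (t / 2)).
  by rewrite -expRD; congr expR; ring.
have E0 := expR_gt0 (- (2^-1 * t)); have E1 := expR_gt0 (t / 2).
rewrite mulrCA mulrC; apply: ler_wpM2r; first exact: ltW.
by rewrite expRN ler_pdivrMr// hC.
Qed.

Lemma Gamma_gt0 z : 0 < z -> 0 < Gamma z.
Proof.
move=> z0; rewrite GammaE.
pose m : R := 2^-1 * expR (- 2).
have m0 : 0 < m by rewrite mulr_gt0 ?expR_gt0 ?invr_gt0.
apply: (@lt_le_trans _ _ (\int[mu]_t (m * \1_(`[1, 2]%classic) t))).
  rewrite intRZ ?intR_itv; [|lra|exact: L1_itv].
  by rewrite mulr_gt0//; lra.
apply: le_intR; [by apply: L1Z; exact: L1_itv|exact: gamma_density_L1|].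
move=> t; rewrite indic_itvE; have [/andP[t1 t2]|_] := boolP (1 <= t <= 2); last first.
  by rewrite mulr0 gamma_density_ge0.
have t0 : 0 < t by lra.
rewrite mulr1 gamma_densityE//; apply: ler_pM.
- by rewrite invr_ge0.
- exact: expR_ge0.
- have [z1|z1] := leP 1 z.
    have : 1 `^ (z - 1) <= t `^ (z - 1) by rewrite ge0_ler_powR ?nnegrE//; lra.
    by rewrite powR1; apply: le_trans; lra.
  have : t `^ (-1) <= t `^ (z - 1) by rewrite ler_powR//; lra.
  by apply: le_trans; rewrite (powR_inv1 (ltW t0)) lef_pV2 ?posrE.
- by rewrite ler_expR; lra.
Qed.

Lemma intR_dominated (fn : nat -> R -> R) (f g : R -> R) :
  (forall n, measurable_fun setT (fn n)) -> L1 f -> L1 g ->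
  (forall n x, `|fn n x| <= g x) -> (forall x, fn n x @[n --> \oo] --> f x) ->
  \int[mu]_x fn n x @[n --> \oo] --> \int[mu]_x f x.
Proof.
move=> mfn Lf Lg fg cf.
have Lfn n : L1 (fn n) by exact: le_L1 (mfn n) (fg n) Lg.
have mE n : measurable_fun setT (fun x => (fn n x)%:E) by exact/measurable_EFinP.
have mf : measurable_fun setT (fun x => (f x)%:E) by apply/measurable_EFinP; exact: L1_measurable.
have [||_ _ h] := @dominated_convergence _ _ R (@lebesgue_measure R) setT measurableT
  (fun n x => (fn n x)%:E) (fun x => (f x)%:E) (EFin \o g) mE mf _ Lg.
- by apply: aeW => x _; apply: cvg_EFin; [exact: nearW|exact: cf].
- by apply: aeW => x n _; rewrite lee_fin.
have h2 : (\int[mu]_x fn n x)%:E @[n --> \oo] --> (\int[mu]_x f x)%:E.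
  have e : (fun n => (\int[mu]_x fn n x)%:E) = (fun n => \int[mu]_x (fn n x)%:E)%E.
    by apply/funext => n; rewrite intRE.
  by rewrite e intRE.
exact: fine_cvg h2.
Qed.

(** Integration by parts on compact intervals exhausting the half-line. *)
Lemma GammaS z : 0 < z -> Gamma (z + 1) = z * Gamma z.
Proof.
move=> z0; have z10 : 0 < z + 1 by lra.
have La := gamma_density_L1 z0; have Lb := gamma_density_L1 z10.
rewrite !GammaE -(intRZ _ La).
apply/eqP; rewrite -subr_eq0 -(intRB Lb (L1Z z La)); apply/eqP.
pose f t := gamma_density (z + 1) t - z * gamma_density z t.
have Lf : L1 f by apply: L1B => //; exact: L1Z.
pose F t := - (t `^ z * expR (- t)).
pose a n : R := n.+2%:R^-1; pose b n : R := n.+2%:R.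
have a0 n : 0 < a n by rewrite invr_gt0.
have b1 n : 1 < b n by rewrite /b ltr1n.
have ab n : a n < b n.
  by apply: (@lt_trans _ _ 1); [rewrite /a invf_lt1; [exact: b1|exact: (lt_trans ltr01 (b1 n))]|exact: b1].
pose fn n t := \1_(`[a n, b n]%classic) t * f t.
have dF t : 0 < t -> is_derive t 1 F (f t).
  move=> t0.
  have de : is_derive t 1 (fun t => expR (- t)) (expR (- t) * -1).
    exact: (@der_comp _ (@expR R) (fun t => - t) t _ _ (is_derive_expR _) (derN (derI t))).
  have h := derN (derM (is_derive1_powR z t0) de).
  apply: (is_derive_eq h); rewrite /f !gamma_densityE// addrK; ring.
have If n : \int[mu]_t fn n t = F (b n) - F (a n).
  have pos x : a n <= x <= b n -> 0 < x by move=> /andP[h _]; exact: lt_le_trans (a0 n) h.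
  have [|x hx|_ ->//] := @intR_FTC _ F f _ _ (ab n); first by move=> x /pos; exact: dF.
  have x0 := pos _ hx.
  pose f' t := t `^ z * expR (- t) - z * (t `^ (z - 1) * expR (- t)).
  have ce : {for x, continuous (fun t : R => expR (- t))}.
    apply: (@continuous_comp _ _ _ (fun t : R => - t) (@expR R)); last exact: continuous_expR.
    by apply: continuousN; exact: cvg_id.
  have cf' : {for x, continuous f'}.
    have c1 := der_continuous (is_derive1_powR z x0).
    have c2 := der_continuous (is_derive1_powR (z - 1) x0).
    apply: cvgB; first exact: cvgM c1 ce.
    by apply: cvgM; [exact: cvg_cst|exact: cvgM c2 ce].
  have ff' : {near x, f =1 f'}.
    near=> t; have t0 : 0 < t by near: t; exact: lt_nbhsr.
    by rewrite /f /f' !gamma_densityE// addrK.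
  have fx : f x = f' x by rewrite /f /f' !gamma_densityE// addrK.
  rewrite /prop_for /continuous_at fx; apply: cvg_trans cf'.
  by apply: near_eq_cvg; near=> t; rewrite (near ff' t).
have lim0 : F (b n) - F (a n) @[n --> \oo] --> (0 : R).
  have [C C0 hC] := powR_le_expR (z + 1).
  have la : a n @[n --> \oo] --> (0:R).
    have := @cvg_harmonic R; rewrite -cvg_shiftS; apply.
  have l1 : (a n) `^ z @[n --> \oo] --> (0:R).
    by apply: ((cvg_at_rightP _ _ _).1 (powR_cvg0 z0)); split.
  have l2 : 2 * C * a n + (a n) `^ z @[n --> \oo] --> (2 * C * 0 + 0 : R).
    by apply: cvgD => //; apply: cvgM => //; exact: cvg_cst.
  rewrite mulr0 addr0 in l2.
  have l3 : - (2 * C * a n + (a n) `^ z) @[n --> \oo] --> (0 : R) by rewrite -oppr0; exact: cvgN.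
  apply: squeeze_cvgr l3 l2; apply: nearW => n; rewrite -ler_norml.
  apply: le_trans (ler_normB _ _) _; apply: lerD.
    rewrite /F normrN ger0_norm ?mulr_ge0 ?powR_ge0 ?expR_ge0//.
    have := hC _ (ltW (b1 n)); rewrite addrK => h.
    apply: (@le_trans _ _ (C * expR (b n / 2) * expR (- b n))).
      by rewrite ler_wpM2r ?expR_ge0.
    rewrite -mulrA -expRD; have -> : b n / 2 + - b n = - (b n / 2) by field.
    rewrite -mulrA mulrCA ler_wpM2l//; first exact: ltW.
    have h1 := expR_ge1Dx (b n / 2).
    have b0 : 0 < b n by exact: lt_trans (b1 n).
    have -> : 2 * a n = (b n / 2)^-1 by rewrite invf_div.
    rewrite expRN lef_pV2 ?posrE ?expR_gt0 ?divr_gt0//.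
    by move: h1; clear; lra.
  rewrite /F normrN ger0_norm ?mulr_ge0 ?powR_ge0 ?expR_ge0// ler_piMr ?powR_ge0//.
  by rewrite expR_le1 oppr_le0 ltW.
have limI : \int[mu]_t fn n t @[n --> \oo] --> \int[mu]_t f t.
  apply: (intR_dominated _ Lf (L1_norm Lf)) => [n|n x|x].
  - by apply: measurable_funM; [exact: measurable_indic|exact: L1_measurable].
  - rewrite /fn normrM ler_piMl//; rewrite indic_itvE; case: (_ && _); rewrite ?normr1 ?normr0//.
  - have [x0|x0] := ltP 0 x; last first.
      rewrite /fn /f !gamma_density0// mulr0 subrr.
      by under eq_fun do rewrite mulr0; exact: cvg_cst.
    apply: cvg_near_cst; near=> n; rewrite /fn indic_itvE.
    suff -> : a n <= x <= b n by rewrite mul1r.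
    have h1 : x <= n%:R by near: n; exact: nbhs_infty_ger.
    have h2 : x^-1 <= n%:R by near: n; exact: nbhs_infty_ger.
    have nb : n%:R <= b n by rewrite ler_nat; do 2 apply: leqW.
    apply/andP; split; last exact: le_trans nb.
    by rewrite /a -[x]invrK lef_pV2 ?posrE ?invr_gt0//; exact: le_trans nb.
have : \int[mu]_t f t = 0.
  apply: cvg_unique limI _ => //.
  by rewrite (_ : (fun n => \int[mu]_t fn n t) = (fun n => F (b n) - F (a n)))//; apply/funext.
by [].
Unshelve. all: by end_near. Qed.

(** Log-convexity, through the tangent inequality t^r <= x^r (r t / x + 1 - r). *)
Lemma Gamma_shift_le x r : 0 < x -> 0 <= r <= 1 -> Gamma (x + r) <= x `^ r * Gamma x.
Proof.
move=> x0 /andP[r0 r1]; have x10 : 0 < x + 1 by lra.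
have xr0 : 0 < x + r by lra.
have Lx := gamma_density_L1 x0; have Lx1 := gamma_density_L1 x10.
have -> : x `^ r * Gamma x = x `^ r * (r / x * Gamma (x + 1) + (1 - r) * Gamma x).
  by rewrite GammaS//; field; rewrite gt_eqF.
rewrite !GammaE -(intRZ (r / x) Lx1) -(intRZ (1 - r) Lx) -intRD; [|exact: L1Z|exact: L1Z].
rewrite -intRZ; last by apply: L1D; exact: L1Z.
apply: le_intR; [exact: gamma_density_L1|by apply: L1Z; apply: L1D; exact: L1Z|].
move=> t; have [t0|t0] := ltP 0 t; last by rewrite !gamma_density0// !mulr0 addr0 mulr0.
rewrite !gamma_densityE//.
have tn0 : t != 0 by rewrite gt_eqF.
have tD a b : t `^ (a + b) = t `^ a * t `^ b by apply: powRD; apply/implyP.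
have -> : x + r - 1 = (x - 1) + r by ring.
rewrite tD.
have -> : t `^ (x + 1 - 1) = t `^ (x - 1) * t.
  have -> : x + 1 - 1 = (x - 1) + 1 by ring.
  by rewrite tD (powRr1 (ltW t0)).
have w0 : 0 < t / x by rewrite divr_gt0.
have young : (t / x) `^ r <= r * (t / x) + (1 - r).
  move: r0; rewrite le_eqVlt => /predU1P[<-|r0]; first by rewrite powRr0; lra.
  move: r1; rewrite le_eqVlt => /predU1P[->|r1]; first by rewrite (powRr1 (ltW w0)); lra.
  have r1' : 0 < 1 - r by lra.
  have := @conjugate_powR _ ((t / x) `^ r) 1 r^-1 (1 - r)^-1 (powR_ge0 _ _) ler01.
  rewrite !invr_gt0 r0 r1' !invrK powR1 mulr1 mul1r -powRrM mulfV ?gt_eqF// (powRr1 (ltW w0)).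
  move=> /(_ isT isT); rewrite [t / x * r]mulrC; apply; ring.
have tE : t `^ r = x `^ r * (t / x) `^ r.
  by rewrite -(powRM _ (ltW x0) (ltW w0)) mulrCA mulfV ?mulr1// gt_eqF.
rewrite tE.
have P0 : 0 <= t `^ (x - 1) * expR (- t) * x `^ r by rewrite !mulr_ge0 ?powR_ge0 ?expR_ge0.
have := ler_wpM2l P0 young; rewrite -subr_ge0 => h; rewrite -subr_ge0; apply: le_trans h _.
by rewrite le_eqVlt; apply/orP; left; apply/eqP; field; rewrite gt_eqF.
Qed.

Lemma Gamma_shift_ge x r : 0 < x -> 0 <= r <= 1 ->
  x * Gamma x <= (x + r) `^ (1 - r) * Gamma (x + r).
Proof.
move=> x0 /andP[r0 r1]; rewrite -GammaS//.
have -> : x + 1 = (x + r) + (1 - r) by ring.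
by apply: Gamma_shift_le; [lra|apply/andP; split; lra].
Qed.

Lemma Gamma_iter x (n : nat) : 0 < x ->
  Gamma (x + n%:R) = (\prod_(0 <= k < n) (x + k%:R)) * Gamma x.
Proof.
move=> x0; elim: n => [|n ih]; first by rewrite big_nil mul1r addr0.
have xn : 0 < x + n%:R by rewrite ltr_wpDr.
by rewrite -natr1 addrA (GammaS xn) ih big_nat_recr//= mulrCA mulrA.
Qed.

Lemma ln_prod_nat (F : nat -> R) m n : (forall k, 0 < F k) ->
  ln (\prod_(m <= k < n) F k) = \sum_(m <= k < n) ln (F k).
Proof.
move=> F0; rewrite unlock; elim: (index_iota m n) => [|k s ih] /=; first exact: ln1.
rewrite lnM ?posrE// ?ih//.
by elim: s {ih} => //= j s ih; rewrite mulr_gt0.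
Qed.

(** The functional equation reduces a shift by r + n to a shift by r in [0, 1], where
    log-convexity bounds the ratio from both sides; each factor ln (x + k) differs from
    ln x by at most k / x. *)
Lemma ln_Gamma_ratio_split (n : nat) r x : 0 <= r <= 1 -> 0 < x ->
  `|ln (Gamma (x + (r + n%:R))) - ln (Gamma x) - (r + n%:R) * ln x| <=
  ((r + n%:R) ^+ 2 + 1) / x.
Proof.
move=> r01 x0; have [r0 r1] := andP r01.
have xr0 : 0 < x + r by rewrite ltr_wpDr.
have G0 := Gamma_gt0 x0; have Gr := Gamma_gt0 xr0.
have xk k : 0 < x + r + k%:R by rewrite ltr_wpDr.
have up1 : ln (Gamma (x + r)) <= r * ln x + ln (Gamma x).
  have xr := powR_gt0 r x0; rewrite -ln_powR -(lnM xr G0).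
  by rewrite (ler_ln Gr (mulr_gt0 xr G0)); exact: Gamma_shift_le.
have lo1 : ln x + ln (Gamma x) <= (1 - r) * ln (x + r) + ln (Gamma (x + r)).
  have xr := powR_gt0 (1 - r) xr0; rewrite -ln_powR -(lnM x0 G0) -(lnM xr Gr).
  by rewrite (ler_ln (mulr_gt0 x0 G0) (mulr_gt0 xr Gr)); exact: Gamma_shift_ge.
pose P := \prod_(0 <= k < n) (x + r + k%:R).
have P0 : 0 < P by rewrite prodr_gt0.
have -> : ln (Gamma (x + (r + n%:R))) = ln P + ln (Gamma (x + r)).
  by rewrite addrA (Gamma_iter n xr0) (lnM P0 Gr).
have PE : ln P = \sum_(0 <= k < n) ln (x + r + k%:R) by exact: ln_prod_nat.
have xi : 0 < x^-1 by rewrite invr_gt0.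
have lnr : ln (x + r) <= ln x + r / x by apply: ln_diff_le.
have n0 : 0 <= n%:R :> R by [].
have upP : ln P <= n%:R * (ln x + (r + n%:R) / x).
  have th0 : 0 <= r + n%:R by rewrite addr_ge0.
  have hc k : (0 <= k < n)%N -> ln (x + r + k%:R) <= ln x + (r + n%:R) / x.
    move=> /andP[_ kn]; apply: (ln_diff_le x0 (xk k) th0).
    by rewrite -addrA lerD2l lerD2l ler_nat ltnW.
  rewrite PE; apply: le_trans (ler_sum_nat hc) _.
  by rewrite sumr_const_nat subn0 mulr_natl.
have loP : n%:R * ln x <= ln P.
  have hc k : (0 <= k < n)%N -> ln x <= ln (x + r + k%:R).
    by move=> _; rewrite ler_ln ?posrE// -addrA lerDl addr_ge0.
  rewrite PE; apply: le_trans (ler_sum_nat hc).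
  by rewrite sumr_const_nat subn0 mulr_natl.
move: (ln P) (ln (Gamma x)) (ln (Gamma (x + r))) upP loP up1 lo1 => p g gr upP loP up1 lo1.
move: (n%:R : R) (ln x) (ln (x + r)) (x^-1) n0 upP loP lnr xi up1 lo1.
move=> m l lr w m0 upP loP lnr w0 up1 lo1.
have h1 : (1 - r) * lr <= (1 - r) * (l + r * w).
  by apply: ler_wpM2l => //; move: r1; clear; lra.
have h2 : 0 <= (1 - (1 - r) * r) * w.
  by apply: mulr_ge0; [have := sqr_ge0 r; move: r1; clear; lra|exact: ltW].
have h3 : 0 <= r * (r + m) * w.
  by apply: mulr_ge0; [apply: mulr_ge0 => //; exact: addr_ge0|exact: ltW].
have h4 : 0 <= (r + m) ^+ 2 * w by apply: mulr_ge0; [exact: sqr_ge0|exact: ltW].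
rewrite ler_norml; apply/andP; split.
  by move: loP lo1 h1 h2 h4; clear; lra.
by move: upP up1 h3 w0; clear; lra.
Qed.

Lemma ln_Gamma_ratio theta x : 0 < theta -> 0 < x ->
  `|ln (Gamma (x + theta)) - ln (Gamma x) - theta * ln x| <= (theta ^+ 2 + 1) / x.
Proof.
move=> th0 x0; set n := Num.truncn theta.
have nth : n%:R <= theta by rewrite truncn_le// ltW.
have thn : theta < n.+1%:R by rewrite truncnS_gt.
have := @ln_Gamma_ratio_split n (theta - n%:R) x; rewrite subrK; apply => //.
by apply/andP; move: thn nth; rewrite -natr1; move: (n%:R : R) => m; split; lra.
Qed.

Definition Qconst theta : R := (theta ^+ 2 + 1) * (2 + theta) + theta * (1 + theta) ^+ 2.

(** Both ratios Gamma (x + 1) / Gamma (x + 1 - theta) and Gamma (x + theta) / Gamma x are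
    x ^ theta up to a factor exp (O (1 / x)); the condition x >= theta keeps the arguments
    away from the pole at 0. *)
Lemma Q_bounds theta x : 0 < theta -> theta <= x ->
  0 < Q theta x /\ `|ln (Q theta x) - 2 * theta * ln x| <= Qconst theta / x.
Proof.
move=> th0 thx; have x0 : 0 < x by exact: lt_le_trans thx.
pose y := x + 1 - theta; have y0 : 0 < y by rewrite /y; lra.
have xE : x + 1 = y + theta by rewrite /y; ring.
have xth0 : 0 < x + theta by lra.
have yth0 : 0 < y + theta by lra.
have g1 := Gamma_gt0 yth0; have g2 := Gamma_gt0 xth0.
have g3 := Gamma_gt0 x0; have g4 := Gamma_gt0 y0.
have hx := ln_Gamma_ratio th0 x0; have hy := ln_Gamma_ratio th0 y0.
rewrite /Q -/y xE.
move: (Gamma (x + theta)) (Gamma x) (Gamma (y + theta)) (Gamma y) g1 g2 g3 g4 hx hy.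
move=> p1 p2 p3 p4 g1 g2 g3 g4 hx hy.
split; first by rewrite divr_gt0// mulr_gt0.
rewrite ln_div ?posrE ?mulr_gt0// !lnM ?posrE//.
have xi : 0 < x^-1 by rewrite invr_gt0.
have yi : y^-1 <= (1 + theta) / x.
  rewrite ler_pdivlMr// mulrC ler_pdivrMr// /y.
  have : 0 <= theta * (x - theta) by rewrite mulr_ge0// ?subr_ge0// ltW.
  by move: thx th0; clear; lra.
have d1 : ln y - ln x <= (1 + theta) / x.
  by rewrite lerBlDl; apply: ln_diff_le => //; rewrite /y; move: th0; clear; lra.
have d2 : ln x - ln y <= (1 + theta) ^+ 2 / x.
  have th1 : 0 <= 1 + theta by move: th0; clear; lra.
  rewrite lerBlDl; apply: le_trans (ln_diff_le y0 x0 th1 _) _.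
    by rewrite /y; move: th0; clear; lra.
  by rewrite lerD2l expr2 -mulrA; apply: ler_wpM2l.
have h2 : (theta ^+ 2 + 1) / y <= (theta ^+ 2 + 1) * ((1 + theta) / x).
  by apply: ler_wpM2l => //; rewrite addr_ge0// sqr_ge0.
have h3 := ler_wpM2l (ltW th0) d1; have h4 := ler_wpM2l (ltW th0) d2.
have h5 : theta * ((1 + theta) / x) <= theta * ((1 + theta) ^+ 2 / x).
  apply: ler_wpM2l; first exact: ltW.
  by rewrite ler_pM2r// expr2 ler_peMl//; move: th0; clear; lra.
rewrite /Qconst; move: hx hy h2 h3 h4 h5.
move: (ln p1) (ln p2) (ln p3) (ln p4) (ln x) (ln y) (x^-1) (y^-1) => q1 q2 q3 q4 lx ly w v.
rewrite !ler_norml => /andP[a1 a2] /andP[b1 b2] h2 h3 h4 h5.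
by apply/andP; split; move: a1 a2 b1 b2 h2 h3 h4 h5; clear; lra.
Qed.

End GammaFunction.

(** * Sums over pairs and over spaced points *)

Section Sums.
Context {R : realType}.
Implicit Types (F G : nat -> nat -> R) (u x : nat -> R).

Definition pair_sum (N : nat) F : R := \sum_(0 <= i < N) \sum_(i.+1 <= j < N) F i j.

Lemma le_pair_sum N F G : (forall i j, (i < j < N)%N -> F i j <= G i j) ->
  pair_sum N F <= pair_sum N G.
Proof.
move=> FG; apply: ler_sum_nat => i _; apply: ler_sum_nat => j /andP[ij jN].
by apply: FG; rewrite ij.
Qed.

Lemma pair_sumD N F G : pair_sum N (fun i j => F i j + G i j) = pair_sum N F + pair_sum N G.
Proof. by rewrite -big_split/=; apply: eq_bigr => i _; rewrite big_split. Qed.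

Lemma pair_sumZ N c F : pair_sum N (fun i j => c * F i j) = c * pair_sum N F.
Proof. by rewrite mulr_sumr; apply: eq_bigr => i _; rewrite mulr_sumr. Qed.

Lemma pair_sumS N F : pair_sum N.+1 F = pair_sum N F + \sum_(0 <= i < N) F i N.
Proof.
rewrite /pair_sum big_nat_recr//= [X in _ + X]big_geq// addr0 -big_split/=.
by apply: eq_big_nat => i /andP[_ iN]; rewrite big_nat_recr.
Qed.

Lemma sum_sym_pairs N F : (forall i j, F i j = F j i) ->
  \sum_(0 <= i < N) \sum_(0 <= j < N) F i j = \sum_(0 <= i < N) F i i + 2 * pair_sum N F.
Proof.
move=> sF; elim: N => [|N ih]; first by rewrite /pair_sum !big_geq// mulr0 addr0.
rewrite pair_sumS big_nat_recr//= [X in _ = X + _]big_nat_recr//=.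
under eq_bigr do rewrite big_nat_recr//=.
rewrite big_split/= ih [\sum_(0 <= j < N.+1) _]big_nat_recr//=.
under [\sum_(0 <= i < N) F N i]eq_bigr do rewrite sF.
ring.
Qed.

Definition harmonic_sum (N : nat) : R := \sum_(0 <= k < N) k.+1%:R^-1.

Lemma harmonic_sum_le N : (0 < N)%N -> harmonic_sum N <= 1 + ln N%:R.
Proof.
case: N => // N _; elim: N => [|N ih]; first by rewrite /harmonic_sum big_nat1 invr1 ln1 addr0.
rewrite /harmonic_sum big_nat_recr//=; have p1 : 0 < N.+1%:R :> R by [].
have p2 : 0 < N.+2%:R :> R by [].
have h : ln (N.+1%:R) - ln (N.+2%:R) <= - (N.+2%:R)^-1 :> R.
  rewrite -ln_div ?posrE//.
  have -> : N.+1%:R / N.+2%:R = 1 + - (N.+2%:R)^-1 :> R.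
    rewrite -[N.+2%:R]natr1; move: (N.+1%:R : R) p1 => a a0.
    by field; apply: lt0r_neq0; move: a0; clear; lra.
  by apply: le_ln1Dx; rewrite ltrN2 invf_lt1 ?ltr1n.
rewrite -/(harmonic_sum N.+1).
move: (harmonic_sum N.+1) (ln (N.+1%:R : R)) (ln (N.+2%:R : R)) (N.+2%:R^-1 : R) ih h.
by move=> a b c d; clear; lra.
Qed.

(** The gaps j - i of integers make the sum harmonic: this is where the error N ln N of
    the whole argument comes from. *)
Lemma pair_sum_inv N : (0 < N)%N ->
  pair_sum N (fun i j => (j - i)%:R^-1) <= N%:R * (1 + ln N%:R).
Proof.
move=> N0.
have h i : (0 <= i < N)%N -> \sum_(i.+1 <= j < N) ((j - i)%:R^-1 : R) <= 1 + ln N%:R.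
  move=> /andP[_ iN]; apply: le_trans _ (harmonic_sum_le N0).
  rewrite -{1}[i.+1]add0n big_addn; under eq_bigr do rewrite -addSnnS addnK.
  rewrite /harmonic_sum (big_cat_nat (leq0n (N - i.+1)) (leq_subr i.+1 N))/= lerDl.
  by apply: sumr_ge0 => k _; rewrite invr_ge0.
by apply: le_trans (ler_sum_nat h) _; rewrite sumr_const_nat subn0 mulr_natl.
Qed.

(** Reindexing the pairs i < j by i + 1; the diagonal and the first row are the boundary
    terms. *)
Lemma pair_sum_shift N F : (0 < N)%N ->
  \sum_(0 <= i < N) \sum_(i.+1 <= j < N) F i j =
  pair_sum N (fun i j => F i.+1 j) + \sum_(1 <= j < N) F 0%N j - \sum_(0 <= i < N.-1) F i.+1 i.+1.
Proof.
case: N => // N _; rewrite [LHS]big_nat_recl// /pair_sum [X in _ = X + _ - _]big_nat_recr//=.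
rewrite [X in _ = _ + X + _ - _]big_geq// addr0.
have -> : \sum_(0 <= i < N) \sum_(i.+1 <= j < N.+1) F i.+1 j =
    \sum_(0 <= i < N) F i.+1 i.+1 + \sum_(0 <= i < N) \sum_(i.+2 <= j < N.+1) F i.+1 j.
  by rewrite -big_split/=; apply: eq_big_nat => i /andP[_ iN]; rewrite big_ltn.
ring.
Qed.

(** Every increment over m steps is a sum of m unit increments, and each of the m
    telescoping sums is at most the total range. *)
Lemma telescope_shift (T : R) u N m : (forall k, u k <= u k.+1) -> (forall k, 0 <= u k <= T) ->
  \sum_(0 <= k < N) (u (k + m)%N - u k) <= m%:R * T.
Proof.
move=> du uT; elim: m => [|m ih].
  by rewrite mul0r; under eq_bigr do rewrite addn0 subrr; rewrite sumr_const_nat mul0rn.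
have -> : \sum_(0 <= k < N) (u (k + m.+1)%N - u k) =
   \sum_(0 <= k < N) (u (k + m)%N - u k) + \sum_(0 <= k < N) (u (k + m).+1 - u (k + m)%N).
  by rewrite -big_split/=; apply: eq_bigr => k _; rewrite addnS; ring.
have -> : \sum_(0 <= k < N) (u (k + m).+1 - u (k + m)%N) = u (N + m)%N - u m.
  by elim: N {ih} => [|N ih]; [rewrite big_geq// subrr|rewrite big_nat_recr//= ih addSn; ring].
have /andP[_ h1] := uT (N + m)%N; have /andP[h2 _] := uT m.
rewrite -natr1; move: ih h1 h2; clear; lra.
Qed.

End Sums.

(** * Potentials with logarithmic singularities of the derivative *)

Section Potential.
Context {R : realType}.
Implicit Types (V : R -> R) (s A x y u : R).

(** Composing with the projection onto [0, s] extends a potential from [0, s] to the line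
    by constants, which keeps it measurable and bounded. *)
Definition clamp s x := Num.max 0 (Num.min x s).

Lemma clamp_bounds s x : 0 <= s -> 0 <= clamp s x <= s.
Proof. by move=> s0; rewrite /clamp le_max lexx/= ge_max s0 ge_min lexx orbT. Qed.

Lemma clamp_id s x : 0 <= x <= s -> clamp s x = x.
Proof. by move=> /andP[x0 xs]; rewrite /clamp min_l// max_r. Qed.

Lemma le_clamp s x y : x <= y -> clamp s x <= clamp s y.
Proof.
move=> xy; rewrite /clamp ge_max le_max lexx /= le_max; apply/orP; right.
by rewrite le_min !ge_min xy lexx !orbT.
Qed.

Lemma continuous_clamp s : continuous (clamp s).
Proof.
have H (f g : R -> R) : continuous f -> continuous g -> continuous (fun x => Num.max (f x) (g x)).
  by move=> cf cg x; exact: continuous_max (cf x) (cg x).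
have H' (f g : R -> R) : continuous f -> continuous g -> continuous (fun x => Num.min (f x) (g x)).
  by move=> cf cg x; exact: continuous_min (cf x) (cg x).
apply: (H (fun=> 0)); first by move=> x; exact: cvg_cst.
by apply: (H' id (fun=> s)) => x; [exact: cvg_id|exact: cvg_cst].
Qed.

(** A primitive of a function that dominates the derivative of the potential, since
    |ln u| is at most 2 / sqrt u + u: its total increase bounds the variation of the
    potential. *)
Definition potential_growth0 A s u := A * ((1 + s) * u + 4 * Num.sqrt u - 4 * Num.sqrt (s - u)).
Definition potential_growth A s x := potential_growth0 A s (clamp s x) - potential_growth0 A s 0.
Definition growth_bound A s := A * ((1 + s) * s + 8 * Num.sqrt s).

(** The derivatives of the growth function plus or minus V are nonnegative inside [0, s]. *)
Lemma potential_variation V A s : 0 < s -> 0 < A ->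
  {within `[0, s], continuous V} -> (forall u, 0 < u < s -> derivable V u 1) ->
  (forall u, 0 < u < s -> `|derive1 V u| <= A * (1 + `|ln `|u| | + `|ln `|u - s| |)) ->
  forall x y, x <= y ->
  `|V (clamp s y) - V (clamp s x)| <= potential_growth A s y - potential_growth A s x.
Proof.
move=> s0 A0 cV dV bV x y xy.
pose W := potential_growth0 A s.
pose w u := A * ((1 + s) + 4 * (2 * Num.sqrt u)^-1 - 4 * ((2 * Num.sqrt (s - u))^-1 * (0 - 1))).
have dW u : 0 < u < s -> is_derive u 1 W (w u).
  move=> /andP[u0 us]; have su : 0 < s - u by rewrite subr_gt0.
  have d1 := is_derive1_sqrt u0.
  have d2 := @der_comp _ (@Num.sqrt R) (fun u => s - u) u _ _ (is_derive1_sqrt su)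
    (derB (derC u s) (derI u)).
  have := derZ A (derB (derD (derZ (1 + s) (derI u)) (derZ 4 d1)) (derZ 4 d2)).
  by move=> h; apply: (is_derive_eq h); rewrite /w mulr1.
have cW : {within `[0, s], continuous W}.
  apply: continuous_subspaceT => u; apply: cvgM; first exact: cvg_cst.
  have cs := @sqrt_continuous R.
  apply: cvgB; first apply: cvgD.
  - by apply: cvgM; [exact: cvg_cst|exact: cvg_id].
  - by apply: cvgM; [exact: cvg_cst|exact: cs].
  - apply: cvgM; first exact: cvg_cst.
    apply: (@continuous_comp _ _ _ (fun u => s - u) (@Num.sqrt R)); last exact: cs.
    exact: (der_continuous (derB (derC u s) (derI u))).
have wV u : 0 < u < s -> `|derive1 V u| <= w u.
  move=> us; apply: le_trans (bV u us) _; move: us => /andP[u0 us].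
  have su : 0 < s - u by rewrite subr_gt0.
  rewrite /w ler_pM2l//; have h1 := abs_ln_le u; have h2 := abs_ln_le (u - s).
  have e1 : isqrt u = (Num.sqrt u)^-1 by rewrite /isqrt gtr0_norm.
  have e2 : isqrt (u - s) = (Num.sqrt (s - u))^-1 by rewrite /isqrt distrC gtr0_norm.
  rewrite e1 (gtr0_norm u0) in h1; rewrite e2 distrC (gtr0_norm su) in h2.
  rewrite (gtr0_norm u0) distrC (gtr0_norm su) !invfM.
  by move: h1 h2; clear; lra.
have mono (e : R) : `|e| <= 1 -> forall a b, 0 <= a -> a <= b -> b <= s ->
    W a + e * V a <= W b + e * V b.
  move=> e1; apply: ger0_derive1_ndecr.
  - move=> u; rewrite in_itv/= => us; have [dWu _] := dW u us.
    by apply: derivableD => //; apply: derivableM; [exact: derivable_cst|exact: dV].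
  - move=> u; rewrite in_itv/= => us.
    have h := derD (dW u us) (derZ e (derivableP (dV u us))).
    rewrite derive1E (@derive_val _ _ _ _ _ _ _ h) -derive1E.
    have h1 := wV u us.
    have : `|e * V^`()%classic u| <= w u.
      by rewrite normrM; apply: le_trans h1; rewrite ler_piMl.
    by rewrite ler_norml => /andP[h2 _]; move: h2; clear; lra.
  - move=> u; apply: continuousD; first exact: cW.
    by apply: continuousM; [exact: cvg_cst|exact: cV].
have /andP[a0 as_] := clamp_bounds x (ltW s0); have /andP[b0 bs] := clamp_bounds y (ltW s0).
have ab := le_clamp s xy.
have n1 : `|1| <= 1 :> R by rewrite normr1.
have n2 : `|-1| <= 1 :> R by rewrite normrN normr1.
have := mono 1 n1 _ _ a0 ab bs; have := mono (-1) n2 _ _ a0 ab bs.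
rewrite /potential_growth -/W ler_norml => h1 h2; apply/andP.
by split; move: h1 h2; clear; lra.
Qed.

Lemma potential_growth_bounds A s : 0 < s -> 0 < A -> forall x, 0 <= potential_growth A s x <= growth_bound A s.
Proof.
move=> s0 A0 x; have /andP[a0 as_] := clamp_bounds x (ltW s0).
rewrite /potential_growth /potential_growth0 /growth_bound -mulrBr sqrtr0 mulr0 subr0.
set a := clamp s x in a0 as_ *.
have r0 := sqrtr_ge0 a; have r1 := sqrtr_ge0 (s - a).
have r2 : Num.sqrt a <= Num.sqrt s by rewrite ler_wsqrtr.
have r3 : Num.sqrt (s - a) <= Num.sqrt s by rewrite ler_wsqrtr// gerBl.
apply/andP; split.
  apply: mulr_ge0; first exact: ltW.
  have : 0 <= (1 + s) * a by rewrite mulr_ge0// addr_ge0// ltW.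
  by move: r0 r3; clear; lra.
rewrite ler_pM2l//.
have : (1 + s) * a <= (1 + s) * s by rewrite ler_pM2l//; move: s0; clear; lra.
by move: r2 r1; clear; lra.
Qed.

End Potential.

(** * Constrained densities and the equilibrium measure *)

Section Equilibrium.
Context {R : realType}.
Implicit Types (f g h phi psi V : R -> R) (s theta K x y t : R).
Notation mu := (@lebesgue_measure R).

(** Admissibility with bounds that hold at every point and a density vanishing off [0, s],
    so that pointwise estimates need no exceptional set. *)
Definition adm theta s f := [/\ measurable_fun setT f, (forall x, 0 <= f x <= theta^-1),
  (forall x, ~~ (0 <= x <= s) -> f x = 0) & \int[mu]_x f x = 1].

Lemma adm_bcs theta s K f : s <= K -> adm theta s f -> bcs K theta^-1 f.
Proof.
move=> sK [mf fb f0 _]; split => // x.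
  by have /andP[h1 h2] := fb x; rewrite ger0_norm.
move=> Kx; apply: f0; apply: contraL Kx => /andP[x0 xs]; rewrite -leNgt ger0_norm//.
exact: le_trans sK.
Qed.

Lemma adm_indic theta s f x : adm theta s f -> \1_(`[0, s]%classic) x * f x = f x.
Proof.
move=> [_ _ f0 _]; rewrite indic_itvE; have [_|h] := boolP (0 <= x <= s); first by rewrite mul1r.
by rewrite f0// mulr0.
Qed.

Lemma measurable_clamp_comp V s : 0 <= s -> {within `[0, s], continuous V} ->
  measurable_fun setT (fun x => V (clamp s x)).
Proof.
move=> s0 cV.
apply: (@measurable_comp _ _ _ _ _ _ `[0, s]%classic); first exact: measurable_itv.
- move=> _ [x _ <-] /=; rewrite in_itv/=; exact: clamp_bounds.
- by apply: subspace_continuous_measurable_fun => //; exact: measurable_itv.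
- by apply: continuous_measurable_fun; exact: continuous_clamp.
Qed.

Definition adm_energy theta s V f :=
  - theta * logE f f + \int[mu]_x (V (clamp s x) * f x).

Lemma energyE theta s V f : adm theta s f -> energy theta s V f = adm_energy theta s V f.
Proof.
move=> af; have [_ _ f0 _] := af.
rewrite /energy /adm_energy /logE; congr (_ * _ + _).
  rewrite Rintegral_mkcond; apply: eq_Rintegral => z _; rewrite patchE.
  case: ifPn => //; rewrite notin_setE /= => nz.
  have [h1|h1] := boolP (0 <= z.1 <= s); last by rewrite (f0 _ h1) mulr0 mul0r.
  have [h2|h2] := boolP (0 <= z.2 <= s); last by rewrite (f0 _ h2) mulr0.
  by exfalso; apply: nz; rewrite !in_itv/=.
rewrite intR_indic; apply: eq_intR => x; rewrite indic_itvE.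
have [h|h] := boolP (0 <= x <= s); first by rewrite mul1r (clamp_id h).
by rewrite (f0 _ h) !mulr0.
Qed.

Lemma adm_admissible theta s f : adm theta s f -> admissible theta s f.
Proof.
move=> af; have [_ fb _ f1] := af; have Lf := bcs_L1 (adm_bcs (lexx s) af).
split.
- apply/(@L1_indic _ _ f); first exact: measurable_itv.
  by apply: eq_L1 Lf => x; rewrite (adm_indic x af).
- by apply: aeW => x _; exact: fb.
- by rewrite intR_indic -f1; apply: eq_intR => x; rewrite (adm_indic x af).
Qed.

(** Every admissible function agrees almost everywhere with this one, for which the bounds
    hold everywhere. *)
Definition truncate theta s phi x := clamp theta^-1 ((phi \_ `[0, s]) x).

Lemma truncate_ae theta s phi : 0 < theta -> admissible theta s phi ->
  [/\ measurable_fun setT (phi \_ `[0, s]), measurable_fun setT (truncate theta s phi),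
   (forall x, ~~ (0 <= x <= s) -> truncate theta s phi x = 0) &
   {ae mu, forall x, (phi \_ `[0, s]) x = truncate theta s phi x}].
Proof.
move=> th0 [iphi aphi _].
have mr : measurable_fun setT (phi \_ `[0, s]).
  apply/measurable_restrict => //; rewrite setTI.
  by apply/measurable_EFinP; exact: (measurable_int mu iphi).
have ti0 : 0 <= theta^-1 by rewrite invr_ge0 ltW.
split=> //.
- apply: (measurableT_comp _ mr).
  by apply: continuous_measurable_fun; exact: continuous_clamp.
- move=> x hx; rewrite /truncate patchE mem_setE in_itv/= (negbTE hx).
  by rewrite clamp_id// lexx.
- have [N [mN N0 hN]] := aphi; exists N; split=> // x /= nx; apply: hN => /= hx; apply: nx.
  rewrite /truncate patchE mem_setE in_itv/=.
  by case: ifPn => [/hx h|_]; rewrite clamp_id// lexx.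
Qed.

Lemma truncate_int theta s phi g : 0 < theta -> admissible theta s phi ->
  measurable_fun setT g ->
  \int[mu]_(x in `[0, s]) (g x * phi x) = \int[mu]_x (g x * truncate theta s phi x).
Proof.
move=> th0 ap mg; have [mr mt t0 ae] := truncate_ae th0 ap.
transitivity (\int[mu]_x (g x * (phi \_ `[0, s]) x)).
  rewrite intR_indic; apply: eq_intR => x; rewrite patchE indic_itvE mem_setE in_itv/=.
  by case: ifP; rewrite ?mul1r// mul0r mulr0.
congr fine; apply: ae_eq_integral => //.
- by apply/measurable_EFinP; exact: measurable_funM.
- by apply/measurable_EFinP; exact: measurable_funM.
- have [N [mN N0 hN]] := ae; exists N; split=> // x /= nx; apply: hN => /= hx; apply: nx => _.
  by rewrite hx.
Qed.

Lemma truncate_adm theta s phi : 0 < theta -> admissible theta s phi ->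
  adm theta s (truncate theta s phi).
Proof.
move=> th0 ap; have [mr mt t0 ae] := truncate_ae th0 ap.
split=> //; first by move=> x; apply: clamp_bounds; rewrite invr_ge0 ltW.
have [_ _ <-] := ap; have := @truncate_int theta s phi (fun=> 1) th0 ap.
move=> /(_ (measurable_cst _)) e.
transitivity (\int[mu]_x (1 * truncate theta s phi x)).
  by apply: eq_intR => x; rewrite mul1r.
by rewrite -e; apply: eq_Rintegral => x _; rewrite mul1r.
Qed.

(** Changing a density on a null set does not change its energy: the exceptional
    set of the product is contained in two strips of measure zero. *)
Lemma truncate_energy theta s V phi : 0 < theta -> 0 <= s -> admissible theta s phi ->
  {within `[0, s], continuous V} ->
  energy theta s V phi = adm_energy theta s V (truncate theta s phi).
Proof.
move=> th0 s0 ap cV; have [mr mt t0 [N [mN N0 hN]]] := truncate_ae th0 ap.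
rewrite /energy /adm_energy; congr (_ * _ + _); last first.
  rewrite -truncate_int//; last exact: measurable_clamp_comp.
  by apply: eq_Rintegral => x; rewrite inE/= in_itv/= => h; rewrite clamp_id.
set r := phi \_ `[0, s] in mr hN; set p := truncate theta s phi in mt t0 hN *.
transitivity (\int[(mu \x mu)%E]_z (ln `|z.1 - z.2| * r z.1 * r z.2)).
  rewrite Rintegral_mkcond; apply: eq_Rintegral => z _; rewrite patchE.
  have rE x : r x = if 0 <= x <= s then phi x else 0 by rewrite /r patchE mem_setE in_itv.
  case: ifPn => [|nz].
    by rewrite inE /= !in_itv/= => -[h1 h2]; rewrite !rE h1 h2.
  rewrite !rE; case: ifPn => h1; last by rewrite mulr0 mul0r.
  case: ifPn => h2; last by rewrite mulr0.
  by move: nz; rewrite notin_setE /= => nz; exfalso; apply: nz; rewrite !in_itv.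
have mk f : measurable_fun setT f ->
    measurable_fun setT (fun z : R * R => (ln `|z.1 - z.2| * f z.1 * f z.2)%:E).
  move=> mf; apply/measurable_EFinP; apply: measurable_funM; last exact: measurable_snd_comp.
  by apply: measurable_funM; [exact: measurable_ln_diff|exact: measurable_fst_comp].
congr fine; apply: ae_eq_integral => //; [exact: mk|exact: mk|].
exists ((N `*` setT) `|` (setT `*` N)); split.
- by apply: measurableU; exact: measurableX.
- apply: null_set_setU; [exact: measurableX|exact: measurableX| |].
    apply: etrans (_ : mu N * mu setT = 0)%E; last by rewrite N0 mul0e.
    exact: (@product_measure1E _ _ (measurableTypeR R) (measurableTypeR R) R).
  apply: etrans (_ : mu setT * mu N = 0)%E; last by rewrite N0 mule0.
  exact: (@product_measure1E _ _ (measurableTypeR R) (measurableTypeR R) R).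
- move=> z /= nz; apply: contrapT => hz; apply: nz => _.
  have h1 : r z.1 = p z.1.
    by apply: contrapT => e; apply: hz; left; split => //; exact: hN.
  have h2 : r z.2 = p z.2.
    by apply: contrapT => e; apply: hz; right; split => //; exact: hN.
  by rewrite h1 h2.
Qed.

Lemma L1_potential theta s K V f : s <= K -> 0 <= s -> adm theta s f ->
  {within `[0, s], continuous V} -> forall A, (forall x, 0 <= x <= s -> `|V x| <= A) ->
  L1 (fun x => V (clamp s x) * f x).
Proof.
move=> sK s0 af cV A VA; apply: (@L1M _ A); [exact: measurable_clamp_comp| |exact: bcs_L1 (adm_bcs sK af)].
by move=> x; apply: VA; exact: clamp_bounds.
Qed.

(** Along the segment from the minimizer f to h the energy is a quadratic polynomial in t
    that is minimal at t = 0, so its linear coefficient is nonnegative. *)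
Lemma variational_inequality theta s K V f h A : 0 < theta -> 0 <= s -> 0 < K -> s <= K ->
  {within `[0, s], continuous V} -> (forall x, 0 <= x <= s -> `|V x| <= A) ->
  adm theta s f -> adm theta s h ->
  (forall g, adm theta s g -> adm_energy theta s V f <= adm_energy theta s V g) ->
  \int[mu]_x (V (clamp s x) * f x) - 2 * theta * logE f f <=
  \int[mu]_x (V (clamp s x) * h x) - 2 * theta * logE h f.
Proof.
move=> th0 s0 K0 sK cV VA af ah fmin.
have bf := adm_bcs sK af; have bh := adm_bcs sK ah; have bd := bcsB bh bf.
have Lf := L1_potential sK s0 af cV VA; have Lh := L1_potential sK s0 ah cV VA.
pose d x := h x - f x.
set If := \int[mu]_x (V (clamp s x) * f x); set Ih := \int[mu]_x (V (clamp s x) * h x).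
have first_order t : 0 < t -> t <= 1 ->
    0 <= (Ih - If - 2 * theta * (logE h f - logE f f)) - theta * t * logE d d.
  move=> t_gt0 t1; pose g x := f x + t * d x.
  have ag : adm theta s g.
    have [mf fb f0 f1] := af; have [mh hb h0 h1] := ah; split.
    - by apply: measurable_funD => //; apply: measurable_funM => //; exact: measurable_funB.
    - move=> x; have /andP[a1 a2] := fb x; have /andP[b1 b2] := hb x; rewrite /g /d.
      have e : f x + t * (h x - f x) = (1 - t) * f x + t * h x by ring.
      have t0 : 0 <= 1 - t by move: t1; clear; lra.
      rewrite e; apply/andP; split; first by rewrite addr_ge0// mulr_ge0// ltW.
      have := ler_wpM2l t0 a2; have := ler_wpM2l (ltW t_gt0) b2; clear; lra.
    - by move=> x hx; rewrite /g /d f0// h0// subrr mulr0 addr0.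
    - have Lff := bcs_L1 bf; have Lhh := bcs_L1 bh.
      rewrite intRD//; last by apply: L1Z; exact: L1B.
      by rewrite intRZ ?intRB// ?f1 ?h1 ?subrr ?mulr0 ?addr0//; exact: L1B.
  have := fmin g ag; rewrite /adm_energy -/If.
  have -> : \int[mu]_x (V (clamp s x) * g x) = If + t * (Ih - If).
    rewrite /If /Ih -(intRB Lh Lf) -(intRZ t (L1B Lh Lf)) -(intRD Lf (L1Z t (L1B Lh Lf))).
    by apply: eq_intR => x; rewrite /g /d; ring.
  have btd := bcsZ t bd; have bg := bcsD bf btd.
  have -> : logE g g = logE f f + 2 * t * (logE h f - logE f f) + t ^+ 2 * logE d d.
    rewrite (logEDl K0 bf btd bg) (logEDr K0 bf btd bf).
    rewrite (logEDr K0 bf btd btd) (logEZr t K0 bd bf) (logEZl t K0 bd bf) (logEZl t K0 bd btd).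
    rewrite (logEZr t K0 bd bd) (logEBr K0 bh bf bf) (logEBl K0 bh bf bf) (logE_sym K0 bf bh).
    by rewrite /d; ring.
  move: (logE f f) (logE h f) (logE d d) (If) (Ih) => a b c u v ineq.
  have : 0 <= t * ((v - u - 2 * theta * (b - a)) - theta * t * c).
    by move: ineq; clear; lra.
  by rewrite pmulr_rge0.
move: first_order; move: (logE f f) (logE h f) (logE d d) (If) (Ih) => a b c u v first_order.
rewrite leNgt; apply/negP => neg.
pose X := (u - 2 * theta * a) - (v - 2 * theta * b).
have X0 : 0 < X by rewrite /X; move: neg; clear; lra.
pose D := theta * `|c| + 1.
have D0 : 0 < D by rewrite ltr_wpDl// mulr_ge0// ltW.
(* Small enough for the quadratic term to use up at most half of the gap X. *)
pose t := Num.min 1 (X / (2 * D)).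
have t0 : 0 < t by rewrite lt_min ltr01 divr_gt0// mulr_gt0.
have t1 : t <= 1 by rewrite ge_min lexx.
have t2 : t <= X / (2 * D) by rewrite ge_min lexx orbT.
have := first_order t t0 t1.
have h1 : - (theta * t * c) <= t * D.
  have hc : - c <= `|c| by rewrite -normrN ler_norm.
  have := ler_wpM2l (mulr_ge0 (ltW th0) (ltW t0)) hc; rewrite /D.
  by move: t0; clear; lra.
have h2 : t * D <= X / 2.
  have := ler_wpM2r (ltW D0) t2.
  suff -> : X / (2 * D) * D = X / 2 by [].
  by field; rewrite gt_eqF.
by move: h1 h2 X0; rewrite /X; clear; lra.
Qed.

(** The part of f outside [0, s] is cut off and its mass is spread over [0, s] in
    proportion to the room left under the ceiling 1 / theta; there is room because
    theta <= s. *)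
Lemma redistribute theta s b f : 0 < theta -> theta <= s -> adm theta b f ->
  exists2 g, adm theta s g &
    \int[mu]_x `|g x - f x| <= 2 * (theta^-1 * Num.max 0 (b - s)).
Proof.
move=> th0 ths af; have s0 : 0 < s by exact: lt_le_trans ths.
have [mf fb f0 f1] := af; have Lf := bcs_L1 (adm_bcs (lexx b) af).
have ti0 : 0 < theta^-1 by rewrite invr_gt0.
pose S := \1_(`[0, s]%classic) : R -> R.
have mS : measurable_fun setT S by exact: measurable_indic.
have S01 x : S x = 0 \/ S x = 1 by rewrite /S indic_itvE; case: (_ && _); [right|left].
have LS : L1 S by exact: L1_itv.
have LSf : L1 (fun x => S x * f x).
  by apply: (@L1M _ 1) => // x; case: (S01 x) => ->; rewrite ?normr0 ?normr1.
have iS : \int[mu]_x S x = s by rewrite /S intR_itv ?subr0// ltW.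
pose m := 1 - \int[mu]_x (S x * f x).
have mE : m = \int[mu]_x (f x - S x * f x) by rewrite intRB// f1.
have cut x : 0 <= f x - S x * f x.
  by have /andP[h _] := fb x; case: (S01 x) => ->; rewrite ?mul0r ?mul1r ?subr0 ?subrr.
have m0 : 0 <= m by rewrite mE; exact: intR_ge0.
have mle : m <= theta^-1 * Num.max 0 (b - s).
  pose B := \1_(`[s, s + Num.max 0 (b - s)]%classic) : R -> R.
  have iB : \int[mu]_x B x = Num.max 0 (b - s).
    rewrite /B intR_itv; first by ring.
    by rewrite lerDl le_max lexx.
  rewrite mE -iB -intRZ; last exact: L1_itv.
  apply: le_intR; [exact: L1B|by apply: L1Z; exact: L1_itv|].
  move=> x; have /andP[h1 h2] := fb x.
  have B0 : 0 <= theta^-1 * B x by apply: mulr_ge0; [exact: ltW|rewrite /B indicE ler0n].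
  rewrite /S indic_itvE; have [_|h] := boolP (0 <= x <= s); first by rewrite mul1r subrr.
  rewrite mul0r subr0; have [hb|hb] := boolP (0 <= x <= b); last by rewrite (f0 _ hb).
  suff -> : B x = 1 by rewrite mulr1.
  rewrite /B indic_itvE; suff -> : s <= x <= s + Num.max 0 (b - s) by [].
  have /andP[x0 xb] := hb; move: h; rewrite x0/= -ltNge => sx.
  by rewrite (ltW sx) -lerBlDl le_max lerD2r xb orbT.
pose den := theta^-1 * s - 1 + m.
have sth : 1 <= theta^-1 * s by rewrite mulrC ler_pdivlMr// mul1r.
have mden : m <= den by rewrite /den; move: sth; clear; lra.
have den0 : 0 <= den by exact: le_trans mden.
pose t := m / den.
have tden : t * den = m.
  (* If den = 0 there is nothing to redistribute, and t is 0 by convention. *)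
  have [d0|d0] := eqVneq den 0; last by rewrite /t divfK.
  by rewrite d0 mulr0; apply/eqP; rewrite eq_le m0 -d0 mden.
have t0 : 0 <= t by rewrite divr_ge0.
have t1 : t <= 1.
  have [d0|d0] := eqVneq den 0; first by rewrite /t d0 invr0 mulr0.
  by rewrite ler_pdivrMr ?mul1r// lt_def d0.
pose g x := S x * f x + t * (theta^-1 * S x - S x * f x).
have Lr : L1 (fun x => theta^-1 * S x - S x * f x) by apply: L1B => //; exact: L1Z.
have ir : \int[mu]_x (theta^-1 * S x - S x * f x) = den.
  by rewrite (intRB (L1Z _ LS) LSf) intRZ// iS /den /m; ring.
exists g.
  split.
  - apply: measurable_funD; first exact: measurable_funM.
    apply: measurable_funM => //; apply: measurable_funB; exact: measurable_funM.
  - move=> x; have /andP[h1 h2] := fb x; rewrite /g.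
    case: (S01 x) => ->; rewrite ?mul0r ?mulr0 ?subrr ?mulr0 ?addr0 ?lexx.
      by rewrite (ltW ti0).
    rewrite !mul1r mulr1; have d1 : 0 <= theta^-1 - f x by rewrite subr_ge0.
    have d2 := mulr_ge0 t0 d1; apply/andP; split; first exact: addr_ge0.
    by have := ler_wpM2r d1 t1; clear; lra.
  - move=> x hx; rewrite /g /S indic_itvE (negbTE hx)/=.
    by rewrite mul0r mulr0 subrr mulr0 addr0.
  - by rewrite (intRD LSf (L1Z t Lr)) intRZ// ir tden /m; ring.
have -> : \int[mu]_x `|g x - f x| = 2 * m.
  rewrite mulr_natl mulr2n {1}mE -{1}tden -ir -(intRZ t Lr).
  rewrite -(intRD (L1B Lf LSf) (L1Z t Lr)); apply: eq_intR => x.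
  have /andP[h1 h2] := fb x; rewrite /g.
  case: (S01 x) => ->.
    by rewrite !mul0r mulr0 subrr mulr0 !addr0 sub0r subr0 normrN ger0_norm.
  rewrite !mul1r mulr1 subrr add0r addrC addKr ger0_norm//.
  by rewrite mulr_ge0// subr_ge0.
by rewrite ler_pM2l.
Qed.

End Equilibrium.

(** * Concentration of a spaced configuration around the equilibrium measure *)

Section Smearing.
Context {R : realType}.
Implicit Types (f g h phi psi V : R -> R) (theta s K w y t a b c e d : R).
Notation mu := (@lebesgue_measure R).

(** Half-open intervals, so that adjacent boxes are disjoint. *)
Definition box a w y : R := (a <= y < a + w)%R%:R.

Lemma box_01 a w y : box a w y = 0 \/ box a w y = 1.
Proof. by rewrite /box; case: (_ && _); [right|left]. Qed.

Lemma box_ge0 a w y : 0 <= box a w y.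
Proof. by rewrite /box ler0n. Qed.

Lemma box_bounds a w y : box a w y != 0 -> a <= y < a + w.
Proof. by rewrite /box; case: (_ && _) => //; rewrite eqxx. Qed.

Lemma measurable_box a w : measurable_fun setT (box a w).
Proof.
have -> : box a w = \1_(`[a, a + w[%classic).
  by apply/funext => y; rewrite indicE /box mem_setE in_itv.
by apply: measurable_indic; exact: measurable_itv.
Qed.

Lemma bcs_box K a w : 0 <= a -> a + w <= K -> bcs K 1 (box a w).
Proof.
move=> a0 aK; split; first exact: measurable_box.
  by move=> y; case: (box_01 a w y) => ->; rewrite ?normr0 ?normr1.
move=> y Ky; case: (eqVneq (box a w y) 0) => // /box_bounds /andP[h1 h2].
move: Ky; rewrite (ger0_norm (le_trans a0 h1)) => Ky.
by move: (lt_trans (lt_le_trans h2 aK) Ky); rewrite ltxx.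
Qed.

Lemma intR_box a w : 0 <= w -> \int[mu]_y box a w y = w.
Proof.
move=> w0; transitivity (\int[mu]_y \1_(`[a, a + w]%classic) y); last first.
  by rewrite intR_itv ?lerDl//; ring.
apply: (@eq_intR_off _ a (a + w)); [exact: measurable_box|exact: measurable_indic|].
by move=> y _ ny; rewrite indic_itvE /box [y < _]lt_neqAle ny.
Qed.

Lemma L1_box_scaled K a w c : 0 <= a -> a + w <= K -> bcs K `|c| (fun y => c * box a w y).
Proof. by move=> a0 aK; have := bcsZ c (bcs_box a0 aK); rewrite mulr1. Qed.

Definition atom (N : nat) w (x : nat -> R) i y := (N%:R * w)^-1 * box (x i) w y.

(** Spreading the atoms makes the self-interaction finite. The width is free: at width
    theta / N the smeared density obeys the ceiling 1 / theta, at a much smaller width it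
    is close enough to the empirical measure. *)
Definition smear (N : nat) w (x : nat -> R) y :=
  \sum_(0 <= i < N) atom N w x i y.

Definition spaced (N : nat) d (x : nat -> R) :=
  forall i j, (i < j < N)%N -> x j + (j - i)%:R * d <= x i.

(** Boxes no wider than the spacing are disjoint. *)
Lemma sum_box_le1 (N : nat) d w x y : spaced N d x -> w <= d ->
  \sum_(0 <= i < N) box (x i) w y <= 1.
Proof.
move=> sep wd; suff: forall n, (n <= N)%N -> \sum_(0 <= i < n) box (x i) w y <= 1 by exact.
elim=> [|n IH] nN; first by rewrite big_geq.
rewrite big_nat_recr//=; case: (eqVneq (box (x n) w y) 0) => [->|nz].
  by rewrite addr0; exact: IH (ltnW nN).
rewrite big_nat big1 ?add0r; first by case: (box_01 (x n) w y) => ->.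
move=> i /andP[_ ilt]; apply/eqP; apply: contraT => /box_bounds /andP[h1 _].
have /andP[_ h2] := box_bounds nz.
have := sep i n; rewrite ilt nN => /(_ isT) h3.
have h4 : 1 <= (n - i)%:R :> R by rewrite ler1n subn_gt0.
have [h5|h5] := leP 0 d.
  have := ler_wpM2r h5 h4; move: h1 h2 h3 wd; clear; lra.
have h6 : (box (x n) w y != 0) by [].
by have /andP[b1 b2] := box_bounds nz; move: b1 b2 h5 wd; clear; lra.
Qed.

Section Configuration.
Variables (N : nat) (d w K : R) (x : nat -> R).
Hypotheses (N0 : (0 < N)%N) (w0 : 0 < w) (wd : w <= d) (K0 : 0 < K).
Hypotheses (x0 : forall i, 0 <= x i) (xK : forall i, x i + d <= K).
Hypothesis sep : spaced N d x.

Let n0 : 0 < N%:R :> R. Proof. by rewrite ltr0n. Qed.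
Let nw0 : 0 < (N%:R * w)^-1. Proof. by rewrite invr_gt0 mulr_gt0. Qed.
Let xwK i : x i + w <= K. Proof. by apply: le_trans (xK i); rewrite lerD2l. Qed.

Notation F := (atom N w x).

Lemma bcs_atom i : bcs K (N%:R * w)^-1 (F i).
Proof. by have := L1_box_scaled (N%:R * w)^-1 (x0 i) (xwK i); rewrite ger0_norm// ltW. Qed.

Lemma intR_atom i : \int[mu]_y F i y = N%:R^-1.
Proof.
rewrite /atom intRZ; last exact: bcs_L1 (bcs_box (x0 i) (xwK i)).
by rewrite intR_box ?ltW//; field; rewrite !gt_eqF.
Qed.

Lemma atom_ge0 i y : 0 <= F i y.
Proof. by rewrite mulr_ge0 ?box_ge0// ltW. Qed.

Lemma atom_support i y : F i y != 0 -> x i <= y < x i + w.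
Proof. by rewrite mulf_eq0 negb_or => /andP[_ /box_bounds]. Qed.

Lemma bcs_smear : bcs K (N%:R * w)^-1 (smear N w x).
Proof.
have [m1 m2 m3] := bcs_sum (index_iota 0 N) bcs_atom.
split => // y; rewrite /smear ger0_norm; last by apply: sumr_ge0 => i _; exact: atom_ge0.
rewrite /atom -mulr_sumr; have h := ler_wpM2l (ltW nw0) (sum_box_le1 y sep wd).
by rewrite mulr1 in h.
Qed.

Lemma intR_smear : \int[mu]_y smear N w x y = 1.
Proof.
rewrite /smear intR_sum; last by move=> i; exact: bcs_L1 (bcs_atom i).
rewrite (eq_bigr (fun=> N%:R^-1)) => [|i _]; last exact: intR_atom.
by rewrite sumr_const_nat subn0 -(mulr_natl N%:R^-1) mulfV// gt_eqF.
Qed.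

(** Averaging f against the boxes instead of the atoms costs the oscillation of f. *)
Lemma smear_average f (e : nat -> R) : (forall i, L1 (fun y => F i y * f y)) ->
  (forall i y, (i < N)%N -> x i <= y < x i + w -> f y <= f (x i) + e i) ->
  \int[mu]_y (smear N w x y * f y) <= N%:R^-1 * \sum_(0 <= i < N) (f (x i) + e i).
Proof.
move=> Lf fe; rewrite /smear.
rewrite (@eq_intR _ _ (fun y => \sum_(0 <= i < N) (F i y * f y))); last first.
  by move=> y; rewrite mulr_suml.
rewrite intR_sum// mulr_sumr; rewrite !big_nat; apply: ler_sum => i /andP[_ iN].
rewrite -(intR_atom i) mulrC -intRZ; last exact: bcs_L1 (bcs_atom i).
apply: le_intR; [exact: Lf|by apply: L1Z; exact: bcs_L1 (bcs_atom i)|] => y.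
case: (eqVneq (F i y) 0) => [->|/atom_support h]; first by rewrite mul0r mulr0.
by rewrite mulrC ler_wpM2r ?atom_ge0//; exact: fe.
Qed.

Lemma smear_average_abs f e : (forall i, L1 (fun y => F i y * f y)) ->
  (forall i y, (i < N)%N -> x i <= y < x i + w -> `|f y - f (x i)| <= e) ->
  `|\int[mu]_y (smear N w x y * f y) - N%:R^-1 * \sum_(0 <= i < N) f (x i)| <= e.
Proof.
move=> Lf fe.
have avg c : N%:R^-1 * \sum_(0 <= i < N) (c : R) = c.
  by rewrite sumr_const_nat subn0 -(mulr_natl c) mulrA mulVf ?mul1r// gt_eqF.
have h1 : \int[mu]_y (smear N w x y * f y) <= N%:R^-1 * \sum_(0 <= i < N) (f (x i) + e).
  apply: (@smear_average f (fun=> e)) => // i y iN hy; have := fe i y iN hy.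
  by rewrite ler_norml => /andP[_]; lra.
have h2 : \int[mu]_y (smear N w x y * (- f y)) <= N%:R^-1 * \sum_(0 <= i < N) (- f (x i) + e).
  apply: (@smear_average (fun y => - f y) (fun=> e)).
    by move=> i; apply: eq_L1 (L1N (Lf i)) => y; rewrite mulrN.
  move=> i y iN hy; have := fe i y iN hy.
  by rewrite ler_norml => /andP[+ _]; lra.
rewrite (eq_intR (g := fun y => - (smear N w x y * f y))) in h2; last by move=> y; rewrite mulrN.
have LS : L1 (fun y => smear N w x y * f y).
  apply: eq_L1 (L1_sum (index_iota 0 N) Lf) => y; by rewrite /smear mulr_suml.
move: h1 h2; rewrite intRN// !big_split/= !mulrDr avg sumrN mulrN ler_norml.
by move: (\int[mu]_y _) (_ * _) => a b; move=> h1 h2; lra.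
Qed.

Lemma smear_lipschitz L g : (0 <= L) -> measurable_fun setT g ->
  (forall a b, `|g a - g b| <= L * `|a - b|) ->
  `|\int[mu]_y (smear N w x y * g y) - N%:R^-1 * \sum_(0 <= i < N) g (x i)| <= L * w.
Proof.
move=> L0 mg gL; apply: smear_average_abs => [i|i y _ /andP[h1 h2]].
  have [mF _ _] := bcs_atom i.
  have mh : measurable_fun setT (fun y => box (x i) w y * g y).
    by apply: measurable_funM => //; exact: measurable_box.
  have hb y : `|box (x i) w y * g y| <= (`|g (x i)| + L * w) * box (x i) w y.
    case: (eqVneq (box (x i) w y) 0) => [->|nz]; first by rewrite mul0r mulr0 normr0.
    have -> : box (x i) w y = 1 by case: (box_01 (x i) w y) nz => ->; rewrite ?eqxx.
    rewrite mul1r mulr1; have /andP[h1 h2] := box_bounds nz.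
    have h3 := gL y (x i); have h4 : `|y - x i| <= w.
      by rewrite ger0_norm ?subr_ge0//; move: h2; lra.
    have h5 := ler_wpM2l L0 h4.
    have h6 := ler_normD (g y - g (x i)) (g (x i)); rewrite subrK in h6.
    by move: h3 h5 h6; lra.
  have Lh : L1 (fun y => box (x i) w y * g y).
    apply: le_L1 mh hb _; apply: L1Z; exact: bcs_L1 (bcs_box (x0 i) (xwK i)).
  by apply: eq_L1 (L1Z (N%:R * w)^-1 Lh) => y; rewrite /atom mulrA.
apply: le_trans (gL _ _) _; rewrite ler_wpM2l// ger0_norm ?subr_ge0//.
by move: h2; lra.
Qed.

Lemma smear_logpot B phi : bcs K B phi -> d <= K ->
  `|logE (smear N w x) phi - N%:R^-1 * \sum_(0 <= i < N) logpot phi (x i)| <=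
  B * (24 * d + 4 * d * ln (3 * K / d)).
Proof.
move=> bphi dK; have d0 : 0 < d by exact: lt_le_trans wd.
have [_ ->] := logE1 K0 bcs_smear bphi.
apply: smear_average_abs => [i|i y _ /andP[h1 h2]].
  by have [] := logE1 K0 (bcs_atom i) bphi.
have xi := x0 i; have xk := xwK i.
apply: (@logpot_modulus _ K) => //.
- by rewrite ger0_norm//; move: xk w0; lra.
- by rewrite ger0_norm; move: xi h1 h2 xk; lra.
- by rewrite distrC ger0_norm; move: h1 h2 wd; lra.
Qed.

(** Points of two boxes are at distance at least x_i - x_j - w, and the loss
    w / (x_i - x_j - w) is at most 1 / (j - i), whose sum over the pairs is O (N ln N); each
    self-interaction costs only ln w. *)
Lemma smear_energy_ge : 2 * w <= d ->
  2 * pair_sum N (fun i j => ln (x i - x j)) - 2 * (N%:R * (1 + ln N%:R)) +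
    N%:R * (ln w - 8) <= N%:R ^+ 2 * logE (smear N w x) (smear N w x).
Proof.
move=> w2d.
have -> : logE (smear N w x) (smear N w x) =
    \sum_(0 <= i < N) \sum_(0 <= j < N) logE (F i) (F j).
  rewrite (logE_suml (index_iota 0 N) K0 bcs_atom bcs_smear).
  by apply: eq_bigr => i _; rewrite (logE_sumr (index_iota 0 N) K0 bcs_atom (bcs_atom i)).
rewrite (@sum_sym_pairs _ N (fun i j => logE (F i) (F j))); last first.
  by move=> i j; exact: logE_sym K0 (bcs_atom i) (bcs_atom j).
have diag i : (ln w - 8) / N%:R ^+ 2 <= logE (F i) (F i).
  have := @logE_self_ge _ K _ (F i) w K0 (bcs_atom i) (atom_ge0 i) w0.
  rewrite intR_atom; have -> : (ln w * N%:R^-1 - 8 * (N%:R * w)^-1 * w) * N%:R^-1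
      = (ln w - 8) / N%:R ^+ 2.
    by field; rewrite !gt_eqF.
  apply=> a b /atom_support/andP[a1 a2] /atom_support/andP[b1 b2].
  by rewrite ltr_norml; move: a1 a2 b1 b2; lra.
have off i j : (i < j < N)%N ->
    (ln (x i - x j) - (j - i)%:R^-1) / N%:R ^+ 2 <= logE (F i) (F j).
  move=> ij; have /andP[ltij _] := ij; have hs := sep ij.
  have k0 : 0 < (j - i)%:R :> R by rewrite ltr0n subn_gt0.
  have k1 : 1 <= (j - i)%:R :> R by rewrite ler1n subn_gt0.
  have d0 : 0 < d by exact: lt_le_trans wd.
  have kd := ler_wpM2r (ltW d0) k1.
  set D := x i - x j; have Dge : (j - i)%:R * d <= D by rewrite /D; move: hs; lra.
  have gap : (j - i)%:R * w <= D - w.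
    have := ler_wpM2l (ltW k0) w2d; have := ler_wpM2r (ltW w0) k1.
    by move: Dge; lra.
  have Dw0 : 0 < D - w by apply: lt_le_trans gap; rewrite mulr_gt0.
  have D0 : 0 < D by move: Dw0 w0; lra.
  have low : ln D - (j - i)%:R^-1 <= ln (D - w).
    have := @ln_diff_le _ (D - w) D w Dw0 D0 (ltW w0).
    have -> : D <= D - w + w by rewrite subrK.
    move=> /(_ isT) h; have h2 : w / (D - w) <= (j - i)%:R^-1.
      by rewrite ler_pdivrMr// -ler_pdivrMl// ?invr_gt0// invrK.
    by move: h h2; lra.
  have := @logE_ge _ K _ _ (F i) (F j) (ln (D - w)) K0 (bcs_atom i) (bcs_atom j)
    (atom_ge0 i) (atom_ge0 j).
  rewrite !intR_atom => hE.
  apply: le_trans (_ : ln (D - w) * N%:R^-1 * N%:R^-1 <= _).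
    have -> : ln (D - w) * N%:R^-1 * N%:R^-1 = ln (D - w) / N%:R ^+ 2.
      by rewrite -mulrA -invfM expr2.
    by rewrite ler_wpM2r// invr_ge0 exprn_ge0// ltW.
  apply: hE => a b /atom_support/andP[a1 a2] /atom_support/andP[b1 b2] _.
  rewrite ler_ln ?posrE//; last by rewrite normr_gt0 subr_eq0; apply/eqP => e;
    move: a1 b2 Dw0; rewrite /D e; lra.
  apply: le_trans (ler_norm _); rewrite /D; move: a1 b2; lra.
have h1 : N%:R * (ln w - 8) <= N%:R ^+ 2 * \sum_(0 <= i < N) logE (F i) (F i).
  have -> : N%:R * (ln w - 8) = N%:R ^+ 2 * \sum_(0 <= i < N) ((ln w - 8) / N%:R ^+ 2).
    by rewrite sumr_const_nat subn0 -(mulr_natl ((ln w - 8) / N%:R ^+ 2)); field; rewrite gt_eqF.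
  by rewrite ler_wpM2l ?exprn_ge0 ?(ltW n0)//; apply: ler_sum => i _.
have h2 := le_pair_sum off.
have h3 := @pair_sum_inv R N N0.
have h4 : N%:R ^+ 2 * pair_sum N (fun i j => (ln (x i - x j) - (j - i)%:R^-1) / N%:R ^+ 2)
    = pair_sum N (fun i j => ln (x i - x j)) - pair_sum N (fun i j => (j - i)%:R^-1).
  rewrite -pair_sumZ -mulN1r -pair_sumZ -pair_sumD.
  congr (pair_sum N _); apply/funext => i; apply/funext => j.
  by rewrite mulrC divfK ?mulN1r// expf_neq0// gt_eqF.
have h5 := ler_wpM2l (exprn_ge0 2 (ltW n0)) h2; rewrite h4 in h5.
rewrite [X in _ <= X]mulrDr; move: h1 h3 h5.
move: (N%:R * (1 + _)) (N%:R * (_ - _)) (pair_sum _ _) (pair_sum _ _) (_ ^+ 2) => a b c e q.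
move: (\sum_(_ <= _ < _) _) (pair_sum _ _) => u v.
move=> h1 h3 h5; rewrite (_ : q * (2 * v) = 2 * (q * v)); last by ring.
by lra.
Qed.

(** The intervals [x_i, x_i + d] have disjoint interiors, so the increments of a monotone
    function over them add up to at most its range. *)
Lemma spaced_variation (G : R -> R) T : (forall a b, a <= b -> G a <= G b) ->
  (forall a, 0 <= G a <= T) -> \sum_(0 <= i < N) (G (x i + d) - G (x i)) <= T.
Proof.
move=> Gm GT; suff h : forall n, (n < N)%N ->
    \sum_(0 <= i < n.+1) (G (x i + d) - G (x i)) <= T - G (x n).
  have := h N.-1; rewrite prednK// => /(_ (leqnn _)) h1; apply: le_trans h1 _.
  by rewrite gerBl; have /andP[] := GT (x N.-1).
elim=> [|n IH] nN.
  by rewrite big_nat1 lerD2r; have /andP[] := GT (x 0%N + d).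
rewrite big_nat_recr//=; have := IH (ltnW nN).
have := @sep n n.+1; rewrite ltnSn nN subSnn mul1r => /(_ isT) /Gm.
move: (\sum_(_ <= _ < _) _) => a; lra.
Qed.

End Configuration.
End Smearing.

Section UpperBound.
Context {R : realType}.
Implicit Types (f g h phi psi chi V : R -> R) (theta s b K w y t a c e d A : R).
Notation mu := (@lebesgue_measure R).

Definition regular_potential s A (A4 : R) V := [/\ {within `[0, s], continuous V},
  (forall y, 0 <= y <= s -> `|V y| <= A), (forall u, 0 < u < s -> derivable V u 1) &
  (forall u, 0 < u < s -> `|derive1 V u| <= A4 * (1 + `|ln `|u| | + `|ln `|u - s| |))].

Definition modulus_bound theta K d := theta^-1 * (24 * d + 4 * d * ln (3 * K / d)).

Lemma smear_adm (N : nat) theta b x : (0 < N)%N -> 0 < theta ->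
  (forall i, 0 <= x i) -> (forall i, x i + theta / N%:R <= b) ->
  spaced N (theta / N%:R) x -> adm theta b (smear N (theta / N%:R) x).
Proof.
move=> N0 th0 x0 xb sep; have n0 : 0 < N%:R :> R by rewrite ltr0n.
have d0 : 0 < theta / N%:R by rewrite divr_gt0.
have b0 : 0 < b by move: (x0 0%N) (xb 0%N) d0; clear; lra.
have bS := bcs_smear N0 d0 (lexx _) x0 xb sep.
have e : (N%:R * (theta / N%:R))^-1 = theta^-1 by congr (_^-1); field; rewrite gt_eqF.
have [mS bd _] := bS; split => //.
- move=> y; rewrite -{1}e; have := bd y; rewrite ger0_norm => [->|].
    by rewrite andbT; apply: sumr_ge0 => i _; exact: atom_ge0.
  by apply: sumr_ge0 => i _; exact: atom_ge0.
- move=> y hy; rewrite /smear big1// => i _; apply/eqP; apply: contraNT hy.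
  move=> /(atom_support) /andP[h1 h2].
  by rewrite (le_trans (x0 i) h1) (le_trans (ltW h2) (xb i)).
- exact: (intR_smear N0 d0 (lexx _) x0 xb).
Qed.

Lemma L1_V_bcs s A A4 V K B f : 0 <= s -> regular_potential s A A4 V -> bcs K B f ->
  L1 (fun y => V (clamp s y) * f y).
Proof.
move=> s0 [cV VA _ _] bf; apply: (@L1M _ A); last exact: bcs_L1 bf.
  exact: measurable_clamp_comp.
by move=> y; apply: VA; exact: clamp_bounds.
Qed.

Lemma V_difference s A A4 V K B B' f h : 0 <= s -> regular_potential s A A4 V ->
  bcs K B f -> bcs K B' h ->
  `|\int[mu]_y (V (clamp s y) * f y) - \int[mu]_y (V (clamp s y) * h y)| <=
  A * \int[mu]_y `|f y - h y|.
Proof.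
move=> s0 rV bf bh; have [_ VA _ _] := rV.
rewrite -(intRB (L1_V_bcs s0 rV bf) (L1_V_bcs s0 rV bh)).
have Ld := L1_norm (bcs_L1 (bcsB bf bh)).
rewrite -intRZ//; apply: le_norm_intR2; [|exact: L1Z|].
  by apply: eq_L1 (L1_V_bcs s0 rV (bcsB bf bh)) => y; rewrite mulrBr.
move=> y; rewrite -mulrBr normrM; apply: ler_wpM2r => //.
by apply: VA; exact: clamp_bounds.
Qed.

Lemma logE_difference K B B' C f h phi : 0 < K -> bcs K B f -> bcs K B' h -> bcs K C phi ->
  `|logE f phi - logE h phi| <= (\int[mu]_y `|f y - h y|) * (C * potbound K).
Proof.
move=> K0 bf bh bp; rewrite -(logEBl K0 bf bh bp).
exact: logE_norm K0 (bcsB bf bh) bp.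
Qed.

(** Let psi be the configuration smeared at a tiny scale w, psi1 the same configuration
    smeared at scale theta / N, and nu = psi - phi. The self-interaction of psi is
    logE nu nu + 2 logE psi phi - logE phi phi. In the cross term psi may be replaced by
    psi1, because the potential of phi is almost Lipschitz; since psi1 is almost a
    competitor in the minimization, the first-order optimality of phi then compares the
    cross term together with the potential energy with the corresponding quantity for
    phi. *)
Lemma configuration_energy_le (N : nat) theta s b K w A A4 V phi x :
  (0 < N)%N -> 0 < theta -> theta <= s -> s <= K -> b <= K -> 0 < A4 ->
  regular_potential s A A4 V -> adm theta s phi ->
  (forall g, adm theta s g -> adm_energy theta s V phi <= adm_energy theta s V g) ->
  (forall i, 0 <= x i) -> (forall i, x i + theta / N%:R <= b) ->
  spaced N (theta / N%:R) x -> 0 < w -> 2 * w <= theta / N%:R ->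
  2 * theta * pair_sum N (fun i j => ln (x i - x j)) -
    N%:R * \sum_(0 <= i < N) V (clamp s (x i)) <=
  theta * N%:R ^+ 2 * logE (fun y => smear N w x y - phi y) (fun y => smear N w x y - phi y)
  - N%:R ^+ 2 * adm_energy theta s V phi
  + (2 * theta * (N%:R * (1 + ln N%:R)) + theta * (N%:R * (8 - ln w))
     + N%:R * growth_bound A4 s
     + 4 * theta * (N%:R ^+ 2 * modulus_bound theta K (theta / N%:R))
     + N%:R ^+ 2 * ((A + 2 * potbound K) * (2 * (theta^-1 * Num.max 0 (b - s))))).
Proof.
move=> N0 th0 ths sK bK A40 rV aphi phimin x0 xb sep w0 w2d.
have n0 : 0 < N%:R :> R by rewrite ltr0n.
set d := theta / N%:R in xb sep w2d *; have d0 : 0 < d by rewrite divr_gt0.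
have s0 : 0 < s by exact: lt_le_trans ths.
have K0 : 0 < K by exact: lt_le_trans sK.
have wd : w <= d by move: w0 w2d; clear; lra.
have xK i : x i + d <= K by exact: le_trans (xb i) bK.
have dK : d <= K by move: (x0 0%N) (xK 0%N); clear; lra.
have [cV VA dV dVb] := rV.
have apsi := smear_adm N0 th0 x0 xb sep; rewrite -/d in apsi.
have [chi achi dchi] := redistribute th0 ths apsi.
set psi1 := smear N d x in apsi dchi; set psi := smear N w x.
have bpsi : bcs K (N%:R * w)^-1 psi := bcs_smear N0 w0 wd x0 xK sep.
have bpsi1 := adm_bcs bK apsi; have bphi := adm_bcs sK aphi; have bchi := adm_bcs sK achi.
have E1 := smear_energy_ge N0 w0 wd K0 x0 xK sep w2d.
have E2 := smear_logpot N0 w0 wd K0 x0 xK sep bphi dK.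
have E3 := smear_logpot N0 d0 (lexx d) K0 x0 xK sep bphi dK.
rewrite -/psi in E1 E2; rewrite -/psi1 in E3.
have E4 : N%:R * \int[mu]_y (V (clamp s y) * psi1 y) <=
    \sum_(0 <= i < N) V (clamp s (x i)) + growth_bound A4 s.
  have tv : forall a c, a <= c -> potential_growth A4 s a <= potential_growth A4 s c.
    move=> a c ac; have := potential_variation s0 A40 cV dV dVb ac.
    by move=> h; rewrite -subr_ge0; exact: le_trans h.
  have h1 := @smear_average R N d d K x N0 d0 (lexx d) x0 xK (fun y => V (clamp s y))
    (fun i => potential_growth A4 s (x i + d) - potential_growth A4 s (x i)).
  rewrite -/psi1 in h1.
  rewrite (eq_intR (g := fun y => psi1 y * V (clamp s y))); last by move=> y; rewrite mulrC.
  apply: le_trans (ler_wpM2l (ltW n0) (h1 _ _)) _.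
  - move=> i; apply: eq_L1 (L1_V_bcs (ltW s0) rV (bcs_atom N0 d0 (lexx d) x0 xK i)) => y.
    by rewrite mulrC.
  - move=> i y _ /andP[y1 y2].
    have h := potential_variation s0 A40 cV dV dVb y1.
    have h' := tv _ _ (ltW y2); have h'' := ler_norm (V (clamp s y) - V (clamp s (x i))).
    by move: h h' h''; clear; lra.
  - rewrite mulrA mulfV ?gt_eqF// mul1r big_split/= lerD2l.
    apply: (spaced_variation N0 sep tv).
    exact: potential_growth_bounds s0 A40.
have E5 := V_difference (ltW s0) rV bchi bpsi1.
have E6 := logE_difference K0 bchi bpsi1 bphi.
have E7 := variational_inequality th0 (ltW s0) K0 sK cV VA aphi achi phimin.
have A0 : 0 <= A by apply: le_trans (VA 0 _); rewrite ?normr_ge0// lexx ltW.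
have P0 : 0 <= theta^-1 * potbound K by rewrite mulr_ge0 ?invr_ge0 ?potbound_ge0// ltW.
have E8 := le_trans E5 (ler_wpM2l A0 dchi).
have E9 := le_trans E6 (ler_wpM2r P0 dchi).
have Enu : logE (fun y => psi y - phi y) (fun y => psi y - phi y) =
    logE psi psi - 2 * logE psi phi + logE phi phi.
  have bnu := bcsB bpsi bphi.
  rewrite (logEBl K0 bpsi bphi bnu) (logEBr K0 bpsi bphi bpsi) (logEBr K0 bpsi bphi bphi).
  by rewrite (logE_sym K0 bphi bpsi); ring.
rewrite Enu; rewrite /modulus_bound.
have -> : adm_energy theta s V phi = - theta * logE phi phi +
  \int[mu]_y (V (clamp s y) * phi y) by [].
move: E8 E9 E7 E4 E3 E2 E1.
move: (\int[mu]_y (V (clamp s y) * chi y)) (\int[mu]_y (V (clamp s y) * psi1 y)) => vchi vpsi1.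
move: (\int[mu]_y (V (clamp s y) * phi y)) (logE chi phi) (logE psi1 phi) => vphi echi epsi1.
move: (logE psi phi) (logE psi psi) (logE phi phi) (pair_sum _ _) => e1 e2 e3 P.
move: (\sum_(_ <= _ < _) logpot _ _) (\sum_(_ <= _ < _) _) => sU sV.
set tD := theta^-1 * Num.max 0 _; set M := theta^-1 * (24 * d + _).
set TV := growth_bound _ _; set p := potbound K.
have tti : theta * theta^-1 = 1 by rewrite mulfV// gt_eqF.
rewrite !ler_norml => /andP[_ f1] /andP[f2 _] f3 f4 /andP[f5 f6] /andP[f7 f8] f9.
have k1 : 2 * theta * epsi1 - vpsi1 <= 2 * theta * e3 - vphi + (A + 2 * p) * (2 * tD).
  have := ler_wpM2l (ltW th0) f2.
  rewrite (_ : theta * - (2 * tD * (theta^-1 * p)) = - ((theta * theta^-1) * (2 * tD * p))).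
    by rewrite tti; move: f1 f3; clear; lra.
  by ring.
have k2 : e1 <= epsi1 + 2 * M by move: f6 f7 f8 f5; clear; lra.
have n2 : 0 <= (N%:R : R) ^+ 2 by rewrite exprn_ge0// ltW.
have k3 : 2 * theta * e1 - vpsi1 <=
    2 * theta * e3 - vphi + 4 * theta * M + (A + 2 * p) * (2 * tD).
  by have := ler_wpM2l (ltW th0) k2; move: k1; clear; lra.
have := ler_wpM2l n2 k3; have := ler_wpM2l (ltW th0) f9; have := ler_wpM2l (ltW n0) f4.
move: (N%:R : R) (ln w) => n lw; move: (ln n) => ln; clear.
have -> : n * (n * vpsi1) = n ^+ 2 * vpsi1 by ring.
move: (n ^+ 2) => n2.
move: ((A + 2 * p) * _) => X; lra.
Qed.

End UpperBound.

(** * A configuration following the equilibrium density *)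

Section Quantiles.
Context {R : realType}.
Implicit Types (f g h phi psi V : R -> R) (theta s b K w y t a c d A : R) (e : nat -> R).
Notation mu := (@lebesgue_measure R).

Lemma bcs_restrict K B f a c : bcs K B f -> bcs K B (fun y => (a <= y < c)%R%:R * f y).
Proof.
move=> [mf fB f0]; split.
- apply: measurable_funM => //.
  have -> : (fun y : R => (a <= y < c)%R%:R : R) = \1_(`[a, c[%classic).
    by apply/funext => y; rewrite indicE mem_setE in_itv.
  by apply: measurable_indic; exact: measurable_itv.
- move=> y; case: (_ && _); first by rewrite mul1r.
  by rewrite mul0r normr0; exact: le_trans (fB y).
- by move=> y /f0 ->; rewrite mulr0.
Qed.

Definition cumulative f t : R := \int[mu]_y ((y < t)%R%:R * f y).

Lemma L1_cumulative K B f t : bcs K B f -> L1 (fun y => (y < t)%R%:R * f y).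
Proof.
move=> bf; apply: (@L1M _ 1) (bcs_L1 bf).
  have -> : (fun y : R => (y < t)%R%:R : R) = \1_(`]-oo, t[%classic).
    by apply/funext => y; rewrite indicE mem_setE in_itv.
  by apply: measurable_indic; exact: measurable_itv.
by move=> y; case: (_ < _); rewrite ?normr0 ?normr1.
Qed.

Lemma cumulative_diff K B f a c : bcs K B f -> a <= c ->
  cumulative f c - cumulative f a = \int[mu]_y ((a <= y < c)%R%:R * f y).
Proof.
move=> bf ac; rewrite /cumulative -(intRB (L1_cumulative c bf) (L1_cumulative a bf)).
apply: eq_intR => y; rewrite -mulrBl; congr (_ * _); rewrite leNgt.
case: (ltP y a) => ya /=; last by rewrite subr0.
by rewrite (lt_le_trans ya ac) subrr.
Qed.

(** The ceiling makes the distribution function Lipschitz, hence the quantiles spaced by at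
    least theta / N. *)
Lemma cumulative_increase theta s f a c : 0 < theta -> adm theta s f -> a <= c ->
  0 <= cumulative f c - cumulative f a <= theta^-1 * (c - a).
Proof.
move=> th0 af ac; have bf := adm_bcs (lexx s) af; have [_ fb _ _] := af.
rewrite (cumulative_diff bf ac); apply/andP; split.
  by apply: intR_ge0 => y; rewrite mulr_ge0 ?ler0n//; have /andP[] := fb y.
have ca : 0 <= c - a by rewrite subr_ge0.
have Lb : L1 (box a (c - a)).
  apply: (le_L1 (measurable_box a (c - a)) _ (L1_itv a c)) => y; rewrite indic_itvE.
  case: (eqVneq (box a (c - a) y) 0) => [->|nz]; first by rewrite normr0 ler0n.
  have /andP[h1] := box_bounds nz; rewrite addrC subrK => h2.
  by rewrite h1 (ltW h2); case: (box_01 a (c - a) y) => ->; rewrite ?normr0 ?normr1.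
rewrite -(intR_box a ca) -intRZ//; apply: le_intR; [|exact: L1Z|].
  exact: bcs_L1 (bcs_restrict a c bf).
move=> y; rewrite /box [a + _]addrC subrK mulrC; apply: ler_wpM2r; first exact: ler0n.
by have /andP[] := fb y.
Qed.

Lemma cumulative_low theta s f t : adm theta s f -> t <= 0 -> cumulative f t = 0.
Proof.
move=> [_ _ f0 _] t0; rewrite /cumulative -[RHS]intR0; apply: eq_intR => y.
case: (ltP y t) => yt; last by rewrite mul0r.
by rewrite f0 ?mulr0// negb_and -ltNge (lt_le_trans yt t0).
Qed.

Lemma cumulative_high theta s f t : adm theta s f -> s < t -> cumulative f t = 1.
Proof.
move=> [_ _ f0 f1] st; rewrite /cumulative -[RHS]f1; apply: eq_intR => y.
case: (ltP y t) => yt; first by rewrite mul1r.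
by rewrite mul0r f0// negb_and -[X in _ || X]ltNge (lt_le_trans st yt) orbT.
Qed.

Lemma spaced_of_step (d : R) e : (forall k, e k.+1 + d <= e k) ->
  forall i j, (i <= j)%N -> e j + (j - i)%:R * d <= e i.
Proof.
move=> st i j ij; rewrite -(subnK ij); move: (j - i)%N => k; rewrite addnK.
elim: k => [|k IH]; first by rewrite add0n mul0r addr0.
apply: le_trans IH; rewrite addSn -natr1 mulrDl mul1r.
by move: (st (k + i)%N); move: (k%:R * d) => z; clear; lra.
Qed.

(** Points cutting f into N pieces of mass 1 / N, listed from the right. They are
    continued to the left of 0 with the minimal spacing theta / N; the first one lies
    beyond the support so that the half-open cells cover it. *)
Lemma quantiles (N : nat) theta b f : (0 < N)%N -> 0 < theta -> 0 <= b -> adm theta b f ->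
  exists e, [/\ e 0%N = b + 1, e 1%N + theta / N%:R <= b, e N = 0,
    (forall k, e k.+1 + theta / N%:R <= e k) &
    (forall k, cumulative f (e k) = (N - k)%:R / N%:R)].
Proof.
move=> N0 th0 b0 af; have n0 : 0 < N%:R :> R by rewrite ltr0n.
have inc := fun a c => @cumulative_increase theta b f a c th0 af.
have ti0 : 0 < theta^-1 by rewrite invr_gt0.
have Fb : cumulative f b = 1.
  apply/eqP; rewrite eq_le; apply/andP; split.
    have h : b <= b + 1 by rewrite lerDl.
    have /andP[] := inc _ _ h; rewrite (cumulative_high af) ?ltrDl//.
    by rewrite subr_ge0.
  apply/ler_addgt0Pr => eps eps0.
  have h : b <= b + theta * eps by rewrite lerDl ltW// mulr_gt0.
  have /andP[_] := inc _ _ h; rewrite (cumulative_high af) ?ltrDl ?mulr_gt0//.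
  have -> : theta^-1 * (b + theta * eps - b) = eps by field; rewrite gt_eqF.
  by clear; lra.
have F0 t : t <= 0 -> cumulative f t = 0 by exact: cumulative_low af.
have Fc : {within `[0, b], continuous (cumulative f)}.
  apply: continuous_subspaceT; apply: (@continuous_lip _ _ theta^-1) => a c.
  wlog ac : a c / a <= c.
    move=> h; have [/h//|/ltW/h] := leP a c.
    by rewrite distrC [`|c - a|]distrC.
  have /andP[h1 h2] := inc _ _ ac.
  by rewrite distrC ger0_norm// distrC ger0_norm// subr_ge0.
have ex k : exists t, cumulative f t = (N - k)%:R / N%:R /\
    (if k is 0%N then t = b + 1 else if (k < N)%N then (0 <= t <= b : Prop)
     else t = - ((k - N)%:R * (theta / N%:R))).
  case: k => [|k].
    by exists (b + 1); rewrite (cumulative_high af) ?ltrDl// subn0 mulfV// gt_eqF.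
  case kN: (k.+1 < N)%N; last first.
    exists (- ((k.+1 - N)%:R * (theta / N%:R))); split => //.
    have /eqP -> : (N - k.+1 == 0)%N by rewrite subn_eq0 leqNgt kN.
    by rewrite mul0r F0// oppr_le0 mulr_ge0// ltW// divr_gt0.
  have [|t] := @IVT _ (cumulative f) 0 b ((N - k.+1)%:R / N%:R) b0 Fc.
    rewrite Fb F0// min_l ?ler01// max_r ?ler01//.
    apply/andP; split; first by rewrite divr_ge0 ?ler0n.
    by rewrite ler_pdivrMr// mul1r ler_nat leq_subr.
  by rewrite in_itv/= => tb tE; exists t.
have [e eE] := choice ex; exists e.
have e0 : e 0%N = b + 1 by have [] := eE 0%N.
have eM k : cumulative f (e k) = (N - k)%:R / N%:R by have [] := eE k.
have eN k : (N <= k)%N -> e k = - ((k - N)%:R * (theta / N%:R)).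
  move=> Nk; have [_] := eE k; case: k Nk => [|k] Nk; first by move: N0; rewrite ltnNge Nk.
  by rewrite ltnNge Nk.
have mass a c : a <= c -> 1 / N%:R <= cumulative f c - cumulative f a ->
    a + theta / N%:R <= c.
  move=> ac h; have /andP[_ h2] := inc _ _ ac; have h3 := le_trans h h2.
  rewrite -lerBrDl; have := ler_wpM2l (ltW th0) h3.
  by rewrite [X in _ <= X]mulrA mulfV ?gt_eqF// !mul1r.
have e1b : e 1%N <= b.
  case: (ltnP 1%N N) => N1; first by have [_] := eE 1%N; rewrite N1 => /andP[].
  rewrite (eN 1%N N1); apply: le_trans b0; rewrite oppr_le0 mulr_ge0//.
  by rewrite ltW// divr_gt0.
have m1 : 1 / N%:R <= cumulative f b - cumulative f (e 1%N).
  rewrite Fb eM natrB// mulrBl mulfV ?gt_eqF//; move: (N%:R^-1) => z; clear; lra.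
have e1 := mass _ _ e1b m1.
split => //; first by rewrite eN// subnn mul0r oppr0.
move=> k; case: (ltnP k N) => kN.
  case: k kN => [_|k kN]; first by rewrite e0; apply: le_trans e1 _; rewrite lerDl.
  have hm : cumulative f (e k.+1) - cumulative f (e k.+2) = 1 / N%:R.
    rewrite !eM (_ : (N - k.+1 = (N - k.+2).+1)%N); last by lia.
    by rewrite -natr1 mulrDl addrAC subrr add0r.
  apply: mass; last by rewrite hm.
  rewrite leNgt; apply/negP => /ltW h; have /andP[h1 _] := inc _ _ h.
  have : 0 < 1 / N%:R :> R by rewrite divr_gt0.
  by move: h1 hm; clear; lra.
rewrite !eN ?(leqW kN)// subSn// -natr1 mulrDl; move: (theta / _) => z; clear; lra.
Qed.

Section Cells.
Variables (N m : nat) (theta b : R) (f : R -> R) (e x : nat -> R).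
Hypotheses (N0 : (0 < N)%N) (th0 : 0 < theta) (b0 : 0 <= b) (af : adm theta b f).
Hypotheses (e0 : e 0%N = b + 1) (eN : e N = 0).
Hypothesis step : forall k, e k.+1 + theta / N%:R <= e k.
Hypothesis mass : forall k, cumulative f (e k) = (N - k)%:R / N%:R.
Hypothesis xe : forall i, (i < N)%N -> e i.+1 - N%:R^-1 <= x i <= e i.+1.
Hypothesis sep : spaced N (theta / N%:R) x.

Let n0 : 0 < N%:R :> R. Proof. by rewrite ltr0n. Qed.
Let d0 : 0 < theta / N%:R. Proof. by rewrite divr_gt0. Qed.

Let estep := spaced_of_step step.

Let emono i j : (i <= j)%N -> e j <= e i.
Proof.
move=> ij; apply: le_trans (estep ij); rewrite lerDl mulr_ge0//; exact: ltW.
Qed.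

Let elt i : e i.+1 < e i.
Proof. by apply: lt_le_trans (step i); rewrite ltrDl. Qed.

Definition cell i y : R := (e i.+1 <= y < e i)%R%:R * f y.

Lemma sum_cell y : \sum_(0 <= i < N) cell i y = f y.
Proof.
have h n : \sum_(0 <= i < n) (e i.+1 <= y < e i)%R%:R = (e n <= y < e 0%N)%R%:R :> R.
  elim: n => [|n IH]; first by rewrite big_geq// leNgt; case: (y < e 0%N).
  rewrite big_nat_recr//= IH; case: (leP (e n) y) => h1 /=.
    by rewrite andbF addr0 (le_trans (ltW (elt n)) h1).
  by rewrite add0r andbT (lt_le_trans h1 (emono (leq0n n))) andbT.
rewrite -mulr_suml h eN e0; have [_ _ f0 _] := af.
case: (boolP (0 <= y <= b)) => [/andP[y0 yb]|/f0 ->]; last by rewrite mulr0.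
by rewrite y0 (le_lt_trans yb) ?mul1r// ltrDl.
Qed.

Lemma bcs_cell i : bcs b theta^-1 (cell i).
Proof. exact: bcs_restrict (adm_bcs (lexx b) af). Qed.

Lemma cell_ge0 i y : 0 <= cell i y.
Proof. by have [_ fb _ _] := af; rewrite mulr_ge0 ?ler0n//; have /andP[] := fb y. Qed.

Lemma cell_support i y : cell i y != 0 -> e i.+1 <= y < e i.
Proof. by rewrite /cell; case: (_ && _) => //; rewrite mul0r eqxx. Qed.

Lemma intR_cell i : (i < N)%N -> \int[mu]_y cell i y = N%:R^-1.
Proof.
move=> iN; rewrite /cell -(cumulative_diff (adm_bcs (lexx b) af) (ltW (elt i))).
rewrite !mass (_ : (N - i = (N - i.+1).+1)%N); last by lia.
by rewrite -natr1 mulrDl addrAC subrr add0r mul1r.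
Qed.

Lemma cell_energy i j : (i <= j < N)%N -> 0 < b ->
  logE (cell i) (cell j) <= ln (e i - e j.+1) / N%:R ^+ 2.
Proof.
move=> /andP[ij jN] b_gt0; have iN : (i < N)%N by exact: leq_ltn_trans jN.
have := @logE_le _ b _ _ (cell i) (cell j) (ln (e i - e j.+1)) b_gt0 (bcs_cell i) (bcs_cell j)
  (cell_ge0 i) (cell_ge0 j).
rewrite !intR_cell// -mulrA -invfM -expr2; apply => u v.
move=> /cell_support/andP[u1 u2] /cell_support/andP[v1 v2] uv.
have h1 := emono ij; have h2 : e j.+1 <= e i.+1 by exact: emono.
have h3 : 0 < `|u - v| by rewrite normr_gt0 subr_eq0.
have h4 : `|u - v| <= e i - e j.+1.
  by rewrite ler_norml; apply/andP; split; lra.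
by rewrite ler_ln ?posrE//; exact: lt_le_trans h4.
Qed.

(** Bounding the interaction of the cells i < j by the logarithm of their largest
    distance e_i - e_(j+1), and shifting the index i by one, compares the energy of f with
    that of the points e_(i+1), up to boundary terms of total size O (N ln N). Each x_i is
    within 1 / N of e_(i+1), which costs another harmonic sum over the gaps j - i. *)
Lemma cells_energy_le : 0 < b ->
  N%:R ^+ 2 * logE f f <= 2 * pair_sum N (fun i j => ln (x i - x j)) +
    (2 * N%:R * (b + 1) + N%:R * (ln N%:R + `|ln theta|)
     + 2 * theta^-1 * (N%:R * (1 + ln N%:R))).
Proof.
move=> b_gt0.
have -> : logE f f = \sum_(0 <= i < N) \sum_(0 <= j < N) logE (cell i) (cell j).
  have bf := adm_bcs (lexx b) af.
  have fE : f = fun y => \sum_(0 <= i < N) cell i y by apply/funext => y; rewrite sum_cell.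
  rewrite {1}fE (logE_suml (index_iota 0 N) b_gt0 bcs_cell bf).
  apply: eq_bigr => i _; rewrite {1}fE.
  by rewrite (logE_sumr (index_iota 0 N) b_gt0 bcs_cell (bcs_cell i)).
rewrite (@sum_sym_pairs _ N (fun i j => logE (cell i) (cell j))); last first.
  by move=> i j; exact: logE_sym b_gt0 (bcs_cell i) (bcs_cell j).
pose F i j := ln (e i - e j.+1).
have n2 : 0 < N%:R ^+ 2 :> R by rewrite exprn_gt0.
have h1 : N%:R ^+ 2 * \sum_(0 <= i < N) logE (cell i) (cell i) <= \sum_(0 <= i < N) F i i.
  rewrite mulr_sumr !big_nat; apply: ler_sum => i /andP[_ iN].
  by rewrite mulrC -ler_pdivlMr//; apply: cell_energy; rewrite ?leqnn.
have h2 : N%:R ^+ 2 * pair_sum N (fun i j => logE (cell i) (cell j)) <= pair_sum N F.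
  rewrite -pair_sumZ; apply: le_pair_sum => i j /andP[ij jN].
  by rewrite mulrC -ler_pdivlMr//; apply: cell_energy; rewrite ?(ltnW ij).
have h3 := pair_sum_shift F N0; rewrite -/(pair_sum N F) in h3.
have h4 : pair_sum N (fun i j => F i.+1 j) <=
    pair_sum N (fun i j => ln (x i - x j)) + theta^-1 * (N%:R * (1 + ln N%:R)).
  have := @pair_sum_inv R N N0; move=> /(ler_wpM2l (_ : 0 <= theta^-1)) h.
  apply: le_trans (lerD (lexx _) (h _)); last by rewrite invr_ge0 ltW.
  rewrite -pair_sumZ -pair_sumD; apply: le_pair_sum => i j ij; have /andP[ltij jN] := ij.
  have k0 : 0 < (j - i)%:R :> R by rewrite ltr0n subn_gt0.
  have kd0 := mulr_gt0 k0 d0.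
  have /andP[a1 a2] := xe (ltn_trans ltij jN); have /andP[c1 c2] := xe jN.
  have hx := sep ij; have lt1 : e j.+1 < e i.+1.
    have := @estep i.+1 j.+1 (ltnW ltij); rewrite subSS; lra.
  have X0 : 0 < x i - x j by lra.
  have E0 : 0 < e i.+1 - e j.+1 by rewrite subr_gt0.
  have N1 : 0 <= N%:R^-1 :> R by rewrite invr_ge0 ltW.
  have le1 : e i.+1 - e j.+1 <= x i - x j + N%:R^-1 by lra.
  have hl := ln_diff_le X0 E0 N1 le1.
  apply: le_trans hl _; rewrite lerD2l ler_pdivrMr//.
  have hX : (j - i)%:R * (theta / N%:R) <= x i - x j by lra.
  have c0 : 0 <= theta^-1 * (j - i)%:R^-1 by rewrite mulr_ge0 ?invr_ge0// ltW.
  have := ler_wpM2l c0 hX.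
  rewrite (_ : theta^-1 * (j - i)%:R^-1 * ((j - i)%:R * (theta / N%:R)) = N%:R^-1)//.
  by field; rewrite !gt_eqF.
have F0 j : (j < N)%N -> F 0%N j <= b + 1.
  move=> jN; rewrite /F e0; have l1 : 0 <= e j.+1 by rewrite -eN emono.
  have l2 := emono (leq0n j); rewrite e0 in l2; have l3 := elt j.
  have p : 0 < b + 1 - e j.+1 by lra.
  by apply: le_trans (ln_leB1 p) _; lra.
have h5 : \sum_(1 <= j < N) F 0%N j <= N.-1%:R * (b + 1).
  have -> : N.-1%:R * (b + 1) = \sum_(1 <= j < N) (b + 1).
    by rewrite sumr_const_nat -(mulr_natl (b + 1)) subn1.
  by rewrite !big_nat; apply: ler_sum => j /andP[_ jN]; exact: F0.
have Fd i : ln theta - ln N%:R <= F i i.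
  rewrite -ln_div ?posrE// /F ler_ln ?posrE// ?subr_gt0 ?elt//.
  by have := step i; lra.
have h6 : N.-1%:R * (ln theta - ln N%:R) <= \sum_(0 <= i < N.-1) F i.+1 i.+1.
  have -> : N.-1%:R * (ln theta - ln N%:R) = \sum_(0 <= i < N.-1) (ln theta - ln N%:R : R).
    by rewrite sumr_const_nat -(mulr_natl (ln theta - ln N%:R)) subn0.
  by apply: ler_sum => i _.
have h7 : \sum_(0 <= i < N) F i i = F 0%N 0%N + \sum_(0 <= i < N.-1) F i.+1 i.+1.
  by rewrite -{1}(prednK N0) big_nat_recl.
have h8 := F0 0%N N0.
have h9 : (N.-1%:R : R) = N%:R - 1 by rewrite -subn1 natrB.
have lN : 0 <= ln N%:R :> R by rewrite ln_ge0// ler1n.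
have lth : - ln theta <= `|ln theta| by rewrite -normrN ler_norm.
have h10 : N.-1%:R * (ln N%:R - ln theta) <= N%:R * (ln N%:R + `|ln theta|).
  apply: le_trans (_ : N.-1%:R * (ln N%:R + `|ln theta|) <= _).
    by apply: ler_wpM2l; [exact: ler0n|lra].
  by apply: ler_wpM2r; [exact: addr_ge0|rewrite ler_nat leq_pred].
rewrite mulrDr (mulrCA _ 2); move: h1 h2 h3 h4 h5 h6 h7 h8 h9 h10.
move: (_ * \sum_(_ <= _ < _) logE _ _) (_ * pair_sum N (fun i j => logE _ _)) => E1 E2.
move: (pair_sum N F) (pair_sum N (fun i j => F i.+1 j)) (F 0%N 0%N) => P1 P2 F00.
move: (\sum_(0 <= _ < N) _) (\sum_(0 <= _ < N.-1) _) (\sum_(1 <= _ < N) _) => S1 S2 S3.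
move: (pair_sum N _) (N%:R * (ln N%:R + `|ln theta|)) (N.-1%:R : R) => P3 T2 n1.
move: (ln theta) (ln N%:R) => a c.
move=> h1 h2 h3 h4 h5 h6 h7 h8 h9 h10.
subst n1; lra.
Qed.

(** Each particle lies above the quantile m + 1 places further on, because m steps of size
    theta / N exceed the rounding error 1 / N; the increments of the monotone majorant of the
    potential then telescope. *)
Lemma cells_potential_le s A B V : 0 < s -> 0 < B -> regular_potential s A B V ->
  1 <= m%:R * theta ->
  \sum_(0 <= i < N) V (clamp s (x i)) <=
  N%:R * \int[mu]_y (V (clamp s y) * f y) + m.+1%:R * growth_bound B s.
Proof.
move=> s0 B0 rV hm; have [cV VA dV dVb] := rV.
pose G := potential_growth B s; pose T := growth_bound B s.
have GT : forall y, 0 <= G y <= T := potential_growth_bounds s0 B0.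
have tv : forall a c, a <= c -> `|V (clamp s c) - V (clamp s a)| <= G c - G a.
  by move=> a c ac; have h := potential_variation s0 B0 cV dV dVb ac; exact: h.
have Gm a c : a <= c -> G a <= G c.
  by move=> /tv h; rewrite -subr_ge0; exact: le_trans h.
have bf := adm_bcs (lexx b) af.
have -> : \int[mu]_y (V (clamp s y) * f y) =
    \sum_(0 <= i < N) \int[mu]_y (V (clamp s y) * cell i y).
  rewrite -intR_sum; last by move=> i; exact: L1_V_bcs (ltW s0) rV (bcs_cell i).
  by apply: eq_intR => y; rewrite -mulr_sumr sum_cell.
(* The quantiles decrease while the telescoping lemma wants an increasing sequence. *)
pose u k := T - G (e k).
have tel := @telescope_shift R T u N m.+1 _ _.
have -> : growth_bound B s = T by [].
apply: le_trans (lerD (lexx _) (tel _ _)); first last.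
- by move=> k; rewrite /u; have /andP[] := GT (e k); lra.
- by move=> k; rewrite /u lerD2l lerN2; apply: Gm; exact: ltW.
rewrite mulr_sumr -big_split/= !big_nat; apply: ler_sum => i /andP[_ iN].
have /andP[x1 x2] := xe iN.
have xlow : e (i + m.+1)%N <= x i.
  apply: le_trans x1; rewrite addnS -addSn.
  have := @estep i.+1 (i.+1 + m)%N (leq_addr _ _); rewrite addKn.
  have : N%:R^-1 <= m%:R * (theta / N%:R).
    by rewrite mulrA -[X in X <= _]mul1r ler_wpM2r// invr_ge0 ltW.
  lra.
have h y : e i.+1 <= y < e i -> V (clamp s (x i)) + (G (e (i + m.+1)%N) - G (e i))
    <= V (clamp s y).
  move=> /andP[y1 y2]; have t1 := tv _ _ (le_trans x2 y1).
  have t2 := Gm _ _ (ltW y2); have t3 := Gm _ _ xlow.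
  by move: t1; rewrite ler_norml => /andP[t1 _]; lra.
set c := _ + _ in h.
have h2 : c / N%:R <= \int[mu]_y (V (clamp s y) * cell i y).
  rewrite -(intR_cell iN) -intRZ; last exact: bcs_L1 (bcs_cell i).
  apply: le_intR; [exact: L1Z (bcs_L1 (bcs_cell i))|exact: L1_V_bcs (ltW s0) rV (bcs_cell i)|].
  move=> y; case: (eqVneq (cell i y) 0) => [->|/cell_support hy]; first by rewrite !mulr0.
  by rewrite ler_wpM2r ?cell_ge0//; exact: h.
move: h2; rewrite ler_pdivrMr// mulrC /c /u; lra.
Qed.

End Cells.
End Quantiles.

Section LowerBound.
Context {R : realType}.
Implicit Types (f g h phi psi V : R -> R) (theta s b K w y t a c d A B : R) (e : nat -> R).
Notation mu := (@lebesgue_measure R).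

Definition particle theta (N M : nat) (lam : N.-tuple 'I_M.+1) (i : nat) : R :=
  ell theta lam i / N%:R.

Lemma state_nth (N M : nat) (lam : N.-tuple 'I_M.+1) i j : lam \in state N M ->
  (i <= j < N)%N -> (nth ord0 lam j <= nth ord0 lam i)%N.
Proof.
rewrite inE => srt /andP[ij jN].
have tr : transitive (fun a b : 'I_M.+1 => (b <= a)%N).
  by move=> a b c h1 h2; exact: leq_trans h1.
have rf : reflexive (fun a b : 'I_M.+1 => (b <= a)%N) by move=> a; exact: leqnn.
by apply: (sorted_leq_nth tr rf ord0 srt); rewrite ?inE ?size_tuple//; exact: leq_ltn_trans jN.
Qed.

Lemma ell_spaced theta (N M : nat) (lam : N.-tuple 'I_M.+1) i j : lam \in state N M ->
  (i < j < N)%N -> ell theta lam j + (j - i)%:R * theta <= ell theta lam i.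
Proof.
move=> st /andP[ij jN]; have iN := ltn_trans ij jN.
have h : (nth ord0 lam j)%:R <= (nth ord0 lam i)%:R :> R.
  by rewrite ler_nat; apply: state_nth st _; rewrite (ltnW ij).
rewrite /ell -addrA -mulrDl -natrD.
rewrite (_ : (N - j.+1 + (j - i) = N - i.+1)%N) ?lerD2r//; lia.
Qed.

Lemma particle_spaced theta (N M : nat) (lam : N.-tuple 'I_M.+1) : (0 < N)%N ->
  lam \in state N M -> spaced N (theta / N%:R) (particle theta lam).
Proof.
move=> N0 st i j ij; rewrite /particle mulrA -mulrDl ler_wpM2r ?invr_ge0//.
exact: ell_spaced.
Qed.

Lemma particle_bounds theta (N M : nat) (lam : N.-tuple 'I_M.+1) i : (0 < N)%N -> 0 < theta ->
  0 <= particle theta lam i /\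
  particle theta lam i + theta / N%:R <= M%:R / N%:R + theta.
Proof.
move=> N0 th0; have n0 : 0 < N%:R :> R by rewrite ltr0n.
rewrite /particle /ell; split.
  by rewrite mulr_ge0 ?invr_ge0// addr_ge0// mulr_ge0// ltW.
rewrite -mulrDl ler_pdivrMr// mulrDl divfK ?gt_eqF// -addrA lerD//.
  by rewrite ler_nat -ltnS.
rewrite -[X in _ + X]mul1r -mulrDl mulrC ler_wpM2l ?(ltW th0)// natr1 ler_nat.
by case: N N0 lam n0 => // N _ _ _; rewrite subSS ltnS leq_subr.
Qed.

(** Consecutive quantiles are at least theta / N apart, so the floors of N e_(i+1) minus
    the shift (N - 1 - i) theta decrease and lie between 0 and M. *)
Lemma discretize theta (N M : nat) e : (0 < N)%N -> 0 < theta ->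
  e 1%N + theta / N%:R <= M%:R / N%:R + theta -> e N = 0 ->
  (forall k, e k.+1 + theta / N%:R <= e k) ->
  exists2 lam : N.-tuple 'I_M.+1, lam \in state N M &
    forall i, (i < N)%N -> e i.+1 - N%:R^-1 <= particle theta lam i <= e i.+1.
Proof.
move=> N0 th0 e1 eN st; have n0 : 0 < N%:R :> R by rewrite ltr0n.
have nn : N%:R != 0 :> R by rewrite gt_eqF.
have est := spaced_of_step st.
pose r i := N%:R * e i.+1 - (N - i.+1)%:R * theta.
have r0 i : (i < N)%N -> 0 <= r i.
  move=> iN; have := ler_wpM2l (ltW n0) (est i.+1 N iN); rewrite eN add0r.
  by rewrite mulrCA (mulrC N%:R) divfK// /r subr_ge0.
have rM i : (i < N)%N -> r i <= M%:R.
  move=> iN; have h := est 1%N i.+1 isT; rewrite subSS subn0 in h.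
  have h2 : e i.+1 + i.+1%:R * (theta / N%:R) <= M%:R / N%:R + theta.
    by rewrite -natr1 mulrDl mul1r; move: h e1; move: (i%:R * _) => z; clear; lra.
  have := ler_wpM2l (ltW n0) h2; rewrite !mulrDr (mulrC N%:R (M%:R / _)) divfK//.
  rewrite (mulrCA N%:R i.+1%:R) (mulrC N%:R (theta / _)) divfK// /r natrB//.
  by move: (i.+1%:R : R) => z; clear; lra.
have rmono i j : (i <= j < N)%N -> r j <= r i.
  move=> /andP[ij jN]; have iN := leq_ltn_trans ij jN.
  have := ler_wpM2l (ltW n0) (est i.+1 j.+1 ij); rewrite subSS mulrDr.
  rewrite (mulrCA N%:R (j - i)%:R) (mulrC N%:R (theta / _)) divfK// /r !natrB//.
  by rewrite -(natr1 i) -(natr1 j); clear; lra.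
pose lam : N.-tuple 'I_M.+1 := [tuple inord (Num.truncn (r i)) | i < N].
have lamE i : (i < N)%N -> (nth ord0 lam i : nat) = Num.truncn (r i).
  move=> iN; have := nth_mktuple (fun i : 'I_N => inord (Num.truncn (r i)) : 'I_M.+1) ord0 (Ordinal iN).
  move=> -> /=; rewrite inordK// ltnS.
  by rewrite -(@ler_nat R); apply: le_trans (rM i iN); rewrite truncn_le// r0.
exists lam.
  rewrite inE; apply/(sortedP ord0) => i; rewrite size_tuple => iN.
  rewrite !lamE ?(ltnW iN)//; apply: le_truncn; apply: rmono.
  by rewrite leqnSn iN.
move=> i iN; rewrite /particle /ell lamE//.
have /andP[t1 t2] := truncn_itv (r0 i iN).
rewrite ler_pdivlMr// ler_pdivrMr// mulrBl mulVf//; move: t1 t2.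
move: (Num.truncn (r i)) => k; rewrite -natr1 /r (mulrC N%:R (e i.+1)).
move: (k%:R : R) ((N - i.+1)%:R * theta) (e i.+1 * _) => z q p; clear => t1 t2.
by apply/andP; split; lra.
Qed.

(** The lattice configuration that follows the quantiles of the equilibrium density, after
    the mass of the latter has been moved into the interval that the particles can fill. *)
Lemma configuration_energy_ge (N M m : nat) theta s K A B V phi :
  (0 < N)%N -> 0 < theta -> theta <= s -> s <= K -> M%:R / N%:R + theta <= K -> 0 < B ->
  regular_potential s A B V -> adm theta s phi -> 1 <= m%:R * theta ->
  exists2 lam : N.-tuple 'I_M.+1, lam \in state N M &
  - (N%:R ^+ 2 * adm_energy theta s V phi)
  - (theta * (2 * N%:R * (M%:R / N%:R + theta + 1) + N%:R * (ln N%:R + `|ln theta|)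
     + 2 * theta^-1 * (N%:R * (1 + ln N%:R)))
     + N%:R * (m.+1%:R * growth_bound B s)
     + N%:R ^+ 2 * ((A + 2 * potbound K) *
        (2 * (theta^-1 * Num.max 0 (s - (M%:R / N%:R + theta)))))) <=
  2 * theta * pair_sum N (fun i j => ln (particle theta lam i - particle theta lam j)) -
    N%:R * \sum_(0 <= i < N) V (clamp s (particle theta lam i)).
Proof.
move=> N0 th0 ths sK bK B0 rV aphi hm; have n0 : 0 < N%:R :> R by rewrite ltr0n.
set b := M%:R / N%:R + theta in bK *.
have thb : theta <= b by rewrite /b lerDr divr_ge0.
have b0 : 0 < b by exact: lt_le_trans thb.
have s0 : 0 < s by exact: lt_le_trans ths.
have K0 : 0 < K by exact: lt_le_trans sK.
have [f af df] := redistribute th0 thb aphi.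
have [e [e0 e1 eN st ms]] := quantiles N0 th0 (ltW b0) af.
have [lam lamst xe] := discretize N0 th0 e1 eN st.
exists lam => //; have sp := particle_spaced theta N0 lamst.
have E1 := cells_energy_le N0 th0 (ltW b0) af e0 eN st ms xe sp b0.
have E2 := cells_potential_le N0 th0 (ltW b0) af e0 eN st ms xe s0 B0 rV hm.
have bf := adm_bcs bK af; have bphi := adm_bcs sK aphi.
have P0 : 0 <= theta^-1 * potbound K by rewrite mulr_ge0 ?invr_ge0 ?potbound_ge0// ltW.
have E3 := le_trans (logE_difference K0 bf bphi bf) (ler_wpM2r P0 df).
have E4 := le_trans (logE_difference K0 bf bphi bphi) (ler_wpM2r P0 df).
rewrite (logE_sym K0 bf bphi) in E4.
have A0 : 0 <= A.
  by have [_ VA _ _] := rV; apply: le_trans (VA 0 _); rewrite ?normr_ge0// lexx ltW.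
have E5 := le_trans (V_difference (ltW s0) rV bf bphi) (ler_wpM2l A0 df).
have -> : adm_energy theta s V phi = - theta * logE phi phi +
  \int[mu]_y (V (clamp s y) * phi y) by [].
move: E5 E4 E3 E2 E1.
move: (\int[mu]_y (V (clamp s y) * f y)) (\int[mu]_y (V (clamp s y) * phi y)) => vf vphi.
move: (logE f f) (logE phi phi) (logE phi f) (pair_sum _ _) => e2 e3 e4 P.
move: (\sum_(_ <= _ < _) _) => sV.
set tD := theta^-1 * Num.max 0 _; set p := potbound K.
have tti : theta * theta^-1 = 1 by rewrite mulfV// gt_eqF.
rewrite !ler_norml => /andP[_ f1] /andP[f2 _] /andP[f3 _] f4 f5.
have k1 : theta * e3 - vphi - (A + 2 * p) * (2 * tD) <= theta * e2 - vf.
  have := ler_wpM2l (ltW th0) (lerD f2 f3).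
  rewrite (_ : theta * (- (2 * tD * (theta^-1 * p)) - (2 * tD * (theta^-1 * p)))
    = - ((theta * theta^-1) * (4 * tD * p))); last by ring.
  by rewrite tti; move: f1; clear; lra.
have n2 : 0 <= (N%:R : R) ^+ 2 by rewrite exprn_ge0// ltW.
have := ler_wpM2l n2 k1; have := ler_wpM2l (ltW th0) f5; have := ler_wpM2l (ltW n0) f4.
move: (_ + 2 * theta^-1 * _) => X; move: (_ * growth_bound _ _) => G.
move: (N%:R : R) => n; clear.
have -> : n * (n * vf + G) = n ^+ 2 * vf + n * G by ring.
move: (n ^+ 2) => n2; move: ((A + 2 * p) * _) => Y; lra.
Qed.

End LowerBound.

(** * Test functions, and the logarithm of the weight *)

Section Ingredients.
Context {R : realType}.
Implicit Types (f g h nu phi psi V : R -> R) (theta s b K L w y t a c d A B gamma : R).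
Notation mu := (@lebesgue_measure R).

(** The constant in the duality inequality is free; its optimal value turns a lower bound
    on the integral of g against nu into a bound on the energy of nu. *)
Lemma duality_energy_le K B B' L g nu gamma : 0 < K -> bcs K B g -> 0 <= L ->
  (forall x x', `|g x - g x'| <= L * `|x - x'|) -> (exists x, g x != 0) ->
  bcs K B' nu -> \int[mu]_x nu x = 0 -> 0 < gamma ->
  gamma * norm_half g <= `|\int[mu]_x (g x * nu x)| ->
  logE nu nu <= - (2 * pi ^+ 2 * gamma ^+ 2).
Proof.
move=> K0 bg L0 gL g0 bnu nu0 gam0 big.
have nh0 := norm_half_gt0 K0 bg L0 gL g0; have nh2 := norm_half_sqr K0 bg L0 gL.
have LA := half_energy_L1 K0 bg L0 gL.
set E := logE nu nu; set A := half_energy g in nh2; set X := \int[mu]_x (g x * nu x) in big.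
have A0 : 0 < A.
  by have := exprn_gt0 2 nh0; rewrite nh2; clear; lra.
have LX : L1 (fun x => g x * nu x) by have [mg gB _] := bg; apply: (L1M mg gB); exact: bcs_L1 bnu.
have dual c : 0 < c -> 2 * pi * `|X| <= c * A - E / c.
  move=> c0; have h1 := fourier_duality K0 bg L0 gL bnu nu0 LA c0.
  rewrite -/E -/X in h1.
  have [x0|x0] := leP 0 X; first by rewrite (ger0_norm x0).
  have bnu' := bcsZ (-1) bnu; have Lnu := bcs_L1 bnu.
  have nu'0 : \int[mu]_x (-1 * nu x) = 0 by rewrite intRZ// nu0 mulr0.
  have h2 := fourier_duality K0 bg L0 gL bnu' nu'0 LA c0.
  rewrite (logEZl _ K0 bnu bnu') (logEZr _ K0 bnu bnu) mulrA mulrNN !mul1r -/E in h2.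
  rewrite (eq_intR (g := fun x => -1 * (g x * nu x))) in h2; last by move=> x; ring.
  by rewrite intRZ// mulN1r -/X in h2; rewrite (ltr0_norm x0).
have X0 : 0 < `|X| by apply: lt_le_trans big; rewrite mulr_gt0.
have p0 : 0 < pi :> R := pi_gt0 R.
pose Y : R := `|X|; rewrite -/Y in big dual X0.
(* The optimal constant is a square root of - E / A; this one gives the same bound
   without the root. *)
have c0 : 0 < pi * Y / A by rewrite divr_gt0// mulr_gt0.
have := dual _ c0.
have -> : pi * Y / A * A - E / (pi * Y / A) = pi * Y - E * A / (pi * Y).
  by rewrite divfK ?(gt_eqF A0)// invf_div mulrA.
move=> h.
have h1 : pi * Y <= - (E * A) / (pi * Y) by rewrite mulNr; move: h; clear; lra.
have pY0 : 0 < pi * Y by rewrite mulr_gt0.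
have h2 : (pi * Y) * (pi * Y) <= - (E * A) by rewrite -ler_pdivlMr.
have h3 : (gamma * norm_half g) * (gamma * norm_half g) <= Y * Y.
  by apply: ler_pM => //; rewrite mulr_ge0// ltW.
have h4 : gamma ^+ 2 * (2 * A) <= Y * Y by rewrite -nh2; move: h3; rewrite !expr2 mulrACA.
have h5 := ler_wpM2l (ltW (exprn_gt0 2 p0)) h4.
have h6 : (2 * pi ^+ 2 * gamma ^+ 2) * A <= (- E) * A.
  move: h2 h5; have -> : pi * Y * (pi * Y) = pi ^+ 2 * (Y * Y) by ring.
  by move: (pi ^+ 2) (gamma ^+ 2) (Y * Y); clear => P G Z; lra.
by rewrite lerNr; move: h6; rewrite ler_pM2r.
Qed.

Lemma lipschitz_norm_lip g : lipschitz g ->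
  0 <= norm_lip g /\ forall x y, `|g x - g y| <= norm_lip g * `|x - y|.
Proof.
move=> [M [_ hM]].
have gM x y : `|g x - g y| <= (M + 1) * `|x - y|.
  have lt : M < M + 1 by rewrite ltrDl.
  by have := hM _ lt (x, y); apply.
pose S := [set `|(g z.1 - g z.2) / (z.1 - z.2)| | z in [set z : R * R | z.1 != z.2]].
have ubS : ubound S (M + 1).
  move=> _ [[x y] /= xy <-]; rewrite normrM normfV ler_pdivrMr; first exact: gM.
  by rewrite normr_gt0 subr_eq0.
have hS : has_ubound S by exists (M + 1).
have inS x y : x != y -> `|(g x - g y) / (x - y)| <= norm_lip g.
  by move=> xy; apply: ub_le_sup => //; exists (x, y).
split; first by apply: le_trans (inS 0 1 _); rewrite ?normr_ge0// eq_sym oner_eq0.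
move=> x y; have [->|xy] := eqVneq x y; first by rewrite !subrr normr0 mulr0.
by have := inS x y xy; rewrite normrM normfV ler_pdivrMr// normr_gt0 subr_eq0.
Qed.

Lemma compactly_supported_bcs g : compactly_supported g -> lipschitz g ->
  forall K0 : R, exists K, [/\ K0 <= K, 0 < K & exists B, bcs K B g].
Proof.
move=> cg lg K0; have [L0 gL] := lipschitz_norm_lip lg.
have [M [_ hM]] := compact_bounded cg.
pose K := Num.max (Num.max 1 K0) (M + 1).
have K1 : 1 <= K by rewrite /K !le_max lexx.
have MK : M < K by rewrite /K lt_max ltrDl ltr01 orbT.
have out x : K < `|x| -> g x = 0.
  move=> Kx; apply/eqP; apply: contraT => gx.
  have := hM _ MK x; move=> /(_ (subset_closure _)) h.
  by have := h gx; rewrite /= leNgt Kx.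
exists K; split; first by rewrite /K !le_max lexx orbT.
  exact: lt_le_trans ltr01 K1.
exists (norm_lip g * (2 * K + 1)); split => //.
  by apply: continuous_measurable_fun; exact: continuous_lip gL.
move=> x; have [xK|/out ->] := leP `|x| K; last first.
  by rewrite normr0 mulr_ge0//; move: K1; clear; lra.
have e : g (K + 1) = 0 by apply: out; rewrite ger0_norm; move: K1; clear; lra.
have := gL x (K + 1); rewrite e subr0 => h; apply: le_trans h _.
rewrite ler_wpM2l// ler_norml; move: xK; rewrite ler_norml => /andP[h1 h2].
by apply/andP; split; move: h1 h2 K1; clear; lra.
Qed.

Lemma integral_empirical theta (N M : nat) (lam : N.-tuple 'I_M.+1) g :
  measurable_fun setT g ->
  \int[empirical_measure theta lam]_x g x =
  N%:R^-1 * \sum_(0 <= i < N) g (particle theta lam i).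
Proof.
move=> mg; have ge0_case (h : R -> R) : measurable_fun setT h -> (forall x, 0 <= h x) ->
    (\int[empirical_measure theta lam]_x (h x)%:E)%E =
    (N%:R^-1 * \sum_(0 <= i < N) h (particle theta lam i))%:E.
  move=> mh h0; have mh' : measurable_fun setT (EFin \o h) by exact/measurable_EFinP.
  rewrite /empirical_measure ge0_integral_mscale//; last by move=> x _; rewrite /= lee_fin.
  rewrite ge0_integral_measure_sum//; last by move=> x _; rewrite /= lee_fin.
  rewrite EFinM; congr (_ * _)%E; rewrite big_mkord -sumEFin; apply: eq_bigr => i _.
  by rewrite integral_dirac// diracT mul1e.
rewrite /Rintegral integralE.
have -> : (fun x => (EFin \o g)^\+ x)%E = (fun x => (Num.max (g x) 0)%:E).
  by apply/funext => x; rewrite funeposE /= EFin_max.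
have -> : (fun x => (EFin \o g)^\- x)%E = (fun x => (Num.max (- g x) 0)%:E).
  by apply/funext => x; rewrite funenegE /= EFin_max.
rewrite !ge0_case; [|by apply: measurable_maxr => //; exact: measurable_funN|..]; last first.
- by move=> x; rewrite le_max lexx orbT.
- exact: measurable_maxr.
- by move=> x; rewrite le_max lexx orbT.
rewrite -EFinB /= -mulrBr; congr (_ * _); rewrite -sumrB; apply: eq_bigr => i _.
by move: (g _) => z; case: (leP 0 z) => h; rewrite /Num.max; case: ltP; case: ltP; lra.
Qed.

Definition log_weight theta (N M : nat) (VN : R -> R) (lam : N.-tuple 'I_M.+1) : R :=
  pair_sum N (fun i j => ln (Q theta (ell theta lam i - ell theta lam j))) -
  N%:R * \sum_(0 <= i < N) VN (particle theta lam i).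

Lemma ell_gap theta (N M : nat) (lam : N.-tuple 'I_M.+1) i j : lam \in state N M -> 0 < theta ->
  (i < j < N)%N -> (j - i)%:R * theta <= ell theta lam i - ell theta lam j /\
  theta <= ell theta lam i - ell theta lam j.
Proof.
move=> st th0 ij; have h := ell_spaced theta st ij; have /andP[lij _] := ij.
have k1 : 1 <= (j - i)%:R :> R by rewrite ler1n subn_gt0.
have := ler_wpM2r (ltW th0) k1; rewrite mul1r; move: h.
by move: (_ * theta) => z; clear => h1 h2; split; lra.
Qed.

Lemma weightE theta (N M : nat) VN (lam : N.-tuple 'I_M.+1) : 0 < theta ->
  lam \in state N M -> weight theta VN lam = expR (log_weight theta VN lam).
Proof.
move=> th0 st; rewrite /weight /log_weight expRD; congr (_ * _); last first.
  rewrite -mulrN -sumrN mulr_sumr expR_sum; apply: eq_bigr => i _.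
  by rewrite mulrN.
rewrite /pair_sum expR_sum !big_nat; apply: eq_bigr => i /andP[_ iN].
rewrite expR_sum !big_nat; apply: eq_bigr => j ij.
have [_ h] := ell_gap st th0 ij; have [Q0 _] := Q_bounds th0 h.
by rewrite lnK.
Qed.

(** The logarithm of the weight of a log-gas with the potential extended by constants. *)
Definition coulomb theta (N : nat) V s (x : nat -> R) :=
  2 * theta * pair_sum N (fun i j => ln (x i - x j)) - N%:R * \sum_(0 <= i < N) V (clamp s (x i)).

(** Q theta x is x ^ (2 theta) up to a factor exp (O (1 / x)), and the distances are at
    least (j - i) theta. The powers of N that appear on rescaling are the same for all
    configurations, so they will cancel in the normalization. *)
Lemma log_weight_coulomb theta (N M : nat) VN V s e (lam : N.-tuple 'I_M.+1) : (0 < N)%N ->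
  0 < theta -> lam \in state N M ->
  (forall i, `|VN (particle theta lam i) - V (clamp s (particle theta lam i))| <= e) ->
  `|log_weight theta VN lam - (pair_sum N (fun _ _ => 2 * theta * ln N%:R) +
     coulomb theta N V s (particle theta lam))| <=
  Qconst theta * theta^-1 * (N%:R * (1 + ln N%:R)) + N%:R ^+ 2 * e.
Proof.
move=> N0 th0 st hV; have n0 : 0 < N%:R :> R by rewrite ltr0n.
rewrite /log_weight /coulomb; set x := particle theta lam in hV *.
have Qc0 : 0 <= Qconst theta.
  have t0 := ltW th0.
  rewrite /Qconst addr_ge0// mulr_ge0// ?addr_ge0// ?exprn_ge0// ?addr_ge0//.
have gap i j : (i < j < N)%N ->
    `|ln (Q theta (ell theta lam i - ell theta lam j)) - (2 * theta * ln N%:R + 2 * theta * ln (x i - x j))| <=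
    Qconst theta * theta^-1 * (j - i)%:R^-1.
  move=> ij; have [h1 h2] := ell_gap st th0 ij.
  set X := ell theta lam i - ell theta lam j in h1 h2 *.
  have [Q0 hQ] := Q_bounds th0 h2; have X0 : 0 < X by exact: lt_le_trans h2.
  have /andP[lij _] := ij.
  have k0 : 0 < (j - i)%:R :> R by rewrite ltr0n subn_gt0.
  have xE : x i - x j = X / N%:R by rewrite /x /particle /X mulrBl.
  have -> : 2 * theta * ln N%:R + 2 * theta * ln (x i - x j) = 2 * theta * ln X.
    by rewrite -mulrDr xE ln_div ?posrE// addrC subrK.
  apply: le_trans hQ _; rewrite -mulrA ler_wpM2l// -invfM lef_pV2 ?posrE ?mulr_gt0//.
  by rewrite mulrC.
have up : pair_sum N (fun i j => ln (Q theta (ell theta lam i - ell theta lam j))) <=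
    pair_sum N (fun i j => 2 * theta * ln N%:R + 2 * theta * ln (x i - x j) +
      Qconst theta * theta^-1 * (j - i)%:R^-1).
  by apply: le_pair_sum => i j /gap; rewrite ler_norml => /andP[_]; clear; lra.
have lo : pair_sum N (fun i j => 2 * theta * ln N%:R + 2 * theta * ln (x i - x j)) <=
    pair_sum N (fun i j => ln (Q theta (ell theta lam i - ell theta lam j)) +
      Qconst theta * theta^-1 * (j - i)%:R^-1).
  by apply: le_pair_sum => i j /gap; rewrite ler_norml => /andP[+ _]; clear; lra.
rewrite !pair_sumD !pair_sumZ in up lo.
have c0 : 0 <= Qconst theta * theta^-1 by rewrite mulr_ge0// invr_ge0 ltW.
have hinv := ler_wpM2l c0 (@pair_sum_inv R N N0).
have hs : `|N%:R * \sum_(0 <= i < N) VN (x i) - N%:R * \sum_(0 <= i < N) V (clamp s (x i))|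
    <= N%:R ^+ 2 * e.
  rewrite -mulrBr -sumrB normrM (ger0_norm (ltW n0)) expr2 -mulrA ler_wpM2l ?(ltW n0)//.
  apply: le_trans (ler_norm_sum _ _ _) _; apply: le_trans (ler_sum _ (fun i _ => hV i)) _.
  by rewrite sumr_const_nat subn0 -(mulr_natl e).
move: hs up lo hinv.
rewrite (_ : pair_sum N (fun _ _ => 2 * theta * ln N%:R) =
  2 * theta * pair_sum N (fun _ _ => ln N%:R)); last by rewrite pair_sumZ.
move: (pair_sum N (fun i j => ln (Q _ _))) (pair_sum N (fun _ _ => ln N%:R)) => a1 a2.
move: (pair_sum N (fun i j => ln (x i - x j))) (pair_sum N (fun i j => (j - i)%:R^-1)) => a3 a4.
move: (N%:R * \sum_(0 <= i < N) VN (x i)) (N%:R * \sum_(0 <= i < N) V (clamp s (x i))) (N%:R ^+ 2 * e).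
move=> b1 b2 b3.
move: (Qconst theta * theta^-1 * (_ * _)) (Qconst theta * theta^-1 * a4) => c1 c2; clear.
by rewrite !ler_norml => /andP[h1 h2] h3 h4 h5; apply/andP; split; lra.
Qed.

End Ingredients.

(** * The deviation inequality *)

Section Tail.
Context {R : realType}.
Implicit Types (f g h nu phi psi V : R -> R) (theta s b K w y t a c d A B gamma p q n l : R).
Notation mu := (@lebesgue_measure R).

(** The normalization is at least the weight of one state, and there are at most
    (M + 1) ^ N states. *)
Lemma gibbs_tail theta (N M : nat) VN (E : pred (N.-tuple 'I_M.+1)) lam0 (lo hi : R) :
  0 < theta -> lam0 \in state N M -> lo <= log_weight theta VN lam0 ->
  (forall lam, lam \in state N M -> E lam -> log_weight theta VN lam <= hi) ->
  PN theta VN E <= expR (hi - lo + N%:R * ln M.+1%:R).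
Proof.
move=> th0 st0 hlo hhi; have w0 lam : lam \in state N M -> 0 <= weight theta VN lam.
  by move=> st; rewrite weightE// expR_ge0.
have Zlo : expR lo <= partition_function theta N M VN.
  rewrite /partition_function (bigD1 lam0)//=.
  apply: le_trans (_ : weight theta VN lam0 <= _).
    by rewrite weightE// ler_expR.
  by rewrite lerDl; apply: sumr_ge0 => lam /andP[st _]; exact: w0.
have Z0 : 0 < partition_function theta N M VN by apply: lt_le_trans Zlo; exact: expR_gt0.
rewrite /PN; apply: le_trans (_ : \sum_(lam in state N M | E lam) expR (hi - lo) <= _).
  apply: ler_sum => lam /andP[st El]; rewrite weightE// expRB mulrC.
  apply: ler_pM; rewrite ?expR_ge0 ?invr_ge0 ?(ltW Z0)//.
    by rewrite ler_expR; exact: hhi.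
  by rewrite lef_pV2 ?posrE ?expR_gt0.
apply: le_trans (_ : \sum_(lam : N.-tuple 'I_M.+1) expR (hi - lo) <= _).
  rewrite big_mkcond/=; apply: ler_sum => lam _; case: ifP => // _; exact: expR_ge0.
rewrite sumr_const -(mulr_natl (expR _)) (expRD (hi - lo)) [X in _ <= X]mulrC ler_wpM2r ?expR_ge0//.
rewrite card_tuple card_ord expRM_natl lnK ?posrE ?ltr0n//.
by rewrite -natrX.
Qed.

Lemma growth_bound_le A s K : 0 <= A -> 0 <= s -> s <= K -> growth_bound A s <= growth_bound A K.
Proof.
move=> A0 s0 sK; rewrite /growth_bound; apply: ler_wpM2l => //.
apply: lerD; first by apply: ler_pM => //; [exact: addr_ge0|rewrite lerD2l].
by apply: ler_wpM2l => //; rewrite ler_wsqrtr.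
Qed.

(** At the scale theta / N ^ p the Lipschitz loss w * norm_lip g is the second term of the
    deviation, while ln w is only of order ln N. *)
Lemma smearing_scale theta p (N : nat) : 0 < theta -> 2 <= p -> (2 <= N)%N ->
  let w := theta / N%:R `^ p in
  [/\ 0 < w, 2 * w <= theta / N%:R & ln w = ln theta - p * ln N%:R].
Proof.
move=> th0 p2 N2 w; have N1 : 1 <= N%:R :> R by rewrite ler1n ltnW.
have n0 : 0 < N%:R :> R by exact: lt_le_trans ltr01 N1.
have P0 : 0 < N%:R `^ p by rewrite powR_gt0.
split; first by rewrite divr_gt0.
  rewrite /w mulrA (mulrC 2) -mulrA ler_wpM2l ?(ltW th0)// ler_pdivrMr// mulrC ler_pdivlMr//.
  apply: le_trans (_ : N%:R `^ 2%:R <= _); last by rewrite ler_powR.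
  by rewrite powR_mulrn ?(ltW n0)// expr2 ler_wpM2r ?(ltW n0)// ler_nat.
by rewrite /w ln_div ?posrE// ln_powR.
Qed.

(** On the event, g separates the smeared configuration from the equilibrium measure by at
    least gamma times the half-norm, so by duality the energy of the difference is at most
    - 2 pi^2 gamma^2. *)
Lemma coulomb_event_le (N M : nat) theta s K w A B V phi g gamma (lam : N.-tuple 'I_M.+1) :
  (0 < N)%N -> 0 < theta -> theta <= s -> s <= K -> M%:R / N%:R + theta <= K -> 0 < B ->
  regular_potential s A B V -> adm theta s phi ->
  (forall h, adm theta s h -> adm_energy theta s V phi <= adm_energy theta s V h) ->
  compactly_supported g -> lipschitz g -> (exists x, g x != 0) -> 0 < gamma ->
  0 < w -> 2 * w <= theta / N%:R -> lam \in state N M ->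
  gamma * norm_half g + norm_lip g * w <=
    `|\int[empirical_measure theta lam]_x g x - \int[mu]_x (g x * phi x)| ->
  coulomb theta N V s (particle theta lam) <=
  - (2 * pi ^+ 2 * gamma ^+ 2 * theta * N%:R ^+ 2)
  - N%:R ^+ 2 * adm_energy theta s V phi
  + (2 * theta * (N%:R * (1 + ln N%:R)) + theta * (N%:R * (8 - ln w))
     + N%:R * growth_bound B s
     + 4 * theta * (N%:R ^+ 2 * modulus_bound theta K (theta / N%:R))
     + N%:R ^+ 2 * ((A + 2 * potbound K) *
         (2 * (theta^-1 * Num.max 0 (M%:R / N%:R + theta - s))))).
Proof.
move=> N0 th0 ths sK bK B0 rV aphi phimin cg lg g0 gam0 w0 w2d lamst event.
have n0 : 0 < N%:R :> R by rewrite ltr0n.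
have sp := particle_spaced theta N0 lamst; set x := particle theta lam in sp *.
have x0 i : 0 <= x i by have [] := particle_bounds lam i N0 th0.
have xb i : x i + theta / N%:R <= M%:R / N%:R + theta by have [] := particle_bounds lam i N0 th0.
have := configuration_energy_le N0 th0 ths sK bK B0 rV aphi phimin x0 xb sp w0 w2d.
rewrite -/(coulomb theta N V s x); set err := (_ + _ * (_ * (_ * _))).
move=> hU; apply: le_trans hU _; rewrite lerD2r lerD2r.
have [L0 gL] := lipschitz_norm_lip lg.
have [K' [KK' K'0 [Bg bg]]] := compactly_supported_bcs cg lg K.
have wd : w <= theta / N%:R by move: w0 w2d; clear; lra.
have xK i : x i + theta / N%:R <= K' by exact: le_trans (xb i) (le_trans bK KK').
have bS := bcs_smear N0 w0 wd x0 xK sp.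
have bphi : bcs K' theta^-1 phi := adm_bcs (le_trans sK KK') aphi.
have bnu := bcsB bS bphi; have [_ _ _ phi1] := aphi; have [mg gB _] := bg.
have nu0 : \int[mu]_y (smear N w x y - phi y) = 0.
  rewrite (intRB (bcs_L1 bS) (bcs_L1 bphi)) phi1.
  by rewrite (intR_smear N0 w0 wd x0 xK) subrr.
have avg := smear_lipschitz N0 w0 wd x0 xK L0 mg gL.
have Lgs : L1 (fun y => g y * smear N w x y) by exact: L1M mg gB (bcs_L1 bS).
have Lgp : L1 (fun y => g y * phi y) by exact: L1M mg gB (bcs_L1 bphi).
have gnu : \int[mu]_y (g y * (smear N w x y - phi y)) =
    \int[mu]_y (smear N w x y * g y) - \int[mu]_y (g y * phi y).
  rewrite (eq_intR (g := fun y => g y * smear N w x y - g y * phi y)); last by move=> y; ring.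
  by rewrite (intRB Lgs Lgp); congr (_ - _); apply: eq_intR => y; rewrite mulrC.
have := @duality_energy_le _ _ _ _ _ _ _ gamma K'0 bg L0 gL g0 bnu nu0 gam0.
rewrite gnu => hE; rewrite integral_empirical// -/x in event.
have : gamma * norm_half g <=
    `|\int[mu]_y (smear N w x y * g y) - \int[mu]_y (g y * phi y)|.
  move: event avg; move: (\int[mu]_y (smear N w x y * g y)) (\int[mu]_y (g y * phi y)) => a c.
  move: (_^-1 * _) (gamma * _) (_ * w) => d G W; clear => h1 h2.
  have := ler_normD (d - a) (a - c); rewrite [d - a + _]addrA subrK (distrC d a).
  by move: h1 h2; move: `|_| `|_| `|_| => u v z; lra.
move=> /hE h; have tn : 0 <= theta * N%:R ^+ 2 by rewrite mulr_ge0 ?exprn_ge0 ?ltW.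
have := ler_wpM2l tn h; clear; lra.
Qed.

(** The constants are kept explicit because they must not depend on n, on q or on the
    potential. *)
Lemma upper_error_le theta p K q n l (T X D lK : R) : 0 < theta -> 0 < n -> 0 <= l -> 0 <= q ->
  0 <= X -> D <= q -> lK = ln (3 * K / theta) -> 0 < K -> l = ln n ->
  2 * theta * (n * (1 + l)) + theta * (n * (8 - (ln theta - p * l))) + n * T
     + 4 * theta * (n ^+ 2 * modulus_bound theta K (theta / n))
     + n ^+ 2 * (X * D) <=
  n * (2 * theta + theta * (8 + `|ln theta|) + T + 4 * theta * (24 + 4 * `|lK|))
  + n * l * (2 * theta + theta * p + 16 * theta) + X * (n ^+ 2 * q).
Proof.
move=> th0 n0 l0 q0 X0 Dq lKE K0 lE.
have e1 : n ^+ 2 * modulus_bound theta K (theta / n) = n * (24 + 4 * (lK + l)).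
  have -> : lK + l = ln (3 * K / (theta / n)).
    rewrite lKE lE -lnM ?posrE ?divr_gt0 ?mulr_gt0//; congr ln.
    by rewrite invf_div mulrA mulrAC.
  rewrite /modulus_bound; move: (ln _) => z; field.
  by rewrite !gt_eqF.
rewrite e1.
have h1 : n * lK <= n * `|lK| by rewrite ler_wpM2l ?(ltW n0)// ler_norm.
have h2 : n * (- ln theta) <= n * `|ln theta|.
  by rewrite ler_wpM2l ?(ltW n0)// -normrN ler_norm.
have h3 : n ^+ 2 * (X * D) <= X * (n ^+ 2 * q).
  by rewrite mulrCA ler_wpM2l// ler_wpM2l// exprn_ge0// ltW.
have h4 := ler_wpM2l (ltW th0) h1; have h5 := ler_wpM2l (ltW th0) h2.
move: h3 h4 h5; move: (ln theta) `|ln theta| `|lK| (n ^+ 2 * (X * D)) (X * (n ^+ 2 * q)).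
clear => a b c d e h3 h4 h5; lra.
Qed.

Lemma lower_error_le theta K b q n l (T T' X D m1 : R) : 0 < theta -> 0 < n -> 0 <= l -> 0 <= q ->
  0 <= X -> D <= q -> b <= K -> 0 <= m1 ->
  theta * (2 * n * (b + 1) + n * (l + `|ln theta|) + 2 * theta^-1 * (n * (1 + l)))
     + n * (m1 * T) + n ^+ 2 * (X * D) <=
  n * (theta * (2 * (K + 1) + `|ln theta|) + 2 + m1 * T)
  + n * l * (theta + 2) + X * (n ^+ 2 * q).
Proof.
move=> th0 n0 l0 q0 X0 Dq bK m0.
have -> : theta * (2 * n * (b + 1) + n * (l + `|ln theta|) + 2 * theta^-1 * (n * (1 + l))) =
  n * theta * 2 * (b + 1) + n * theta * (l + `|ln theta|) + 2 * (n * (1 + l)).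
  by field; rewrite gt_eqF.
have h1 : n * theta * b <= n * theta * K by rewrite ler_wpM2l// mulr_ge0// ltW.
have h3 : n ^+ 2 * (X * D) <= X * (n ^+ 2 * q).
  by rewrite mulrCA ler_wpM2l// ler_wpM2l// exprn_ge0// ltW.
move: h1 h3; move: (n ^+ 2 * (X * D)) (X * (n ^+ 2 * q)) `|ln theta| (m1 * T).
clear => a c d e h1 h3; lra.
Qed.

End Tail.

Lemma ln_states_le (R : realType) (N M : nat) (c : R) : (0 < N)%N -> M%:R / N%:R <= c ->
  ln M.+1%:R <= ln N%:R + ln (c + 1) :> R.
Proof.
move=> N0 Mc; have n0 : 0 < N%:R :> R by rewrite ltr0n.
have c0 : 0 <= c by apply: le_trans Mc; rewrite divr_ge0.
have c1 : 0 < c + 1 by rewrite ltr_wpDl.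
rewrite -lnM ?posrE// ler_ln ?posrE ?ltr0n ?mulr_gt0//.
move: Mc; rewrite ler_pdivrMr// -natr1 mulrDr mulr1 mulrC => h.
by apply: lerD => //; rewrite ler1n.
Qed.

Lemma combine_errors (R : realType) (n r P2 Q2 X A Qc cU dU cL dL cS c U L S : R) :
  0 <= r -> 0 <= P2 -> 0 <= Q2 -> 0 <= X -> 0 <= A -> 0 <= c -> 0 <= dU + dL + 2 * Qc + 1 ->
  U <= n * cU + r * dU + X * Q2 -> L <= n * cL + r * dL + X * Q2 -> S <= r + n * cS ->
  (cU + cL + 2 * Qc + cS) * n <= c * r ->
  U + L + 2 * (Qc * (n + r) + A * P2) + S <=
  (c + (dU + dL + 2 * Qc + 1) + 2 * X + 2 * A + 1) * (P2 + Q2 + r).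
Proof.
move=> r0 P0 Q0 X0 A0 c0; set d := dU + dL + 2 * Qc + 1 => d0 hU hL hS hc.
have h1 := mulr_ge0 d0 P0; have h2 := mulr_ge0 d0 Q0.
have h3 := mulr_ge0 X0 P0; have h4 := mulr_ge0 X0 r0.
have h5 := mulr_ge0 A0 Q0; have h6 := mulr_ge0 A0 r0.
have h7 := mulr_ge0 c0 P0; have h8 := mulr_ge0 c0 Q0.
have e : d * r = r * dU + r * dL + 2 * (Qc * r) + r by rewrite /d; ring.
move: e h1 h2 d0; move: d => d; move: hU hL hS hc h3 h4 h5 h6 h7 h8 r0 P0 Q0; clear; lra.
Qed.

Theorem proposition2p6 (R : realType) (p theta a0 A0 A1 A2 A3 A4 : R)
    (hp : 2 <= p) (htheta : 0 < theta) (ha0 : 0 < a0) (hA0 : a0 <= A0)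
    (hA1 : 0 < A1) (hA2 : 0 < A2) (hA3 : 0 < A3) (hA4 : 0 < A4) :
  exists2 C : R, 0 < C &
    forall (MM : R) (M_ : nat -> nat) (q_ : nat -> R)
      (V_ : nat -> R -> R) (V : R -> R) (p_ : nat -> R),
      assumption1 a0 A0 A1 MM M_ q_ ->
      assumption2 theta A2 A3 A4 MM M_ V_ V p_ ->
    forall phi : R -> R, equilibrium theta (MM + theta) V phi ->
    forall (gamma : R) (N : nat) (g : R -> R),
      0 < gamma -> (2 <= N)%N ->
      compactly_supported g -> lipschitz g -> (exists x : R, g x != 0) ->
      PN theta (V_ N) (fun lam : N.-tuple 'I_(M_ N).+1 =>
          `| \int[empirical_measure theta lam]_x g x
             - \int[@lebesgue_measure R]_(x in `[0, MM + theta])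
                 (g x * phi x) |
          >= gamma * norm_half g + theta * norm_lip g / (N%:R `^ p))
      <= expR (- (2 * pi ^+ 2 * gamma ^+ 2 * theta * N%:R ^+ 2)
               + C * (N%:R ^+ 2 * p_ N + N%:R ^+ 2 * q_ N
                      + N%:R * ln N%:R)).
Proof.
have A00 : 0 < A0 by exact: lt_le_trans hA0.
(* An upper bound for both ends of the supports, MM + theta and M_N / N + theta. *)
pose K := A0 + A1 + theta.
have K0 : 0 < K by rewrite /K !addr_gt0.
pose T := growth_bound A4 K.
(* The rounding error 1 / N is at most m spacings theta / N. *)
pose m := (Num.truncn theta^-1).+1.
pose X := (A3 + 2 * potbound K) * (2 * (theta^-1 * A1)).
pose Qc := Qconst theta * theta^-1.
pose lK := ln (3 * K / theta).
pose cS := ln (A0 + A1 + 1).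
pose c0 := (2 * theta + theta * (8 + `|ln theta|) + T + 4 * theta * (24 + 4 * `|lK|)) +
  (theta * (2 * (K + 1) + `|ln theta|) + 2 + m.+1%:R * T) + 2 * Qc + cS.
pose c1 := (2 * theta + theta * p + 16 * theta) + (theta + 2) + 2 * Qc + 1.
have p0 : 0 <= p by apply: le_trans hp.
have ti0 : 0 < theta^-1 by rewrite invr_gt0.
have T0 : 0 <= T by apply: (le_trans _ (growth_bound_le (ltW hA4) (lexx 0) (ltW K0))); rewrite /growth_bound !(mulr0, sqrtr0, addr0).
have Qc0 : 0 <= Qc.
  have t0 := ltW htheta; rewrite /Qc mulr_ge0 ?(ltW ti0)//.
  by rewrite /Qconst addr_ge0// mulr_ge0// ?addr_ge0// ?exprn_ge0// ?addr_ge0.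
have X0 : 0 <= X by rewrite /X !mulr_ge0 ?addr_ge0 ?mulr_ge0 ?potbound_ge0 ?ltW.
have cS0 : 0 <= cS by rewrite /cS ln_ge0// lerDr addr_ge0 ?ltW.
have c00 : 0 <= c0.
  have h1 : 0 <= theta * (8 + `|ln theta|) by rewrite mulr_ge0 ?(ltW htheta)// addr_ge0.
  have h2 : 0 <= 4 * theta * (24 + 4 * `|lK|) by rewrite !mulr_ge0 ?addr_ge0 ?mulr_ge0 ?(ltW htheta).
  have h3 : 0 <= theta * (2 * (K + 1) + `|ln theta|).
    by rewrite mulr_ge0 ?(ltW htheta)// addr_ge0// mulr_ge0// addr_ge0// ltW.
  have h4 : 0 <= m.+1%:R * T by rewrite mulr_ge0.
  rewrite /c0; move: h1 h2 h3 h4 htheta T0 Qc0 cS0.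
  move: (theta * (8 + _)) (4 * theta * _) (theta * (2 * _ + _)) (m.+1%:R * T) => a b c d.
  by clear; lra.
have c10 : 0 <= c1.
  have h : 0 <= theta * p by rewrite mulr_ge0// ltW.
  by rewrite /c1; move: h htheta Qc0; clear; lra.
have l2 : 0 < ln 2 :> R by rewrite ln_gt0// ltr1n.
exists (c0 / ln 2 + c1 + 2 * X + 2 * A2 + 1).
  have h := divr_ge0 c00 (ltW l2); move: h c10 X0 hA2.
  by move: (c0 / _) (c1) (X) => a b c; clear; lra.
move=> MM M_ q_ V_ V p_ [/andP[aMM MMA] hq hM] [_ cV Vext hp_ hVN VA Vder Vder'].
move=> phi [aphi0 phimin0] gamma N g gam0 N2 cg lg g0.
have N0 : (0 < N)%N by exact: ltnW.
have n0 : 0 < N%:R :> R by rewrite ltr0n.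
have /andP[q0 q1] := hq N N0; have pN0 := hp_ N N0; have hMN := hM N N0.
have hV := hVN N N0; move: hV hMN q0 q1 pN0.
move: (M_ N) (q_ N) (V_ N) (p_ N) => M q VN pN hV hMN q0 q1 pN0 {hq hM hVN hp_}.
set s := MM + theta in cV Vext VA Vder Vder' aphi0 phimin0 *.
have MM0 : 0 < MM by exact: lt_le_trans aMM.
have ths : theta <= s by rewrite lerDr ltW.
have s0 : 0 < s by exact: lt_le_trans ths.
have A1q : A1 * q <= A1 by rewrite -[leRHS]mulr1 ler_wpM2l// ltW.
have /andP[hMN1 hMN2] : MM - A1 * q <= M%:R / N%:R <= MM + A1 * q.
  move: hMN; rewrite mulrC ler_norml => /andP[h1 h2].
  by apply/andP; split; [move: h1|move: h2]; clear; lra.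
have sK : s <= K by rewrite /s /K lerD2r; move: MMA hA1; clear; lra.
have MNb : M%:R / N%:R <= A0 + A1 by move: hMN2 A1q MMA; clear; lra.
have bK : M%:R / N%:R + theta <= K by rewrite /K lerD2r.
have rV : regular_potential s A3 A4 V.
  split; [exact: cV|exact: VA|exact: Vder|].
  move=> u hu; have := Vder' u hu; rewrite /s opprD addrA; exact.
set phit := truncate theta s phi.
have aphi : adm theta s phit := truncate_adm htheta aphi0.
have phimin h : adm theta s h -> adm_energy theta s V phit <= adm_energy theta s V h.
  move=> ah; rewrite -(energyE V ah) -(truncate_energy htheta (ltW s0) aphi0 cV).
  by apply: phimin0; exact: adm_admissible.
have mhm : 1 <= m%:R * theta.
  have := truncnS_gt theta^-1; rewrite -/m => /ltW h.
  by have := ler_wpM2r (ltW htheta) h; rewrite mulVf ?gt_eqF.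
have [lam0 st0 hlam0] := configuration_energy_ge N0 htheta ths sK bK hA4 rV aphi mhm.
have [w0 w2d lnw] := smearing_scale htheta hp N2.
set w := theta / _ in w0 w2d lnw.
have hVc (lam : N.-tuple 'I_M.+1) i :
    `|VN (particle theta lam i) - V (clamp s (particle theta lam i))| <= A2 * pN.
  have [x0 x1] := particle_bounds lam i N0 htheta.
  set x := particle theta lam i in x0 x1 *.
  have -> : V (clamp s x) = V x.
    case: (leP x s) => xs; first by rewrite clamp_id// x0 xs.
    by rewrite /clamp min_r ?(ltW xs)// max_r ?(ltW s0)// Vext// ltW.
  apply: hV; rewrite /IN /= in_itv/= x0/=.
  have -> : N.-1%:R / N%:R * theta = theta - theta / N%:R :> R.
    by rewrite -subn1 natrB//; field; rewrite gt_eqF.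
  by move: x1; clear; lra.
have lw lam st := @log_weight_coulomb R theta N M VN V s (A2 * pN) lam N0 htheta st (hVc lam).
set cN := pair_sum N (fun _ _ => _) in lw; rewrite -/Qc in lw.
set e1 := Qc * _ + _ in lw.
rewrite -/(coulomb theta N V s (particle theta lam0)) in hlam0.
set errL := theta * _ + _ + _ in hlam0.
set I0 := N%:R ^+ 2 * adm_energy _ _ _ _ in hlam0.
pose errU := 2 * theta * (N%:R * (1 + ln N%:R)) + theta * (N%:R * (8 - ln w))
     + N%:R * growth_bound A4 s
     + 4 * theta * (N%:R ^+ 2 * modulus_bound theta K (theta / N%:R))
     + N%:R ^+ 2 * ((A3 + 2 * potbound K) *
         (2 * (theta^-1 * Num.max 0 (M%:R / N%:R + theta - s)))).
pose G := 2 * pi ^+ 2 * gamma ^+ 2 * theta * N%:R ^+ 2.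
have lo : cN + (- I0 - errL) - e1 <= log_weight theta VN lam0.
  by have := lw lam0 st0; rewrite ler_norml => /andP[h _]; move: h hlam0; clear; lra.
have mg : measurable_fun setT g.
  have [_ gL] := lipschitz_norm_lip lg.
  by apply: continuous_measurable_fun; exact: continuous_lip gL.
apply: le_trans (@gibbs_tail R theta N M VN _ lam0 _ (cN + (- G - I0 + errU) + e1) htheta st0 lo _) _.
  move=> lam st; rewrite (truncate_int htheta aphi0 mg) -/phit => event.
  have hc : coulomb theta N V s (particle theta lam) <= - G - I0 + errU.
    apply: (coulomb_event_le N0 htheta ths sK bK hA4 rV aphi phimin cg lg g0 gam0 w0 w2d st).
    by move: event; rewrite mulrAC (mulrC _ (norm_lip g)).
  by have := lw lam st; rewrite ler_norml => /andP[_ h]; move: h hc; clear; lra.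
rewrite ler_expR -/G.
have l0 : 0 <= ln N%:R :> R by rewrite ln_ge0// ler1n.
have hX D : D <= A1 * q -> (A3 + 2 * potbound K) * (2 * (theta^-1 * D)) <= X * q.
  move=> Dq; rewrite /X -mulrA; apply: ler_wpM2l.
    by rewrite addr_ge0 ?mulr_ge0 ?potbound_ge0 ?(ltW hA3).
  rewrite -mulrA ler_wpM2l// -mulrA ler_wpM2l//; exact: ltW.
have hTs : growth_bound A4 s <= T := growth_bound_le (ltW hA4) (ltW s0) sK.
have D1 : Num.max 0 (M%:R / N%:R + theta - s) <= A1 * q.
  by rewrite ge_max mulr_ge0 ?(ltW hA1)//=; rewrite /s; move: hMN2; clear; lra.
have D2 : Num.max 0 (s - (M%:R / N%:R + theta)) <= A1 * q.
  by rewrite ge_max mulr_ge0 ?(ltW hA1)//=; rewrite /s; move: hMN1; clear; lra.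
have n2 : 0 <= N%:R ^+ 2 :> R by rewrite exprn_ge0// ltW.
have hU : errU <= N%:R * (2 * theta + theta * (8 + `|ln theta|) + T + 4 * theta * (24 + 4 * `|lK|))
    + N%:R * ln N%:R * (2 * theta + theta * p + 16 * theta) + X * (N%:R ^+ 2 * q).
  have := @upper_error_le R theta p K q N%:R (ln N%:R) T X q lK htheta n0 l0 q0 X0 (lexx q) erefl K0 erefl.
  apply: le_trans; rewrite /errU lnw.
  by apply: lerD; [apply: lerD => //; apply: lerD => //; exact: (ler_wpM2l (ltW n0) hTs)|exact: (ler_wpM2l n2 (hX _ D1))].
have hL : errL <= N%:R * (theta * (2 * (K + 1) + `|ln theta|) + 2 + m.+1%:R * T)
    + N%:R * ln N%:R * (theta + 2) + X * (N%:R ^+ 2 * q).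
  have := @lower_error_le R theta K (M%:R / N%:R + theta) q N%:R (ln N%:R) T T X q m.+1%:R htheta
    n0 l0 q0 X0 (lexx q) bK (ler0n _ _).
  apply: le_trans; rewrite /errL.
  apply: lerD; last exact: (ler_wpM2l n2 (hX _ D2)).
  apply: lerD => //; exact: (ler_wpM2l (ltW n0) (ler_wpM2l (ler0n _ _) hTs)).
have hS := ler_wpM2l (ltW n0) (ln_states_le N0 MNb); rewrite -/cS in hS.
(* ln N >= ln 2 absorbs the terms of order N. *)
have hn : N%:R <= N%:R * ln N%:R / ln 2 :> R.
  rewrite ler_pdivlMr// ler_wpM2l ?(ltW n0)// ler_ln ?posrE ?ltr0n//.
  by rewrite ler_nat.
have hc0 := ler_wpM2l c00 hn.
have P20 : 0 <= N%:R ^+ 2 * pN by rewrite mulr_ge0.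
have Q20 : 0 <= N%:R ^+ 2 * q by rewrite mulr_ge0.
have r0 : 0 <= N%:R * ln N%:R :> R by rewrite mulr_ge0// ltW.
have hS' : N%:R * ln M.+1%:R <= N%:R * ln N%:R + N%:R * cS by rewrite -mulrDr.
have hc0' : c0 * N%:R <= c0 / ln 2 * (N%:R * ln N%:R).
  move: hc0; move: (c0) (N%:R * ln N%:R) ((ln 2)^-1 : R) => a b c; clear.
  by have -> : a * (b * c) = a * c * b by ring.
have := combine_errors r0 P20 Q20 X0 (ltW hA2) (divr_ge0 c00 (ltW l2)) c10 hU hL hS' hc0'.
rewrite -/c1 -/c0; set C := _ + _ + 1.
have -> : 2 * (Qc * (N%:R + N%:R * ln N%:R) + A2 * (N%:R ^+ 2 * pN)) = 2 * e1.
  by rewrite /e1; move: (Qc) (ln N%:R); clear => a b; ring.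
move: (C * _) (errU) (errL) => Z a b; move: (N%:R * ln M.+1%:R) => d.
by move: (cN) (I0) (e1) (G) => x y z t; clear; lra.
Qed.
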